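(* Let $\mathcal{G}$ be an ultragraph, let $E$ be a directed graph constructed from $\mathcal{G}$ as described in the context, and let $\phi\colon C^*(\mathcal{G})\to C^*(E)$ be the homomorphism with $\phi(p_v)=P_v$ for $v\in G^0$ and $\phi(s_e)=S_e$ for $e\in\mathcal{G}^1$. Let $I$ be an ideal of $C^*(\mathcal{G})$. Then $I$ is invariant under the gauge action on $C^*(\mathcal{G})$ if and only if the ideal of $C^*(E)$ generated by $\phi(I)$ is invariant under the gauge action on $C^*(E)$.
   Context: Ideals are closed and two-sided. $\mathbb{N}=\{1,2,\dots\}$. An ultragraph $\mathcal{G}=(G^0,\mathcal{G}^1,r,s)$ consists of a countable set of vertices $G^0$, a countable set of edges $\mathcal{G}^1$, and functions $s\colon\mathcal{G}^1\to G^0$ and $r\colon\mathcal{G}^1\to\mathcal{P}(G^0)\setminus\{\emptyset\}$. Ultragraph algebra. $C^*(\mathcal{G})$ is the universal $C^*$-algebra generated by an Exel-Laca $\mathcal{G}$-family, i.e. projections $\{p_v:v\in G^0\}$ and partial isometries $\{s_e:e\in\mathcal{G}^1\}$ with mutually orthogonal final projections such that, writing $q_e:=s_e^*s_e$: (1) the $p_v$ are pairwise orthogonal; the $q_e$ pairwise commute; $p_vq_e=p_v$ if $v\in r(e)$ and $p_vq_e=0$ if $v\notin r(e)$; and $\prod_{e\in\lambda}q_e\prod_{f\in\mu}(1-q_f)=\sum_{v\in r(\lambda,\mu)}p_v$ for all finite $\lambda,\mu\subset\mathcal{G}^1$ with $\lambda\cap\mu=\emptyset$, $\lambda\ne\emptyset$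 and $r(\lambda,\mu):=\bigcap_{e\in\lambda}r(e)\setminus\bigcup_{f\in\mu}r(f)$ finite; (2) $s_es_e^*\le p_{s(e)}$ for all $e$; (3) $p_v=\sum_{s(e)=v}s_es_e^*$ whenever $s^{-1}(v)$ is finite and nonempty. The gauge action of $\mathbb{T}$ on $C^*(\mathcal{G})$ fixes each $p_v$ and sends $s_e$ to $zs_e$. The graph $E$. Fix an enumeration $\mathcal{G}^1=\{e_1,e_2,\dots\}$ (finite or infinite, without repetition); if $\mathcal{G}^1$ is finite, put $r(e_n):=\emptyset$ for $n>|\mathcal{G}^1|$ (used only for defining $r(\omega)$). For $\omega\in\{0,1\}^n$ write $|\omega|=n$, $\omega|_m=(\omega_1,\dots,\omega_m)$ for $m\le n$, $0^n=(0,\dots,0)$; $(0^n,1)$ is $0^n$ followed by $1$, and $(0^0,1)=(1)$. For $\omega\in\{0,1\}^n\setminus\{0^n\}$ put $r(\omega):=\bigcap_{\omega_i=1}r(e_i)\setminus\bigcup_{\omega_j=0}r(e_j)$. Let $\Delta_n:=\{\omega\in\{0,1\}^n\setminus\{0^n\}:|r(\omega)|=\infty\}$, $\Delta:=\bigsqcup_{n\ge1}\Delta_n$, $\Gamma_0:=\{(0^n,1):n\ge0,\ |r(0^n,1)|=\infty\}$, $\Gamma_+:=\Delta\setminus\Gamma_0$, $W_+:=\bigcup_{\omega\in\Delta}r(\omega)$, $W_0:=G^0\setminus W_+$. Fix a function $\sigma\colon W_+\to\Delta$ such that $v\in r(\sigma(v))$ for all $v\in W_+$ and $\sigma^{-1}(\omega)$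 is finite for all $\omega\in\Delta$ (such functions exist); extend it by $\sigma(v)=\emptyset$ for $v\in W_0$, with $|\emptyset|=0$. For $e_n\in\mathcal{G}^1$ let $X(e_n):=\{v\in r(e_n):|\sigma(v)|<n\}\sqcup\{\omega\in\Delta_n:\omega_n=1\}$; this set is finite and nonempty. The graph $E=(E^0,E^1,r_E,s_E)$ has $E^0=G^0\sqcup\Delta$, $E^1=\{\overline{x}:x\in W_+\sqcup\Gamma_+\}\sqcup\{(e_n,x):e_n\in\mathcal{G}^1,\ x\in X(e_n)\}$, $r_E(\overline{x})=x$, $r_E((e_n,x))=x$, $s_E(\overline{v})=\sigma(v)$ for $v\in W_+$, $s_E(\overline{\omega})=\omega|_{|\omega|-1}$ for $\omega\in\Gamma_+$, $s_E((e_n,x))=s(e_n)$. Graph algebra. $C^*(E)$ is the universal $C^*$-algebra generated by mutually orthogonal projections $\{q_x:x\in E^0\}$ and partial isometries $\{t_\alpha:\alpha\in E^1\}$ with mutually orthogonal ranges such that $t_\alpha^*t_\alpha=q_{r_E(\alpha)}$, $t_\alpha t_\alpha^*\le q_{s_E(\alpha)}$, and $q_x=\sum_{s_E(\alpha)=x}t_\alpha t_\alpha^*$ whenever $s_E^{-1}(x)$ is finite and nonempty. The gauge action of $\mathbb{T}$ on $C^*(E)$ fixes each $q_x$ and sends $t_\alpha$ to $zt_\alpha$ for every $\alpha\in E^1$. For a path $\alpha=\alpha_1\cdots\alpha_n$ (with $s_E(\alpha_{i+1})=r_E(\alpha_i)$), $t_\alpha:=t_{\alpha_1}\cdots t_{\alpha_n}$;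 vertices are paths of length $0$ with $t_x:=q_x$. The homomorphism. For $x\in E^0$ let $f_x$ be the path: $f_x:=x$ if $x\in W_0\sqcup\Gamma_0$; $f_\omega:=\overline{\omega|_{m+1}}\,\overline{\omega|_{m+2}}\cdots\overline{\omega}$ with $m=\min\{k:\omega_k=1\}$ if $\omega\in\Gamma_+$; $f_v:=f_{\sigma(v)}\overline{v}$ if $v\in W_+$. Let $U_x:=t_{f_x}$, $P_v:=U_vU_v^*$ for $v\in G^0$, and $S_{e_n}:=U_{s(e_n)}\sum_{x\in X(e_n)}t_{(e_n,x)}U_x^*$ for $e_n\in\mathcal{G}^1$. These form an Exel-Laca $\mathcal{G}$-family, so $\phi$ exists by universality; it is an isomorphism of $C^*(\mathcal{G})$ onto a full corner of $C^*(E)$. *)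

(* Defs.v *)
From HB Require Import structures.
From mathcomp Require Import all_boot all_order all_algebra.
From mathcomp Require Import complex.
From mathcomp Require Import all_classical all_reals all_analysis.

Set Implicit Arguments.
Unset Strict Implicit.
Unset Printing Implicit Defensive.

Import Order.TTheory GRing.Theory Num.Theory.
Import numFieldNormedType.Exports.

Local Open Scope classical_set_scope.
Local Open Scope ring_scope.

(* C*-algebras need not be unital, so the product is a separate operation on a
   complex Banach space and not a MathComp ring multiplication.  The norm takes
   its values in the nonnegative reals of [complex R]. *)
HB.mixin Record isCStar (R : realType) A
    & CompleteNormedModule (complex R) A := {
  cmul : A -> A -> A;
  cstar : A -> A;
  cmulA : associative cmul;
  cmulDl : left_distributive cmul +%R;
  cmulDr : right_distributive cmul +%R;
  cmulZl : forall (c : complex R) (a b : A), cmul (c *: a) b = c *: cmul a b;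
  cmulZr : forall (c : complex R) (a b : A), cmul a (c *: b) = c *: cmul a b;
  cstarK : involutive cstar;
  cstarD : {morph cstar : a b / a + b};
  cstarZ : forall (c : complex R) (a : A), cstar (c *: a) = Num.conj c *: cstar a;
  cstarM : forall a b : A, cstar (cmul a b) = cmul (cstar b) (cstar a);
  cnormM : forall a b : A, `|cmul a b| <= `|a| * `|b|;
  cnorm_star : forall a : A, `|cmul (cstar a) a| = `|a| ^+ 2
}.

#[short(type="cstarType")]
HB.structure Definition CStar (R : realType) :=
  {A of isCStar R A & CompleteNormedModule (complex R) A}.

Declare Scope cstar_scope.
Delimit Scope cstar_scope with cstar.
Notation "a ** b" := (cmul a b) (at level 40, left associativity) : cstar_scope.
Notation "a ^*" := (cstar a) : cstar_scope.
Local Open Scope cstar_scope.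

Section CStarTheory.
Variable R : realType.
Implicit Types A B : cstarType R.

Record star_hom A B (h : A -> B) : Prop := {
  star_hom_linear : linear h;
  star_homM : forall a b, h (a ** b) = h a ** h b;
  star_hom_star : forall a, h (a^*) = (h a)^*
}.

Record closed_subspace A (I : set A) : Prop := {
  subspace0 : I 0;
  subspaceD : forall a b, I a -> I b -> I (a + b);
  subspaceZ : forall (c : complex R) a, I a -> I (c *: a);
  subspace_closed : closed I
}.

Record closed_subalgebra A (S : set A) : Prop := {
  subalgebra_subspace : closed_subspace S;
  subalgebraM : forall a b, S a -> S b -> S (a ** b);
  subalgebraV : forall a, S a -> S (a^*)
}.

Record closed_ideal A (I : set A) : Prop := {
  ideal_subspace : closed_subspace I;
  idealMl : forall a b, I b -> I (a ** b);
  idealMr : forall a b, I a -> I (a ** b)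
}.

Definition ideal_generated A (S : set A) : set A :=
  \bigcap_(J in [set J | closed_ideal J /\ S `<=` J]) J.

Definition generates A (S : set A) : Prop :=
  forall T, closed_subalgebra T -> S `<=` T -> T = setT.

Definition projection A (p : A) : Prop := p^* = p /\ p ** p = p.

Definition partial_isometry A (s : A) : Prop := s ** s^* ** s = s.

Definition ple A (p q : A) : Prop := p ** q = p.

(* An action of the circle group, given on all complex numbers but constrained
   only on those of modulus 1.  Strong continuity is not listed: for the gauge
   actions below it follows from the values on generators. *)
Record circle_action A (g : complex R -> A -> A) : Prop := {
  circle_action_hom : forall z, `|z| = 1 -> star_hom (g z);
  circle_action1 : forall a, g 1 a = a;
  circle_actionM : forall z w a, `|z| = 1 -> `|w| = 1 ->
    g (z * w) a = g z (g w a)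
}.

Definition action_invariant A (g : complex R -> A -> A) (I : set A) : Prop :=
  forall z, `|z| = 1 -> forall a, I a -> I (g z a).

Section GaugeAction.
Variables (V E : Type) (A : cstarType R) (p : V -> A) (s : E -> A).

(* Automatically unique when the [p v] and [s e] generate [A]. *)
Record gauge_action (g : complex R -> A -> A) : Prop := {
  gauge_circle : circle_action g;
  gauge_vertex : forall z v, `|z| = 1 -> g z (p v) = p v;
  gauge_edge : forall z e, `|z| = 1 -> g z (s e) = z *: s e
}.

(* [(A, p, s)] is the universal C*-algebra generated by a family of elements
   satisfying the relations [fam]. *)
Record universal (fam : forall B : cstarType R, (V -> B) -> (E -> B) -> Prop)
    : Prop := {
  universal_family : fam A p s;
  universal_generated : generates (range p `|` range s);
  universal_hom : forall (B : cstarType R) (p' : V -> B) (s' : E -> B),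
    fam B p' s' -> exists h : A -> B,
      [/\ star_hom h, forall v, h (p v) = p' v & forall e, h (s e) = s' e]
}.

End GaugeAction.

End CStarTheory.

Record ultragraph := Ultragraph {
  uvertex : countType;
  uedge : countType;
  urange : uedge -> set uvertex;
  usource : uedge -> uvertex;
  urange_neq0 : forall e, urange e !=set0
}.

Section ExelLaca.
Variables (R : realType) (G : ultragraph) (A : cstarType R).
Variables (p : uvertex G -> A) (s : uedge G -> A).

Let q (e : uedge G) : A := (s e)^* ** s e.

Definition rfin (lam mu : seq (uedge G)) : set (uvertex G) :=
  (\bigcap_(e in [set` lam]) urange e) `\` \bigcup_(f in [set` mu]) urange f.

(* The product of the [q e] over the nonempty list [e0 :: lam] and of the
   [1 - q f] over [mu], where [a (1 - q f)] is expanded to [a - a (q f)]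
   because [A] may have no unit. *)
Definition qprod (e0 : uedge G) (lam mu : seq (uedge G)) : A :=
  foldl (fun a f => a - a ** q f) (foldl (fun a e => a ** q e) (q e0) lam) mu.

Record exel_laca_family : Prop := {
  el_proj : forall v, projection (p v);
  el_pisom : forall e, partial_isometry (s e);
  el_final_orth : forall e f, e != f ->
    (s e ** (s e)^*) ** (s f ** (s f)^*) = 0;
  el_vertex_orth : forall v w, v != w -> p v ** p w = 0;
  el_q_comm : forall e f, q e ** q f = q f ** q e;
  el_vertex_in : forall v e, urange e v -> p v ** q e = p v;
  el_vertex_out : forall v e, ~ urange e v -> p v ** q e = 0;
  (* finite sets of edges are presented by duplicate-free lists *)
  el_qprod : forall (e0 : uedge G) (lam mu : seq (uedge G)),
    uniq (e0 :: lam) -> uniq mu -> ~~ has (mem mu) (e0 :: lam) ->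
    finite_set (rfin (e0 :: lam) mu) ->
    qprod e0 lam mu = \sum_(v \in rfin (e0 :: lam) mu) p v;
  el_final_le : forall e, ple (s e ** (s e)^*) (p (usource e));
  el_sum : forall v, finite_set [set e | usource e = v] ->
    [set e | usource e = v] !=set0 ->
    p v = \sum_(e \in [set e | usource e = v]) (s e ** (s e)^*)
}.

End ExelLaca.

Definition ultragraph_algebra (R : realType) (G : ultragraph) (A : cstarType R)
    (p : uvertex G -> A) (s : uedge G -> A) : Prop :=
  universal p s (fun B => @exel_laca_family R G B).

Record digraph := Digraph {
  dvertex : countType;
  dedge : countType;
  drange : dedge -> dvertex;
  dsource : dedge -> dvertex
}.

Section CuntzKrieger.
Variables (R : realType) (E : digraph) (A : cstarType R).
Variables (q : dvertex E -> A) (t : dedge E -> A).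

Record cuntz_krieger_family : Prop := {
  ck_proj : forall x, projection (q x);
  ck_pisom : forall a, partial_isometry (t a);
  ck_vertex_orth : forall x y, x != y -> q x ** q y = 0;
  ck_final_orth : forall a b, a != b ->
    (t a ** (t a)^*) ** (t b ** (t b)^*) = 0;
  ck_initial : forall a, (t a)^* ** t a = q (drange a);
  ck_final_le : forall a, ple (t a ** (t a)^*) (q (dsource a));
  ck_sum : forall x, finite_set [set a | dsource a = x] ->
    [set a | dsource a = x] !=set0 ->
    q x = \sum_(a \in [set a | dsource a = x]) (t a ** (t a)^*)
}.

(* A path is its initial vertex together with its list of edges. *)
Definition tpath (f : dvertex E * seq (dedge E)) : A :=
  if f.2 is a :: l then foldl cmul (t a) [seq t b | b <- l] else q f.1.

End CuntzKrieger.

Definition graph_algebra (R : realType) (E : digraph) (A : cstarType R)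
    (q : dvertex E -> A) (t : dedge E -> A) : Prop :=
  universal q t (fun B => @cuntz_krieger_family R E B).

(* [num e = n] means that [e] is the edge [e_n]; numbering starts at 1 and has
   no gaps. *)
Record enumeration (G : ultragraph) := Enumeration {
  num :> uedge G -> nat;
  num_gt0 : forall e, (0 < num e)%N;
  num_inj : injective num;
  num_nogap : forall e n, (0 < n <= num e)%N -> exists f, num f = n
}.

(* The letter [w_i], with positions counted from 1. *)
Definition bit (w : seq bool) (i : nat) : bool := nth false w i.-1.

Section Words.
Variables (G : ultragraph) (num : enumeration G).

(* [r(e_n)], which is empty when [n] exceeds the number of edges. *)
Definition rnum (n : nat) : set (uvertex G) :=
  [set v | exists2 e, num e = n & urange e v].

Definition rword (w : seq bool) : set (uvertex G) :=
  (\bigcap_(i in [set i | (1 <= i <= size w)%N && bit w i]) rnum i) `\`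
  \bigcup_(j in [set j | (1 <= j <= size w)%N && ~~ bit w j]) rnum j.

Definition Delta : set (seq bool) :=
  [set w | w <> nseq (size w) false /\ infinite_set (rword w)].

Definition Gamma0 : set (seq bool) :=
  [set w | exists2 n, w = rcons (nseq n false) true & infinite_set (rword w)].

Definition Gammap : set (seq bool) := Delta `\` Gamma0.

Definition Wp : set (uvertex G) := \bigcup_(w in Delta) rword w.

Definition W0 : set (uvertex G) := ~` Wp.

Record sigma_map := SigmaMap {
  sigma :> uvertex G -> seq bool;
  sigma_Delta : forall v, Wp v -> Delta (sigma v);
  sigma_rword : forall v, Wp v -> rword (sigma v) v;
  sigma_fin : forall w, Delta w -> finite_set [set v | Wp v /\ sigma v = w];
  sigma_W0 : forall v, W0 v -> sigma v = [::]
}.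

Lemma rword_take (w : seq bool) (k : nat) : rword w `<=` rword (take k w).
Proof.
have bitE i : (1 <= i <= size (take k w))%N ->
    (1 <= i <= size w)%N /\ bit (take k w) i = bit w i.
  case: i => [//|i] /= hi.
  have hk : (i < k)%N by apply: leq_trans hi _; rewrite size_take_min geq_minl.
  have hw : (i < size w)%N.
    by apply: leq_trans hi _; rewrite size_take_min geq_minr.
  by split=> //; rewrite /bit /= nth_take.
move=> v [h1 h2]; split.
  move=> i /= /andP[hi bi]; have [hi' be] := bitE i hi.
  by apply: h1; rewrite /= hi' -be.
move=> [i /= /andP[hi bi] hv]; have [hi' be] := bitE i hi.
by apply: h2; exists i; rewrite //= hi' -be.
Qed.

Lemma has_idP (w : seq bool) : w <> nseq (size w) false <-> has id w.
Proof.
split=> [h|]; last first.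
  by move=> + e; rewrite e has_nseq /= andbF.
apply/negPn/negP => hn; apply: h; apply/all_pred1P.
move: hn; rewrite -all_predC; apply: sub_all => b /=.
by case: b.
Qed.

Lemma Delta_take (w : seq bool) (k : nat) :
  Delta w -> has id (take k w) -> Delta (take k w).
Proof.
move=> [_ hi] hk; split; first exact/has_idP.
by apply: sub_infinite_set hi; exact: rword_take.
Qed.

Lemma first1P (n : nat) (w : seq bool) :
  w = rcons (nseq n false) true -> index true w = n.
Proof.
move=> ->; rewrite -cats1 index_cat mem_nseq andbF size_nseq /=.
by rewrite addn0.
Qed.

(* [m = min {k : w_k = 1}] is [(index true w).+1]. *)
Lemma Delta_first (w : seq bool) :
  Delta w -> Delta (take (index true w).+1 w).
Proof.
move=> dw; apply: Delta_take => //.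
have hw : true \in w by have /has_idP/hasP[b bw] := dw.1; case: b bw.
apply/hasP; exists true => //.
by rewrite in_take // ltnSn.
Qed.

Lemma Gammap_take (w : seq bool) (k : nat) :
  Delta w -> ((index true w).+1 < k <= size w)%N -> Gammap (take k w).
Proof.
move=> dw /andP[mk kw].
have hw : true \in w by have /has_idP/hasP[b bw] := dw.1; case: b bw.
have tk : true \in take k w by rewrite in_take //; exact: ltnW.
split; first by apply: Delta_take => //; apply/hasP; exists true.
move=> [n e _].
have si : size (take k w) = n.+1 by rewrite e size_rcons size_nseq.
rewrite size_takel // in si.
have := first1P e.
rewrite -{1}(cat_take_drop k w) index_cat tk in mk.
by move=> en; move: mk; rewrite en si ltnn.
Qed.

Lemma Gammap_belast (w : seq bool) :
  Gammap w -> Delta (take (size w).-1 w).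
Proof.
move=> [dw gw]; apply: Delta_take => //.
apply: contrapT => hn; apply: gw; exists (size w).-1; last exact: dw.2.
have hw := (has_idP w).1 dw.1.
case/lastP: w hw hn {dw} => [//|w b]; rewrite size_rcons /= -cats1.
rewrite take_size_cat // has_cat /= orbF => /orP[//|bt] hn.
rewrite bt cats1; congr rcons.
by apply: contrapT => /has_idP.
Qed.

Variable sig : sigma_map.

Definition E0 : Type := (uvertex G + Delta)%type.

Definition WGp : set E0 :=
  [set x | match x with inl v => Wp v | inr w => Gammap (val w) end].

Definition Xset (e : uedge G) : set E0 :=
  [set x | match x with
           | inl v => urange e v /\ (size (sig v) < num e)%N
           | inr w => size (val w) = num e /\ bit (val w) (num e)
           end].

Definition E1 : Type := (WGp + {e : uedge G & Xset e})%type.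

Definition DeltaV (w : seq bool) (dw : Delta w) : Delta :=
  exist _ w (mem_set dw).

Definition sbar (x : E0) : WGp x -> E0 :=
  match x with
  | inl v => fun hv => inr (DeltaV (sigma_Delta sig hv))
  | inr w => fun hw => inr (DeltaV (Gammap_belast hw))
  end.

Definition sE (a : E1) : E0 :=
  match a with
  | inl x => sbar (set_valP x)
  | inr ex => inl (usource (tag ex))
  end.

Definition rE (a : E1) : E0 :=
  match a with
  | inl x => val x
  | inr ex => val (tagged ex)
  end.

Definition ugraph_graph : digraph := @Digraph E0 E1 rE sE.

Definition bar (x : E0) (hx : WGp x) : E1 := inl (exist _ x (mem_set hx)).

Definition eedge (e : uedge G) (x : Xset e) : E1 :=
  inr (existT (fun e => set_type (Xset e)) e x).

Lemma bar_word_subproof (w : Delta)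
    (i : 'I_(size (val w) - (index true (val w)).+1)) :
  Gammap (take ((index true (val w)).+1 + i.+1) (val w)).
Proof.
apply: Gammap_take; first exact: set_valP.
have := ltn_ord i; rewrite ltn_subRL => h.
by rewrite addnS ltnS leq_addr.
Qed.

Definition bar_word (w : Delta)
    (i : 'I_(size (val w) - (index true (val w)).+1)) : E1 :=
  let h := bar_word_subproof i in @bar (inr (DeltaV h.1)) h.

(* With [m = (index true w).+1], the path with edges the bars of
   [w|_(m+1), ..., w] starting at [w|_m].  For [w] in [Gamma0], [m = size w]
   and this is the path of length 0 at [w]. *)
Definition fword (w : Delta) : E0 * seq E1 :=
  (inr (DeltaV (Delta_first (set_valP w))),
   [seq bar_word i | i <- enum 'I_(size (val w) - (index true (val w)).+1)]).

Definition fvertex (x : E0) : E0 * seq E1 :=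
  match x with
  | inr w => fword w
  | inl v =>
    match pselect (Wp v) with
    | left hv =>
      let f := fword (DeltaV (sigma_Delta sig hv)) in
      (f.1, rcons f.2 (@bar (inl v) hv))
    | right _ => (inl v, [::])
    end
  end.

Section Family.
Variables (R : realType) (B : cstarType R).
Variables (q : dvertex ugraph_graph -> B) (t : dedge ugraph_graph -> B).

Definition Upath (x : E0) : B := tpath q t (fvertex x).

Definition Pvertex (v : uvertex G) : B := Upath (inl v) ** (Upath (inl v))^*.

Definition Sedge (e : uedge G) : B :=
  Upath (inl (usource e)) **
    \sum_(x \in [set: Xset e]) (t (eedge x) ** (Upath (val x))^*).

End Family.
End Words.

(* Main.v *)
From HB Require Import structures.
Require Import Defs.
From mathcomp Require Import all_boot all_order all_algebra complex.
From mathcomp Require Import all_classical all_reals all_analysis.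
From mathcomp Require Import ring lra zify.

Set Implicit Arguments.
Unset Strict Implicit.
Unset Printing Implicit Defensive.

Import Order.TTheory GRing.Theory Num.Theory.
Import numFieldNormedType.Exports.

Local Open Scope classical_set_scope.
Local Open Scope ring_scope.
Local Open Scope cstar_scope.
Local Notation "a ^*" := (cstar a) : ring_scope.

(** The two gauge actions do not match under [phi]: on [C^*(E)] every edge has
    degree 1, whereas the bar edges stem from no edge of the ultragraph. The
    proof goes through a third circle action [beta] on [C^*(E)], which fixes
    the bars and multiplies [t_(e, x)] by [z]. The paths [f_x] consist of bars
    only, so [U_x] is fixed by [beta] and [beta_z (phi a) = phi (gamma_z a)]
    ([corner_gauge]). Write [J] for the ideal generated by [phi(I)].

    The equality [I = phi^-1(J)] ([corner_ideal]) makes the invariance of [I]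
    under the gauge action equivalent to that of [J] under [beta]
    ([corner_invariant]). To prove it, a homomorphism [psi] from [C^*(E)] to
    the algebra of adjointable operators on square-summable sequences in
    [C^*(G)] is constructed with [psi (phi a)] equal to [a] placed in the
    corner (0, 0) of an infinite matrix; the operators with matrix
    coefficients in [I] form an ideal whose preimage contains [J], and whose
    corner is [I]. The homomorphism [psi] is given by a Cuntz-Krieger family:
    every vertex [x] of [E] has a projection [R_x] in [C^*(G)] ([Rvertex]),
    which is [p_v] for a vertex [v], and which for a word [w] is the projection
    of [r(w)] without the finitely many vertices that [sigma] assigns to
    shorter words. One places [R_x] at the diagonal position given by the
    length of [f_x], a bar with range [x] one step off the diagonal, and
    [s_e R_x] in the remaining case ([stab_family]). The relations amount to
    [R_w = sum R_x] over the bars leaving [w] ([bar_sum]) and to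
    [s_e^* s_e = sum R_x] over [X(e)] ([Xset_sum]).

    It remains to see that [J] is invariant under [beta] if and only if it is
    invariant under the gauge action of [C^*(E)]. More generally, let [kappa]
    and [lambda] be circle actions multiplying each [t_a] by powers of [z] with
    exponents [k a] and [l a]. If among the paths over a finite set of edges
    those of bounded [k]-degree have bounded length, then every
    [kappa]-invariant ideal is [lambda]-invariant ([weighted_action_ideal]).
    The reason is that [lambda_w] is approximately inner on elements that are
    homogeneous for [kappa]: for a path [mu] in a finite subgraph,
    [lambda_w (t_mu) = U_m t_mu U_(m')^*] with
    [U_m = sum w^(l nu) t_nu (...) t_nu^*] over the paths [nu] of [k]-degree at
    most [m], a finite sum, and [m - m' = k mu]. An element of a
    [kappa]-invariant ideal is a limit of Fejer means of its spectral
    components, which lie in the ideal, and approximate innerness keeps their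
    images under [lambda_w] in it. The condition on degrees holds for the gauge
    action, where the degree is the length, and for [beta], since a bar
    increases the length of [f_x] by one and this length is bounded over
    finitely many edges ([finite_degree_edge_weight]).

    The operator algebra above has to be shown to be a C*-algebra. The
    Cauchy-Schwarz inequality for sequences rests on the positivity of
    [c^* c] ([pos_star]), proved with square roots obtained as fixed points of
    contractions; the same square roots give the continuity of
    homomorphisms. *)

(** * Identities in abelian groups *)

Inductive zexpr := ZVar of nat | ZZero | ZAdd of zexpr & zexpr | ZOpp of zexpr.

Fixpoint zeval (V : zmodType) (env : seq V) (e : zexpr) : V :=
  match e with
  | ZVar i => env`_i
  | ZZero => 0
  | ZAdd a b => zeval env a + zeval env b
  | ZOpp a => - zeval env a
  end.

Fixpoint zcount (i : nat) (e : zexpr) : nat * nat :=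
  match e with
  | ZVar j => (nat_of_bool (i == j)%N, 0%N)
  | ZZero => (0%N, 0%N)
  | ZAdd a b => let: (p, n) := zcount i a in let: (p', n') := zcount i b in
                ((p + p')%N, (n + n')%N)
  | ZOpp a => let: (p, n) := zcount i a in (n, p)
  end.

Lemma zevalE (V : zmodType) (env : seq V) (e : zexpr) :
  zeval env e =
  \sum_(i < size env) (env`_i *+ (zcount i e).1 - env`_i *+ (zcount i e).2).
Proof.
elim: e => [j||a iha b ihb|a iha] /=.
- have [jn|jn] := ltnP j (size env); last first.
    rewrite nth_default// big1// => i _; rewrite subr0.
    have -> : ((i : nat) == j) = false by rewrite ltn_eqF// (leq_trans (ltn_ord i)).
    by rewrite mulr0n.
  rewrite (bigD1 (Ordinal jn))//= eqxx subr0 mulr1n big1 ?addr0// => i ij.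
  have -> : ((i : nat) == j) = false.
    by apply/negbTE; apply: contra ij => /eqP e; apply/eqP/val_inj.
  by rewrite mulr0n subr0.
- by rewrite big1// => i _; rewrite subr0.
- rewrite iha ihb -big_split /=; apply: eq_bigr => i _.
  case: (zcount i a) (zcount i b) => [p n] [p' n'] /=.
  by rewrite !mulrnDr opprD addrACA.
- rewrite iha -sumrN; apply: eq_bigr => i _.
  by case: (zcount i a) => [p n] /=; rewrite opprB.
Qed.

(** In a free abelian group an expression is determined by the difference
    between the numbers of positive and negative occurrences of each atom;
    comparing these numbers crosswise keeps them natural. *)
Lemma zeval_eq (V : zmodType) (env : seq V) (a b : zexpr) :
  all (fun i => let: (p, n) := zcount i a in let: (p', n') := zcount i b in
                (p + n' == p' + n)%N) (iota 0 (size env)) ->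
  zeval env a = zeval env b.
Proof.
move=> /allP h; rewrite !zevalE; apply: eq_bigr => i _.
have := h i; rewrite mem_iota ltn_ord => /(_ isT).
case: (zcount i a) (zcount i b) => [p n] [p' n'] /= /eqP e.
apply/eqP; rewrite subr_eq addrAC eq_sym subr_eq -!mulrnDr e //.
Qed.

(** Matching on a constant forces [unify] to run while the tactic is being
    evaluated to a term. *)
Ltac zfind x l :=
  lazymatch l with
  | x :: _ => constr:(0%N)
  | ?y :: ?l' =>
    match constr:(Set) with
    | _ => let _ := match constr:(Set) with _ => unify x y end in constr:(0%N)
    | _ => let n := zfind x l' in constr:(n.+1)
    end
  end.

Ltac zatoms l t :=
  lazymatch t with
  | (?a + ?b)%R => let l1 := zatoms l a in zatoms l1 b
  | (- ?a)%R => zatoms l a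
  | (0)%R => l
  | _ => match l with
         | _ => let n := zfind t l in l
         | _ => constr:(t :: l)
         end
  end.

Ltac zreify l t :=
  lazymatch t with
  | (?a + ?b)%R => let x := zreify l a in let y := zreify l b in constr:(ZAdd x y)
  | (- ?a)%R => let x := zreify l a in constr:(ZOpp x)
  | (0)%R => constr:(ZZero)
  | _ => let n := zfind t l in constr:(ZVar n)
  end.

Ltac zmodule :=
  lazymatch goal with
  | |- @eq ?T ?a ?b =>
    let l0 := zatoms (@nil T) a in let l := zatoms l0 b in
    let x := zreify l a in let y := zreify l b in
    exact (@zeval_eq _ l x y isT)
  end.

(** * Real-valued norms *)

Section RealNorm.
Variable R : realType.

Lemma ltr0c (r : R) : (0 < (r%:C)%C) = (0 < r).
Proof. exact: (ltcR 0 r). Qed.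

(** Norms are nonnegative elements of [complex R]; estimates are carried out
    with their real parts. *)
Definition nrm (V : normedZmodType (complex R)) (x : V) : R := complex.Re `|x|.

Section Normed.
Variable V : normedZmodType (complex R).
Implicit Types x y : V.

Lemma nrmE x : `|x| = (nrm x)%:C%C.
Proof. by rewrite RRe_real ?normr_real. Qed.

Lemma nrm_ge0 x : 0 <= nrm x.
Proof. by rewrite -ler0c -nrmE. Qed.

Lemma nrm0 : nrm (0 : V) = 0.
Proof. by rewrite /nrm normr0. Qed.

Lemma nrm_eq0 x : nrm x = 0 -> x = 0.
Proof. by move=> h; apply/eqP; rewrite -normr_eq0 nrmE h. Qed.

Lemma nrmN x : nrm (- x) = nrm x.
Proof. by rewrite /nrm normrN. Qed.

Lemma nrmD x y : nrm (x + y) <= nrm x + nrm y.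
Proof. by rewrite -lecR rmorphD /= -!nrmE ler_normD. Qed.

Lemma nrmB x y : nrm (x - y) = nrm (y - x).
Proof. by rewrite -nrmN opprB. Qed.

Lemma nrmBD x y : nrm (x - y) <= nrm x + nrm y.
Proof. by rewrite -[nrm y]nrmN; exact: nrmD. Qed.

Lemma nrm_tri x y z : nrm (x - z) <= nrm (x - y) + nrm (y - z).
Proof. by apply: le_trans (nrmD _ _); rewrite addrA subrK. Qed.

Lemma nrm_sum (I : Type) (s : seq I) (P : pred I) (F : I -> V) :
  nrm (\sum_(i <- s | P i) F i) <= \sum_(i <- s | P i) nrm (F i).
Proof.
elim/big_rec2: _ => [|i r x _ h]; first by rewrite nrm0.
by apply: le_trans (nrmD _ _) _; rewrite lerD2l.
Qed.

Lemma nrm_small x : (forall e : R, 0 < e -> nrm x <= e) -> x = 0.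
Proof.
move=> h; apply: nrm_eq0; apply/eqP; rewrite eq_le nrm_ge0 andbT.
by apply/ler_addgt0Pl => e e0; rewrite addr0 h.
Qed.

End Normed.

Lemma nrmcM (c d : complex R) : nrm (c * d) = nrm c * nrm d.
Proof.
by apply: (@complexI R); rewrite rmorphM /= -!nrmE normrM.
Qed.

Lemma nrmc1 : nrm (1 : complex R) = 1.
Proof. by rewrite /nrm normr1. Qed.

Lemma nrmcP (c : complex R) : `|c| = 1 <-> nrm c = 1.
Proof. by split => [h|h]; [rewrite /nrm h | rewrite nrmE h]. Qed.

Lemma nrmcR (r : R) : nrm (r%:C)%C = `|r|.
Proof. by rewrite /nrm normc_def /= expr0n addr0 sqrtr_sqr. Qed.

Lemma nrmcV (c : complex R) : nrm c^-1 = (nrm c)^-1.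
Proof.
by apply: (@complexI R); rewrite fmorphV /= -!nrmE normfV.
Qed.

Lemma nrmcJ (c : complex R) : nrm (Num.conj c) = nrm c.
Proof. by rewrite /nrm norm_conjC. Qed.

Lemma nrmZ (V : normedModType (complex R)) (c : complex R) (x : V) :
  nrm (c *: x) = nrm c * nrm x.
Proof. by apply: (@complexI R); rewrite rmorphM /= -!nrmE normrZ. Qed.

Section Topology.
Variable V : completeNormedModType (complex R).

Lemma closedP (S : set V) : closed S <->
  (forall x, (forall e : R, 0 < e -> exists2 y, S y & nrm (x - y) < e) -> S x).
Proof.
split=> [cS x hx|h].
  apply: cS => U /nbhs_ballP [e /= e0 he].
  have [e1 e10 ee] : exists2 e1 : R, 0 < e1 & e = e1%:C%C.
    exists (complex.Re e); last by rewrite RRe_real// gtr0_real.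
    by rewrite -ltr0c RRe_real// gtr0_real.
  have [y Sy yx] := hx _ e10.
  exists y; split => //; apply: he; rewrite -ball_normE /ball_ /= nrmE ee ltcR.
  exact: yx.
move=> x cx; apply: h => e e0.
have e0' : 0 < e%:C%C :> complex R by rewrite ltr0c.
have [y [Sy]] := cx _ (nbhsx_ballx x _ e0').
by rewrite -ball_normE /ball_ /= nrmE ltcR => yx; exists y.
Qed.

Lemma nrm_complete (u : nat -> V) :
  (forall e : R, 0 < e -> exists N, forall m n, (N <= m)%N -> (N <= n)%N ->
     nrm (u m - u n) < e) ->
  exists l, forall e : R, 0 < e -> exists N, forall n, (N <= n)%N -> nrm (u n - l) < e.
Proof.
move=> hu.
have cu : cauchy (u @ \oo).
  apply: cauchy_exP => e e0.
  have [e1 e10 ee] : exists2 e1 : R, 0 < e1 & e = e1%:C%C.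
    exists (complex.Re e); last by rewrite RRe_real// gtr0_real.
    by rewrite -ltr0c RRe_real// gtr0_real.
  have [N hN] := hu _ e10.
  exists (u N); exists N => // n /= nN.
  by rewrite -ball_normE /ball_ /= nrmE ee ltcR hN.
have [l hl] := (cvg_ex _).1 (cauchy_cvg _ cu).
exists l => e e0.
have e0' : 0 < e%:C%C :> complex R by rewrite ltr0c.
have [N _ hN] := hl _ (nbhsx_ballx l _ e0').
exists N => n nN; have := hN n nN.
by rewrite /= -ball_normE /ball_ /= nrmE ltcR nrmB.
Qed.

End Topology.
End RealNorm.

Section Geometric.
Variable R : realType.

Lemma expr_small (r C e : R) : 0 <= r < 1 -> 0 < e ->
  exists N, forall n, (N <= n)%N -> r ^+ n * C < e.
Proof.
move=> /andP[r0 r1] e0.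
have h : (r ^+ n * C) @[n --> \oo] --> (0 * C : R).
  by apply: cvgMl; apply: cvg_expr; rewrite ger0_norm.
rewrite mul0r in h.
move/cvgrPdist_lt: h => /(_ _ e0) [N _ hN].
exists N => n nN; apply: le_lt_trans (ler_norm _) _.
by have := hN n nN; rewrite /= sub0r normrN.
Qed.

Variable V : completeNormedModType (complex R).

(** Successive differences are bounded by a geometric sequence. *)
Lemma nrm_contraction (u : nat -> V) (r : R) : 0 <= r < 1 ->
  (forall n, nrm (u n.+2 - u n.+1) <= r * nrm (u n.+1 - u n)) ->
  exists l, forall e : R, 0 < e ->
    exists N, forall n, (N <= n)%N -> nrm (u n - l) < e.
Proof.
move=> /andP[r0 r1] hu; apply: nrm_complete => e e0.
set C := nrm (u 1%N - u 0%N).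
have s0 : 0 < 1 - r by rewrite subr_gt0.
have step n : nrm (u n.+1 - u n) <= r ^+ n * C.
  elim: n => [|n ih]; first by rewrite expr0 mul1r.
  by apply: le_trans (hu n) _; rewrite exprS -mulrA ler_wpM2l.
have tail n k : (1 - r) * nrm (u (n + k)%N - u n) <= r ^+ n * C * (1 - r ^+ k).
  elim: k => [|k ih]; first by rewrite addn0 subrr nrm0 expr0 subrr !mulr0.
  rewrite addnS; apply: le_trans (_ : (1 - r) *
    (nrm (u (n + k).+1 - u (n + k)%N) + nrm (u (n + k)%N - u n)) <= _).
    by rewrite ler_pM2l//; exact: nrm_tri.
  have := ler_wpM2l (ltW s0) (step (n + k)%N).
  rewrite mulrDr exprD exprSr; lra.
have rk k : 0 <= 1 - r ^+ k <= 1.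
  by rewrite subr_ge0 exprn_ile1 //= ?(ltW r1)// lerBlDr lerDl exprn_ge0.
have r01 : 0 <= r < 1 by rewrite r0 r1.
have e20 : 0 < e * (1 - r) / 2 by rewrite !mulr_gt0// invr_gt0.
have [N hN] := @expr_small r C _ r01 e20.
have hb k : (N <= k)%N -> nrm (u k - u N) < e / 2.
  move=> Nk; have := tail N (k - N)%N; rewrite subnKC// => h.
  rewrite -(ltr_pM2l s0); apply: le_lt_trans h _.
  have /andP[h1 h2] := rk (k - N)%N.
  have C0 : 0 <= r ^+ N * C by rewrite mulr_ge0 ?exprn_ge0 ?nrm_ge0.
  apply: le_lt_trans (_ : r ^+ N * C < _); first by rewrite ler_piMr.
  by apply: lt_le_trans (hN N (leqnn N)) _; rewrite [e * _]mulrC mulrA.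
exists N => m n Nm Nn.
apply: le_lt_trans (nrm_tri _ (u N) _) _; rewrite [nrm (u N - _)]nrmB.
by have := hb m Nm; have := hb n Nn; lra.
Qed.

End Geometric.

(** * Elementary theory of C*-algebras *)

Section CStarBasics.
Variable R : realType.
Variable A : cstarType R.
Implicit Types a b c d x y : A.

Lemma cmul0l a : (0 : A) ** a = 0.
Proof. by apply: (addrI (0 ** a)); rewrite -cmulDl !addr0. Qed.

Lemma cmul0r a : a ** (0 : A) = 0.
Proof. by apply: (addrI (a ** 0)); rewrite -cmulDr !addr0. Qed.

Lemma cmulNl a b : (- a) ** b = - (a ** b).
Proof. by apply/eqP; rewrite -addr_eq0 -cmulDl addNr cmul0l. Qed.

Lemma cmulNr a b : a ** (- b) = - (a ** b).
Proof. by apply/eqP; rewrite -addr_eq0 -cmulDr addNr cmul0r. Qed.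

Lemma cmulBl a b c : (a - b) ** c = a ** c - b ** c.
Proof. by rewrite cmulDl cmulNl. Qed.

Lemma cmulBr a b c : c ** (a - b) = c ** a - c ** b.
Proof. by rewrite cmulDr cmulNr. Qed.

Lemma cmul_suml (I : Type) (s : seq I) (P : pred I) (F : I -> A) b :
  (\sum_(i <- s | P i) F i) ** b = \sum_(i <- s | P i) F i ** b.
Proof. by elim/big_rec2: _ => [|i x y _ <-]; rewrite ?cmul0l ?cmulDl. Qed.

Lemma cmul_sumr (I : Type) (s : seq I) (P : pred I) (F : I -> A) b :
  b ** (\sum_(i <- s | P i) F i) = \sum_(i <- s | P i) b ** F i.
Proof. by elim/big_rec2: _ => [|i x y _ <-]; rewrite ?cmul0r ?cmulDr. Qed.

Lemma cstar0 : (0 : A)^* = 0.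
Proof. by apply: (addrI (0^*)); rewrite -cstarD !addr0. Qed.

Lemma cstarN a : (- a)^* = - a^*.
Proof. by apply/eqP; rewrite -addr_eq0 -cstarD addNr cstar0. Qed.

Lemma cstarB a b : (a - b)^* = a^* - b^*.
Proof. by rewrite cstarD cstarN. Qed.

Lemma cstar_sum (I : Type) (s : seq I) (P : pred I) (F : I -> A) :
  (\sum_(i <- s | P i) F i)^* = \sum_(i <- s | P i) (F i)^*.
Proof. by elim/big_rec2: _ => [|i x y _ <-]; rewrite ?cstar0 ?cstarD. Qed.

Lemma conj_real (r : R) : Num.conj (r%:C)%C = (r%:C)%C.
Proof. by apply/CrealP; rewrite complex_real. Qed.

Lemma cstarZr (r : R) a : ((r%:C)%C *: a)^* = (r%:C)%C *: a^*.
Proof. by rewrite cstarZ conj_real. Qed.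

Lemma nrmM a b : nrm (a ** b) <= nrm a * nrm b.
Proof. by rewrite -lecR rmorphM /= -!nrmE cnormM. Qed.

Lemma nrm_starM a : nrm (a^* ** a) = nrm a ^+ 2.
Proof. by apply: (@complexI R); rewrite rmorphXn /= -!nrmE cnorm_star. Qed.

Lemma nrm_star a : nrm (a^*) = nrm a.
Proof.
have h b : nrm b <= nrm (b^*).
  have := nrmM (b^*) b; rewrite nrm_starM expr2.
  have [->|b0] := eqVneq b 0; first by rewrite nrm0 nrm_ge0.
  rewrite ler_pM2r// lt_neqAle nrm_ge0 andbT eq_sym.
  by apply: contra b0 => /eqP/nrm_eq0/eqP.
by apply/eqP; rewrite eq_le h -{2}(cstarK a) h.
Qed.

Lemma nrm_Mstar a : nrm (a ** a^*) = nrm a ^+ 2.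
Proof. by rewrite -{1}(cstarK a) nrm_starM nrm_star. Qed.

Lemma star_eq0 a : a^* ** a = 0 -> a = 0.
Proof.
move=> h; apply: nrm_eq0; apply/eqP; rewrite -sqrf_eq0 -nrm_starM h nrm0//.
Qed.

(** [d = 1 - sqrt (1 - x)] is the fixed point of the contraction [d |-> (x +
    d^2) / 2] of the ball of radius [|x|]. *)
Lemma half_sqrt x : x^* = x -> nrm x < 1 ->
  exists d, [/\ d^* = d, d + d = x + d ** d, nrm d <= nrm x &
    forall y, x ** y = y ** x -> d ** y = y ** d].
Proof.
move=> xs x1; set r := nrm x.
have r0 : 0 <= r by exact: nrm_ge0.
pose f d := (2^-1%:C)%C *: (x + d ** d).
have fb d : nrm d <= r -> nrm (f d) <= r.
  move=> hd; rewrite nrmZ nrmcR ger0_norm ?invr_ge0//.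
  have h1 := nrmD x (d ** d).
  have h2 : nrm (d ** d) <= r.
    apply: le_trans (nrmM _ _) _; have := nrm_ge0 d.
    move: hd x1; rewrite -/r; nra.
  by rewrite -/r in h1; lra.
pose u n := iter n f 0.
have uS n : u n.+1 = f (u n) by [].
have ub n : nrm (u n) <= r.
  by elim: n => [|n ih]; rewrite ?nrm0// uS fb.
have fd d d' : nrm d <= r -> nrm d' <= r -> nrm (f d - f d') <= r * nrm (d - d').
  move=> hd hd'; rewrite -scalerBr nrmZ nrmcR ger0_norm ?invr_ge0//.
  have -> : x + d ** d - (x + d' ** d') = d ** (d - d') + (d - d') ** d'.
    rewrite cmulBr cmulBl addrA subrK opprD addrACA subrr add0r //.
  have h1 := nrmD (d ** (d - d')) ((d - d') ** d').
  have h2 := nrmM d (d - d'); have h3 := nrmM (d - d') d'.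
  have := nrm_ge0 (d - d'); nra.
have [d hd] : exists l, forall e : R, 0 < e ->
    exists N, forall n, (N <= n)%N -> nrm (u n - l) < e.
  apply: (@nrm_contraction _ _ _ r); first by rewrite r0 x1.
  by move=> n; apply: (fd (u n.+1) (u n)); apply: ub.
have half (e : R) : 0 < e -> 0 < e / 2 by move=> e0; rewrite divr_gt0.
have app (e : R) : 0 < e -> exists n, nrm (u n - d) < e /\ nrm (u n.+1 - d) < e.
  by move=> /hd [N hN]; exists N; split; apply: hN.
have dr : nrm d <= r.
  apply/ler_addgt0Pr => e e0; have [n [h _]] := app _ e0.
  by have := nrm_tri d (u n) 0; rewrite !subr0 nrmB; have := ub n; lra.
have us n : (u n)^* = u n.
  elim: n => [|n ih]; first by rewrite cstar0.
  by rewrite uS /f cstarZr cstarD cstarM xs ih.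
have uc n y : x ** y = y ** x -> u n ** y = y ** u n.
  move=> hy; elim: n => [|n ih]; first by rewrite cmul0l cmul0r.
  rewrite uS /f cmulZl cmulZr cmulDl cmulDr hy.
  by rewrite -cmulA ih cmulA ih cmulA.
exists d; split => //.
- apply/eqP; rewrite -subr_eq0; apply/eqP/nrm_small => e e0.
  have [n [h _]] := app (e / 2) (half _ e0).
  have := nrm_tri (d^*) (u n) d.
  by rewrite -{1}(us n) -cstarB nrm_star [nrm (d - u n)]nrmB; lra.
- have fdd : f d = d.
    apply/eqP; rewrite -subr_eq0; apply/eqP/nrm_small => e e0.
    have [n [h1 h2]] := app (e / 2) (half _ e0).
    have := nrm_tri (f d) (u n.+1) d; have := fd d (u n) dr (ub n).
    rewrite -uS [nrm (d - u n)]nrmB; have := nrm_ge0 (u n - d).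
    by move: x1; rewrite -/r; nra.
  rewrite -[in LHS]fdd /f -scalerDl -rmorphD /= -[RHS]scale1r; congr (_ *: _).
  by congr (_%:C)%C; lra.
- move=> y hy; apply/eqP; rewrite -subr_eq0; apply/eqP/nrm_small => e e0.
  have C0 : 0 < 2 * nrm y + 1 by have := nrm_ge0 y; lra.
  have [n [h1 h2]] := app (e / (2 * nrm y + 1)) (divr_gt0 e0 C0).
  have -> : d ** y - y ** d = (d - u n) ** y - y ** (d - u n).
    by rewrite cmulBl cmulBr uc// opprB addrA subrK.
  have b1 := nrmBD ((d - u n) ** y) (y ** (d - u n)).
  have b2 := nrmM (d - u n) y; have b3 := nrmM y (d - u n).
  have : nrm (d - u n) * (2 * nrm y + 1) <= e.
    by rewrite -ler_pdivlMr// nrmB ltW.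
  have := nrm_ge0 (d - u n); lra.
Qed.

End CStarBasics.

(** * Homomorphisms and ideals *)

Section StarHom.
Variable R : realType.
Local Notation C := (complex R).

Lemma conj_i : Num.conj ('i : C) = - 'i.
Proof. exact: conjCi. Qed.

Section SelfAdjoint.
Variable A : cstarType R.
Implicit Types a b c d x y : A.

(** The cross terms cancel when [x^* y] is selfadjoint. *)
Lemma star_i x y : x^* ** y = y^* ** x ->
  (x + 'i *: y)^* ** (x + 'i *: y) = x^* ** x + y^* ** y.
Proof.
move=> h; rewrite cstarD cstarZ conj_i cmulDl !cmulDr !cmulZl !cmulZr scalerA.
rewrite mulNr -expr2 sqrCi opprK scale1r h scaleNr.
zmodule.
Qed.

(** [b + i (1 - e)] is formally a unitary with real part [b]; left
    multiplication by it is an isometry even when there is no unit. *)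
Lemma unitary_part_le1 b e : b^* = b -> e^* = e -> b ** e = e ** b ->
  e + e = b ** b + e ** e -> nrm b <= 1.
Proof.
move=> bs es be h.
(* [s] is the sign of the imaginary part. *)
have key (s : bool) y : nrm (b ** y + 'i *: ((-1) ^+ s *: (y - e ** y))) = nrm y.
  apply/eqP; rewrite -(eqrXn2 (ltn0Sn 1)) ?nrm_ge0//; apply/eqP.
  rewrite -!nrm_starM star_i; last first.
    rewrite cstarM cstarZ cstarB cstarM bs es rmorphXn rmorphN1.
    rewrite cmulZl cmulZr; congr (_ *: _).
    rewrite cmulBl cmulBr !cmulA; congr (_ - _).
    by rewrite -[_ ** b ** e]cmulA be !cmulA.
  congr nrm; rewrite cstarM cstarZ cstarB cstarM bs es rmorphXn rmorphN1.
  rewrite cmulZl cmulZr scalerA -expr2 sqrr_sign scale1r.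
  have -> : y^* ** b ** (b ** y) = y^* ** (e + e - e ** e) ** y.
    by rewrite h addrK !cmulA.
  rewrite !(cmulBl, cmulBr, cmulDl, cmulDr) !cmulA.
  move: (y^* ** e ** e ** y) (y^* ** e ** y) (y^* ** y) => p q r.
  zmodule.
have key2 y : nrm (b ** y) <= nrm y.
  have := nrmD (b ** y + 'i *: ((-1) ^+ false *: (y - e ** y)))
    (b ** y + 'i *: ((-1) ^+ true *: (y - e ** y))).
  rewrite !key expr0 expr1 scaleN1r scale1r scalerN addrACA addrN addr0.
  by rewrite -mulr2n -scaler_nat nrmZ -(rmorph_nat (real_complex R)) nrmcR normr_nat; lra.
have := key2 b; have := nrm_starM b; rewrite bs => -> hb.
by have := nrm_ge0 b; nra.
Qed.

End SelfAdjoint.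

Section Hom.
Variables A B : cstarType R.
Variables (h : A -> B) (hh : star_hom h).

Lemma homD a b : h (a + b) = h a + h b.
Proof. by have := star_hom_linear hh 1 a b; rewrite !scale1r. Qed.

Lemma hom0 : h 0 = 0.
Proof. by apply: (addrI (h 0)); rewrite -homD !addr0. Qed.

Lemma homZ c a : h (c *: a) = c *: h a.
Proof. by have := star_hom_linear hh c a 0; rewrite !addr0 hom0 addr0. Qed.

Lemma homN a : h (- a) = - h a.
Proof. by rewrite -scaleN1r homZ scaleN1r. Qed.

Lemma homB a b : h (a - b) = h a - h b.
Proof. by rewrite homD homN. Qed.

Lemma hom_sum (I : Type) (s : seq I) (P : pred I) (F : I -> A) :
  h (\sum_(i <- s | P i) F i) = \sum_(i <- s | P i) h (F i).
Proof. by elim/big_rec2: _ => [|i x y _ <-]; rewrite ?hom0 ?homD. Qed.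

Definition homM := star_homM hh.
Definition homS := star_hom_star hh.

(** A selfadjoint element of norm less than 1 is the real part of a unitary, by
    [half_sqrt]; this algebraic relation is preserved by [h] and bounds the norm
    of the image by [unitary_part_le1]. *)
Lemma hom_contractive a : nrm (h a) <= nrm a.
Proof.
have sa b : b^* = b -> nrm b < 1 -> nrm (h b) <= 1.
  move=> bs b1.
  have bb : nrm (b ** b) < 1.
    by have := nrmM b b; have := nrm_ge0 b; nra.
  have bbs : (b ** b)^* = b ** b by rewrite cstarM bs.
  have [d [ds dd _ dc]] := half_sqrt bbs bb.
  (* [h d] solves the equation of [half_sqrt] for [(h b)^2], so [h b] is
     the real part of a unitary. *)
  apply: (@unitary_part_le1 _ (h b) (h d)).
  - by rewrite -homS bs.
  - by rewrite -homS ds.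
  - by rewrite -!homM dc// cmulA.
  - by rewrite -!homM -!homD dd.
have sa2 b : b^* = b -> nrm (h b) <= nrm b.
  move=> bs; apply/ler_addgt0Pr => e e0.
  have n0 : 0 < nrm b + e by have := nrm_ge0 b; lra.
  set r := (nrm b + e)^-1.
  have r0 : 0 < r by rewrite invr_gt0.
  have := sa ((r%:C)%C *: b); rewrite cstarZr bs homZ !nrmZ nrmcR gtr0_norm//.
  move=> /(_ erefl); rewrite /r ![(_ + _)^-1 * _]mulrC ltr_pdivrMr// mul1r.
  by rewrite ler_pdivrMr// mul1r; apply; lra.
rewrite -(ler_pXn2r (ltn0Sn 1)) ?nnegrE ?nrm_ge0// -!nrm_starM -homS -homM.
by apply: sa2; rewrite cstarM cstarK.
Qed.

Lemma hom_preim_closed (I : set B) : closed I -> closed (h @^-1` I).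
Proof.
move=> /closedP cI; apply/closedP => x hx; apply: cI => e e0.
have [y Iy xy] := hx e e0; exists (h y) => //.
by rewrite -homB; apply: le_lt_trans (hom_contractive _) xy.
Qed.

Lemma hom_preim_ideal (I : set B) : closed_ideal I -> closed_ideal (h @^-1` I).
Proof.
move=> [[I0 ID IZ Ic] IMl IMr]; split; first split.
- by rewrite /preimage /= hom0.
- by move=> a b; rewrite /preimage /= homD; exact: ID.
- by move=> c a; rewrite /preimage /= homZ; exact: IZ.
- exact: hom_preim_closed.
- by move=> a b; rewrite /preimage /= homM; exact: IMl.
- by move=> a b; rewrite /preimage /= homM; exact: IMr.
Qed.

End Hom.

Lemma hom_comp (A B D : cstarType R) (g : B -> D) (h : A -> B) :
  star_hom g -> star_hom h -> star_hom (g \o h).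
Proof.
move=> hg hh; split.
- by move=> c a b /=; rewrite (homD hh) (homZ hh) (homD hg) (homZ hg).
- by move=> a b /=; rewrite (homM hh) (homM hg).
- by move=> a /=; rewrite (homS hh) (homS hg).
Qed.

(** Agreement on generators propagates because homomorphisms are continuous. *)
Lemma hom_eq_generated (A B : cstarType R) (S : set A) (g h : A -> B) :
  generates S -> star_hom g -> star_hom h -> (forall a, S a -> g a = h a) ->
  forall a, g a = h a.
Proof.
move=> gen hg hh gh a.
suff e : [set a | g a = h a] = setT.
  by have : [set a | g a = h a] a by rewrite e.
move: a => _; apply: gen => //; split; first split => /=.
- by rewrite (hom0 hg) (hom0 hh).
- by move=> a b ea eb; rewrite (homD hg) (homD hh) ea eb.
- by move=> c a ea; rewrite (homZ hg) (homZ hh) ea.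
- apply/closedP => x hx /=; apply/eqP; rewrite -subr_eq0; apply/eqP/nrm_small.
  move=> e e0; have e20 : 0 < e / 2 by rewrite divr_gt0.
  have [y /= ey xy] := hx _ e20.
  have := nrm_tri (g x) (g y) (h x); rewrite {2}ey -(homB hg) -(homB hh).
  have := hom_contractive hg (x - y); have := hom_contractive hh (y - x).
  by move: xy; rewrite [nrm (y - x)]nrmB; lra.
- by move=> a b /= ea eb; rewrite (homM hg) (homM hh) ea eb.
- by move=> a /= ea; rewrite (homS hg) (homS hh) ea.
Qed.

Lemma ideal_generated_ideal (A : cstarType R) (S : set A) :
  closed_ideal (ideal_generated S).
Proof.
split; first split.
- by move=> J [[[]]].
- by move=> a b Ia Ib J hJ; apply: (subspaceD (ideal_subspace hJ.1)); [exact: Ia | exact: Ib].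
- by move=> c a Ia J hJ; apply: (subspaceZ (ideal_subspace hJ.1)); exact: Ia.
- by apply: closed_bigI => J hJ; exact: (subspace_closed (ideal_subspace hJ.1)).
- by move=> a b Ib J hJ; apply: (idealMl hJ.1); exact: Ib.
- move=> a b Ia J hJ; have Ja : J a by exact: Ia.
  by case: hJ => -[_ _ Mr] _; exact: Mr.
Qed.

Lemma sub_ideal_generated (A : cstarType R) (S : set A) : S `<=` ideal_generated S.
Proof. by move=> a Sa J [_]; apply. Qed.

End StarHom.

(** The balls of radius [1 / (n + 1)] of a Cauchy filter have centers that form
    a Cauchy sequence, whose limit is that of the filter. *)
Lemma sequentially_complete (R : realType) (V : normedModType (complex R)) :
  (forall u : nat -> V,
    (forall e : R, 0 < e -> exists N, forall m n, (N <= m)%N -> (N <= n)%N ->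
       nrm (u m - u n) < e) ->
    exists l, forall e : R, 0 < e -> exists N, forall n, (N <= n)%N ->
       nrm (u n - l) < e) ->
  forall F : set_system V, ProperFilter F -> cauchy F -> cvg F.
Proof.
move=> seqc F PF /cauchyP cF.
have inv0 n : 0 < n.+1%:R^-1 :> R by rewrite invr_gt0.
have hx n : exists x : V, F (ball x ((n.+1%:R^-1)%:C)%C).
  by apply: cF; rewrite ltr0c.
pose x n := projT1 (cid (hx n)).
have Fx n : F (ball (x n) ((n.+1%:R^-1)%:C)%C) by exact: projT2 (cid (hx n)).
have ballE (a b : V) (e : R) : ball a (e%:C)%C b <-> nrm (a - b) < e.
  by rewrite -ball_normE /ball_ /= nrmE ltcR.
have close m n : nrm (x m - x n) < m.+1%:R^-1 + n.+1%:R^-1.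
  have [y [/ballE h1 /ballE h2]] := filter_ex (filterI (Fx m) (Fx n)).
  by apply: le_lt_trans (nrm_tri _ y _) _; rewrite ltrD// nrmB.
have arch (e : R) : 0 < e -> exists N, forall n, (N <= n)%N -> n.+1%:R^-1 < e.
  move=> e0; have [N _ hN] := near_infty_natSinv_lt (PosNum e0).
  by exists N => n Nn; exact: (hN n Nn).
have [|l hl] := seqc x.
  move=> e e0; have e20 : 0 < e / 2 by rewrite divr_gt0.
  have [N hN] := arch _ e20.
  exists N => m n Nm Nn; apply: lt_le_trans (close m n) _.
  by rewrite [e]splitr ltW// ltrD// hN.
apply/cvg_ex; exists l; apply/cvg_ballP => e e0.
have [e1 e10 ->] : exists2 e1 : R, 0 < e1 & e = e1%:C%C.
  exists (complex.Re e); last by rewrite RRe_real// gtr0_real.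
  by rewrite -ltr0c RRe_real// gtr0_real.
have e20 : 0 < e1 / 2 by rewrite divr_gt0.
have [N hN] := arch _ e20; have [M hM] := hl _ e20.
apply: filterS (Fx (maxn N M)) => y /ballE h; apply/ballE.
apply: le_lt_trans (nrm_tri _ (x (maxn N M)) _) _; rewrite nrmB [e1]splitr.
by rewrite ltrD// ?hM ?leq_maxr// (lt_trans h)// hN// leq_maxl.
Qed.

(** The inner product is linear in the second variable. The Cauchy-Schwarz
    inequality is a field because its usual proof needs the positivity of [c^*
    c], which is derived below in the multiplier algebra of [A], itself an
    algebra of adjointable operators. *)
Record hilbert_module (R : realType) (A : cstarType R) (X : lmodType (complex R)) :=
  HilbertModule {
  ip : X -> X -> A;
  ipDr : forall x y z, ip x (y + z) = ip x y + ip x z;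
  ipZr : forall c x y, ip x (c *: y) = c *: ip x y;
  ip_star : forall x y, (ip x y)^* = ip y x;
  ip_def : forall x, ip x x = 0 -> x = 0;
  ip_cs : forall x y, nrm (ip x y) ^+ 2 <= nrm (ip x x) * nrm (ip y y);
  ip_complete : forall u : nat -> X,
    (forall e : R, 0 < e -> exists N, forall m n, (N <= m)%N -> (N <= n)%N ->
       nrm (ip (u m - u n) (u m - u n)) < e) ->
    exists l, forall e : R, 0 < e -> exists N, forall n, (N <= n)%N ->
       nrm (ip (u n - l) (u n - l)) < e
}.

Section HilbertModule.
Variables (R : realType) (A : cstarType R) (X : lmodType (complex R)).
Variable H : hilbert_module A X.
Implicit Types x y z : X.
Local Notation "<< x , y >>" := (ip H x y).

Definition hn x : R := Num.sqrt (nrm <<x, x>>).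

Lemma hn_sqr x : hn x ^+ 2 = nrm <<x, x>>.
Proof. by rewrite sqr_sqrtr// nrm_ge0. Qed.

Lemma hn_ge0 x : 0 <= hn x.
Proof. exact: sqrtr_ge0. Qed.

Lemma ip_le x y : nrm <<x, y>> <= hn x * hn y.
Proof.
rewrite -(ler_pXn2r (ltn0Sn 1)) ?nnegrE ?mulr_ge0 ?nrm_ge0 ?hn_ge0//.
by rewrite exprMn !hn_sqr ip_cs.
Qed.

Lemma ipDl x y z : <<x + y, z>> = <<x, z>> + <<y, z>>.
Proof. by rewrite -!(ip_star H z) ipDr cstarD. Qed.

Lemma ipZl c x y : <<c *: x, y>> = Num.conj c *: <<x, y>>.
Proof. by rewrite -!(ip_star H y) ipZr cstarZ. Qed.

Lemma ipNr x y : <<x, - y>> = - <<x, y>>.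
Proof. by rewrite -scaleN1r ipZr scaleN1r. Qed.

Lemma ipNl x y : <<- x, y>> = - <<x, y>>.
Proof. by rewrite -!(ip_star H y) ipNr cstarN. Qed.

Lemma ipBr x y z : <<x, y - z>> = <<x, y>> - <<x, z>>.
Proof. by rewrite ipDr ipNr. Qed.

Lemma ipBl x y z : <<x - y, z>> = <<x, z>> - <<y, z>>.
Proof. by rewrite ipDl ipNl. Qed.

Lemma ip0r x : <<x, 0>> = 0.
Proof. by rewrite -(scale0r 0) ipZr scale0r. Qed.

Lemma hn0 : hn 0 = 0.
Proof. by rewrite /hn ip0r nrm0 sqrtr0. Qed.

Lemma hn_eq0 x : hn x = 0 -> x = 0.
Proof.
by move=> h; apply: (@ip_def _ _ _ H); apply: nrm_eq0; rewrite -hn_sqr h expr0n.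
Qed.

Lemma ip_nondeg x : (forall y, <<y, x>> = 0) -> x = 0.
Proof. by move=> h; apply: (@ip_def _ _ _ H); rewrite h. Qed.

Lemma hnD x y : hn (x + y) <= hn x + hn y.
Proof.
rewrite -(ler_pXn2r (ltn0Sn 1)) ?nnegrE ?addr_ge0 ?hn_ge0// hn_sqr.
rewrite ipDl !ipDr.
have h1 := nrmD (<<x, x>> + <<x, y>>) (<<y, x>> + <<y, y>>).
have h2 := nrmD <<x, x>> <<x, y>>; have h3 := nrmD <<y, x>> <<y, y>>.
have h4 := ip_le x y; have h5 := ip_le y x.
have h6 := hn_sqr x; have h7 := hn_sqr y.
nra.
Qed.

Lemma hnZ c x : hn (c *: x) = nrm c * hn x.
Proof.
rewrite /hn ipZr ipZl scalerA nrmZ nrmcM nrmcJ -expr2 sqrtrM ?exprn_ge0 ?nrm_ge0//.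
by rewrite sqrtr_sqr ger0_norm ?nrm_ge0.
Qed.

Lemma hnN x : hn (- x) = hn x.
Proof. by rewrite /hn ipNr ipNl opprK. Qed.

Lemma hnB x y : hn (x - y) = hn (y - x).
Proof. by rewrite -hnN opprB. Qed.

Lemma hn_tri x y z : hn (x - z) <= hn (x - y) + hn (y - z).
Proof. by apply: le_trans (hnD _ _); rewrite addrA subrK. Qed.

Lemma hn_lt x (e : R) : 0 < e -> (hn x < e) = (nrm <<x, x>> < e ^+ 2).
Proof.
by move=> e0; rewrite -hn_sqr ltr_pXn2r ?nnegrE ?hn_ge0// ltW.
Qed.

Lemma hn_complete (u : nat -> X) :
  (forall e : R, 0 < e -> exists N, forall m n, (N <= m)%N -> (N <= n)%N ->
       hn (u m - u n) < e) ->
  exists l, forall e : R, 0 < e -> exists N, forall n, (N <= n)%N ->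
       hn (u n - l) < e.
Proof.
move=> hu; have /(@ip_complete _ _ _ H) [l hl] : forall e : R, 0 < e -> exists N,
    forall m n, (N <= m)%N -> (N <= n)%N -> nrm <<u m - u n, u m - u n>> < e.
  move=> e e0; have s0 : 0 < Num.sqrt e by rewrite sqrtr_gt0.
  have [N hN] := hu _ s0; exists N => m n Nm Nn.
  by have := hN m n Nm Nn; rewrite hn_lt// sqr_sqrtr// ltW.
exists l => e e0; have [|N hN] := hl (e ^+ 2); first by rewrite exprn_gt0.
by exists N => n nN; rewrite hn_lt// hN.
Qed.

Definition is_adj (T S : X -> X) := forall x y, <<x, T y>> = <<S x, y>>.

Definition bounded (T : X -> X) := exists M : R, forall x, hn (T x) <= M * hn x.

Definition adjointable (T : X -> X) := bounded T /\ exists S, is_adj T S.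

Lemma is_adj_sym T S : is_adj T S -> is_adj S T.
Proof. by move=> h x y; rewrite -ip_star -h ip_star. Qed.

Lemma is_adj_linear T S : is_adj T S -> linear T.
Proof.
move=> h c x y; apply/eqP; rewrite -subr_eq0; apply/eqP/ip_nondeg => z.
by rewrite ipBr h !ipDr !ipZr !h subrr.
Qed.

Lemma is_adj_bounded T S : is_adj T S -> bounded T -> bounded S.
Proof.
move=> h [M hM]; exists M => x.
have [->|s0] := eqVneq (hn (S x)) 0.
  have := hM x; have := hn_ge0 (T x); have := hn_ge0 x.
  have [->|x0] := eqVneq (hn x) 0; first by rewrite mulr0.
  by move=> *; apply: le_trans (hM x); exact: hn_ge0.
have p0 : 0 < hn (S x) by rewrite lt_neqAle eq_sym s0 hn_ge0.
rewrite -(ler_pM2r p0) -expr2 hn_sqr -h.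
apply: le_trans (ip_le _ _) _.
by rewrite -mulrA mulrCA ler_wpM2l ?hn_ge0.
Qed.

Definition adjointable_pred : {pred X -> X} := [pred T | `[< adjointable T >]].

Lemma bounded_ge0 T : bounded T -> exists2 M : R, 0 <= M &
  forall x, hn (T x) <= M * hn x.
Proof.
move=> [M hM]; exists (Num.max M 0); first by rewrite le_max lexx orbT.
move=> x; apply: le_trans (hM x) _; rewrite ler_wpM2r ?hn_ge0// le_max lexx//.
Qed.

Lemma adjointable_submod : submod_closed adjointable_pred.
Proof.
split.
  apply/asboolP; split; first by exists 0 => x; rewrite hn0 mul0r.
  by exists 0 => x y; rewrite ip0r -ip_star ip0r cstar0.
move=> c T S /asboolP [bT [T' hT]] /asboolP [bS [S' hS]]; apply/asboolP; split.
  have [M M0 hM] := bounded_ge0 bT; have [N N0 hN] := bounded_ge0 bS.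
  exists (nrm c * M + N) => x; apply: le_trans (hnD _ _) _.
  by rewrite hnZ mulrDl -mulrA lerD// ler_wpM2l ?nrm_ge0.
exists (fun x => Num.conj c *: T' x + S' x) => x y.
by rewrite ipDr ipZr hT hS ipDl ipZl conjCK.
Qed.

HB.instance Definition _ :=
  GRing.isSubmodClosed.Build _ _ adjointable_pred adjointable_submod.

Record adjop := Adjop { aop :> X -> X; _ : aop \in adjointable_pred }.

HB.instance Definition _ := [isSub for aop].
HB.instance Definition _ := gen_eqMixin adjop.
HB.instance Definition _ := gen_choiceMixin adjop.
HB.instance Definition _ := [SubChoice_isSubLmodule of adjop by <:].

Lemma aopP (T : adjop) : adjointable T.
Proof. by case: T => T /= /asboolP. Qed.

Lemma adjop_ext (T S : adjop) : (forall x, T x = S x) -> T = S.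
Proof. by move=> h; apply: val_inj; apply/funext. Qed.

Definition mk_adjop (T : X -> X) (h : adjointable T) : adjop :=
  Adjop (introT (asboolP _) h : T \in adjointable_pred).

Lemma aopDE (T S : adjop) x : (T + S) x = T x + S x. Proof. by []. Qed.

Lemma aopBE (T S : adjop) x : (T - S) x = T x - S x. Proof. by []. Qed.
Lemma aopZE c (T : adjop) x : (c *: T) x = c *: T x. Proof. by []. Qed.
Lemma aop0E x : (0 : adjop) x = 0. Proof. by []. Qed.

Lemma aop_linear (T : adjop) : linear T.
Proof. by have [_ [S /is_adj_linear]] := aopP T. Qed.

Lemma aopD (T : adjop) x y : T (x + y) = T x + T y.
Proof. by have := aop_linear T 1 x y; rewrite !scale1r. Qed.

Lemma aop0 (T : adjop) : T 0 = 0.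
Proof. by apply: (addrI (T 0)); rewrite -aopD !addr0. Qed.

Lemma aopZ (T : adjop) c x : T (c *: x) = c *: T x.
Proof. by have := aop_linear T c x 0; rewrite !addr0 aop0 addr0. Qed.

Definition opn (T : adjop) : R := sup [set hn (T x) | x in [set x | hn x <= 1]].

Lemma opn_has_sup (T : adjop) :
  has_sup [set hn (T x) | x in [set x | hn x <= 1]].
Proof.
split; first by exists (hn (T 0)); exists 0 => //=; rewrite hn0.
have [M M0 hM] := bounded_ge0 (aopP T).1.
exists M => _ [x /= x1 <-]; apply: le_trans (hM x) _.
by rewrite ler_piMr.
Qed.

Lemma opn_ub (T : adjop) x : hn x <= 1 -> hn (T x) <= opn T.
Proof. by move=> x1; apply: ub_le_sup; [exact: (opn_has_sup T).2|exists x]. Qed.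

Lemma opn_ge0 (T : adjop) : 0 <= opn T.
Proof. by apply: le_trans (hn_ge0 (T 0)) (opn_ub _ _); rewrite hn0. Qed.

Lemma opnP (T : adjop) x : hn (T x) <= opn T * hn x.
Proof.
have [x0|x0] := eqVneq (hn x) 0.
  by rewrite (hn_eq0 x0) aop0 hn0 mulr0.
have p0 : 0 < hn x by rewrite lt_neqAle eq_sym x0 hn_ge0.
rewrite -ler_pdivrMr// mulrC.
have := @opn_ub T ((((hn x)^-1)%:C)%C *: x).
rewrite aopZ !hnZ nrmcR ger0_norm ?invr_ge0 ?hn_ge0// mulVf//; exact.
Qed.

Lemma opn_le (T : adjop) (M : R) : 0 <= M ->
  (forall x, hn (T x) <= M * hn x) -> opn T <= M.
Proof.
move=> M0 h; apply: ge_sup; first exact: (opn_has_sup T).1.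
by move=> _ [x /= x1 <-]; apply: le_trans (h x) _; rewrite ler_piMr.
Qed.

Definition opnorm (T : adjop) : complex R := ((opn T)%:C)%C.

Lemma opnormD T S : opnorm (T + S) <= opnorm T + opnorm S.
Proof.
rewrite -rmorphD lecR; apply: opn_le => [|x]; first by rewrite addr_ge0 ?opn_ge0.
by rewrite aopDE mulrDl (le_trans (hnD _ _))// lerD ?opnP.
Qed.

Lemma opnormZ c T : opnorm (c *: T) = `|c| * opnorm T.
Proof.
rewrite nrmE -rmorphM; congr (_%:C)%C.
have le (d : complex R) S : opn (d *: S) <= nrm d * opn S.
  apply: opn_le => [|x]; first by rewrite mulr_ge0 ?opn_ge0 ?nrm_ge0.
  by rewrite aopZE hnZ -mulrA ler_wpM2l ?nrm_ge0// opnP.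
have [->|c0] := eqVneq c 0.
  apply/eqP; rewrite eq_le le nrm0 mul0r; exact: opn_ge0.
apply/eqP; rewrite eq_le le /=.
have := le c^-1 (c *: T); rewrite scalerA mulVf// scale1r nrmcV.
have n0 : 0 < nrm c.
  by rewrite lt_neqAle nrm_ge0 andbT eq_sym; apply: contra c0 => /eqP/nrm_eq0/eqP.
by rewrite mulrC ler_pdivlMr// mulrC.
Qed.

Lemma opnorm_eq0 T : opnorm T = 0 -> T = 0.
Proof.
move=> /(@complexI R) h; apply: adjop_ext => x; rewrite aop0E; apply: hn_eq0.
apply/eqP; rewrite eq_le hn_ge0 andbT.
by have := opnP T x; rewrite h mul0r.
Qed.

HB.instance Definition _ :=
  Lmodule_isNormed.Build (complex R) adjop opnormD opnormZ opnorm_eq0.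

Lemma nrm_opn (T : adjop) : nrm T = opn T.
Proof. by []. Qed.

(** The limit and its adjoint are both obtained as pointwise limits, the
    adjoints being a Cauchy sequence for the same norm. *)
Lemma adjop_seq_complete (u : nat -> adjop) :
  (forall e : R, 0 < e -> exists N, forall m n, (N <= m)%N -> (N <= n)%N ->
     opn (u m - u n) < e) ->
  exists l, forall e : R, 0 < e -> exists N, forall n, (N <= n)%N ->
     opn (u n - l) < e.
Proof.
move=> hu.
have small (e : R) x : 0 < e -> exists2 d : R, 0 < d & d * hn x < e.
  move=> e0; have h1 : 0 < hn x + 1 by have := hn_ge0 x; lra.
  exists (e / (hn x + 1)); first by rewrite divr_gt0.
  by rewrite mulrAC ltr_pdivrMr// ltr_pM2l//; lra.
have lim x : exists y, forall e : R, 0 < e -> exists N, forall n, (N <= n)%N ->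
    hn (u n x - y) < e.
  apply: hn_complete => e e0; have [d d0 hd] := small e x e0.
  have [N hN] := hu d d0; exists N => m n Nm Nn.
  rewrite -aopBE; apply: le_lt_trans (opnP _ _) (le_lt_trans _ hd).
  by rewrite ler_wpM2r ?hn_ge0// ltW// hN.
pose L x := projT1 (cid (lim x)).
have hL x : forall e : R, 0 < e -> exists N, forall n, (N <= n)%N ->
    hn (u n x - L x) < e by exact: projT2 (cid (lim x)).
have adj n : exists S, is_adj (u n) S := (aopP (u n)).2.
pose S n := projT1 (cid (adj n)).
have hS n : is_adj (u n) (S n) by exact: projT2 (cid (adj n)).
have unif (e : R) : 0 < e -> exists N, forall n, (N <= n)%N ->
    forall x, hn (u n x - L x) <= e * hn x.
  move=> e0; have [N hN] := hu e e0; exists N => n Nn x.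
  apply/ler_addgt0Pr => d d0; have [M hM] := hL x d d0.
  apply: le_trans (hn_tri _ (u (maxn M N) x) _) _.
  apply: lerD; last by rewrite ltW// hM// leq_maxl.
  rewrite -aopBE; apply: le_trans (opnP _ _) _.
  by rewrite ler_wpM2r ?hn_ge0// ltW// hN// leq_maxr.
have [N1 h1] := unif 1 ltr01.
have opnS n m x : hn (S n x - S m x) <= opn (u n - u m) * hn x.
  have [->|s0] := eqVneq (hn (S n x - S m x)) 0.
    by rewrite mulr_ge0 ?opn_ge0 ?hn_ge0.
  have p0 : 0 < hn (S n x - S m x) by rewrite lt_neqAle eq_sym s0 hn_ge0.
  rewrite -(ler_pM2r p0) -expr2 hn_sqr {1}ipBl -!hS -ipBr -aopBE.
  apply: le_trans (ip_le _ _) _.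
  by rewrite [opn _ * _]mulrC -mulrA ler_wpM2l ?opnP// hn_ge0.
have limS x : exists y, forall e : R, 0 < e -> exists N, forall n, (N <= n)%N ->
    hn (S n x - y) < e.
  apply: hn_complete => e e0; have [d d0 hd] := small e x e0.
  have [N hN] := hu d d0; exists N => m n Nm Nn.
  apply: le_lt_trans (opnS _ _ _) (le_lt_trans _ hd).
  by rewrite ler_wpM2r ?hn_ge0// ltW// hN.
pose L' x := projT1 (cid (limS x)).
have hL' x : forall e : R, 0 < e -> exists N, forall n, (N <= n)%N ->
    hn (S n x - L' x) < e by exact: projT2 (cid (limS x)).
have adjL : adjointable L.
  split.
    exists (opn (u N1) + 1) => x; have := hn_tri (L x) (u N1 x) 0.
    rewrite !subr0 hnB; have := h1 N1 (leqnn _) x; have := opnP (u N1) x; lra.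
  exists L' => x y; apply/eqP; rewrite -subr_eq0; apply/eqP/nrm_small => e e0.
  have e20 : 0 < e / 2 by rewrite divr_gt0.
  have [d d0 hd] := small _ x e20; have [d' d'0 hd'] := small _ y e20.
  have [M hM] := hL y d d0; have [M' hM'] := hL' x d' d'0.
  set n := maxn M M'.
  have -> : <<x, L y>> - <<L' x, y>> =
      <<x, L y - u n y>> + <<S n x - L' x, y>>.
    by rewrite ipBr ipBl (hS n x y) addrA subrK.
  apply: le_trans (nrmD _ _) _.
  have b1 := ip_le x (L y - u n y); have b2 := ip_le (S n x - L' x) y.
  have c1 := hM n (leq_maxl _ _); have c2 := hM' n (leq_maxr _ _).
  rewrite hnB in c1; have := hn_ge0 x; have := hn_ge0 y; nra.
exists (mk_adjop adjL) => e e0.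
have e20 : 0 < e / 2 by rewrite divr_gt0.
have [N hN] := unif _ e20; exists N => n Nn.
apply: le_lt_trans (_ : e / 2 < e); last by lra.
by apply: opn_le => [|x]; [exact: ltW | exact: hN].
Qed.

Lemma adjop_complete (F : set_system adjop) : ProperFilter F -> cauchy F -> cvg F.
Proof. exact: sequentially_complete adjop_seq_complete F. Qed.

HB.instance Definition _ := Uniform_isComplete.Build adjop adjop_complete.

Lemma adjop_mul_subproof (T S : adjop) : adjointable (T \o S).
Proof.
split.
  exists (opn T * opn S) => x /=; apply: le_trans (opnP _ _) _.
  by rewrite -mulrA ler_wpM2l ?opn_ge0 ?opnP.
have [T' hT] := (aopP T).2; have [S' hS] := (aopP S).2.
by exists (S' \o T') => x y /=; rewrite hT hS.
Qed.

Definition adjop_mul (T S : adjop) := mk_adjop (adjop_mul_subproof T S).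

Definition adjoint_fun (T : adjop) := projT1 (cid (aopP T).2).

Lemma adjoint_funP (T : adjop) : is_adj T (adjoint_fun T).
Proof. exact: projT2 (cid (aopP T).2). Qed.

Lemma adjoint_fun_subproof (T : adjop) : adjointable (adjoint_fun T).
Proof.
split; first exact: is_adj_bounded (adjoint_funP T) (aopP T).1.
by exists T; exact: is_adj_sym (adjoint_funP T).
Qed.

Definition adjop_star (T : adjop) := mk_adjop (adjoint_fun_subproof T).

Lemma adjop_starP (T : adjop) x y : <<x, T y>> = <<adjop_star T x, y>>.
Proof. exact: adjoint_funP. Qed.

Lemma adjop_starPr (T : adjop) x y : <<T x, y>> = <<x, adjop_star T y>>.
Proof. by rewrite -ip_star adjop_starP ip_star. Qed.

Lemma ip_inj x y : (forall z, <<z, x>> = <<z, y>>) -> x = y.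
Proof.
by move=> h; apply/eqP; rewrite -subr_eq0; apply/eqP/ip_nondeg => z; rewrite ipBr h subrr.
Qed.

Lemma adjop_star_uniq (T S : adjop) : is_adj T S -> adjop_star T = S.
Proof.
move=> h; apply: adjop_ext => x; apply: ip_inj => z.
by rewrite -adjop_starPr -(is_adj_sym h).
Qed.

Lemma opn_mul (T S : adjop) : opn (adjop_mul T S) <= opn T * opn S.
Proof.
apply: opn_le => [|x]; first by rewrite mulr_ge0 ?opn_ge0.
apply: le_trans (opnP T (S x)) _.
by rewrite -mulrA ler_wpM2l ?opn_ge0 ?opnP.
Qed.

Lemma opn_star_mul (T : adjop) : opn (adjop_mul (adjop_star T) T) = opn T ^+ 2.
Proof.
have sq S : opn S ^+ 2 <= opn (adjop_mul (adjop_star S) S).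
  set M := opn (adjop_mul _ _); have M0 : 0 <= M by exact: opn_ge0.
  rewrite -(ler_sqrt _ M0) sqrtr_sqr ger0_norm ?opn_ge0//.
  apply: opn_le; first exact: sqrtr_ge0.
  move=> x; rewrite -(ler_pXn2r (ltn0Sn 1)) ?nnegrE ?mulr_ge0 ?sqrtr_ge0 ?hn_ge0//.
  rewrite hn_sqr exprMn (sqr_sqrtr M0) adjop_starPr.
  apply: le_trans (ip_le _ _) _; rewrite mulrC expr2 mulrA.
  by rewrite ler_wpM2r ?hn_ge0//; exact: (opnP (adjop_mul (adjop_star S) S)).
have le S : opn S <= opn (adjop_star S).
  have := le_trans (sq S) (opn_mul _ _); rewrite expr2.
  have [->|s0] := eqVneq (opn S) 0; first by rewrite opn_ge0.
  by rewrite ler_pM2r// lt_neqAle eq_sym s0 opn_ge0.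
have starK : adjop_star (adjop_star T) = T.
  by apply: adjop_star_uniq; exact: is_adj_sym (adjop_starP T).
have e : opn (adjop_star T) = opn T.
  by apply/eqP; rewrite eq_le le andbT -{2}starK le.
apply/eqP; rewrite eq_le sq andbT expr2 -{1}e; exact: opn_mul.
Qed.

Lemma adjop_mulA : associative adjop_mul.
Proof. by move=> S T U; apply: adjop_ext. Qed.

Lemma adjop_mulDl : left_distributive adjop_mul +%R.
Proof. by move=> S T U; apply: adjop_ext. Qed.

Lemma adjop_mulDr : right_distributive adjop_mul +%R.
Proof. by move=> S T U; apply: adjop_ext => x; exact: aopD. Qed.

Lemma adjop_mulZl (c : complex R) (S T : adjop) : adjop_mul (c *: S) T = c *: adjop_mul S T.
Proof. exact: adjop_ext. Qed.

Lemma adjop_mulZr (c : complex R) (S T : adjop) : adjop_mul S (c *: T) = c *: adjop_mul S T.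
Proof. by apply: adjop_ext => x; exact: aopZ. Qed.

Lemma adjop_starK : involutive adjop_star.
Proof. by move=> T; apply: adjop_star_uniq; exact: is_adj_sym (adjop_starP T). Qed.

Lemma adjop_starD : {morph adjop_star : S T / S + T}.
Proof.
move=> S T; apply: adjop_star_uniq => x y.
by rewrite !aopDE ipDr ipDl !adjop_starP.
Qed.

Lemma adjop_starZ (c : complex R) (T : adjop) : adjop_star (c *: T) = Num.conj c *: adjop_star T.
Proof.
by apply: adjop_star_uniq => x y; rewrite !aopZE ipZr ipZl conjCK adjop_starP.
Qed.

Lemma adjop_starM (S T : adjop) :
  adjop_star (adjop_mul S T) = adjop_mul (adjop_star T) (adjop_star S).
Proof. by apply: adjop_star_uniq => x y; rewrite /= !adjop_starP. Qed.

Lemma adjop_normM (S T : adjop) : `|adjop_mul S T| <= `|S| * `|T|.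
Proof. by rewrite !nrmE -rmorphM lecR; exact: opn_mul. Qed.

Lemma adjop_norm_star (T : adjop) : `|adjop_mul (adjop_star T) T| = `|T| ^+ 2.
Proof. by rewrite !nrmE -rmorphXn; congr (_%:C)%C; exact: opn_star_mul. Qed.

HB.instance Definition _ := isCStar.Build R adjop adjop_mulA adjop_mulDl
  adjop_mulDr adjop_mulZl adjop_mulZr adjop_starK adjop_starD adjop_starZ
  adjop_starM adjop_normM adjop_norm_star.

End HilbertModule.

(** * Positive elements of a unital C*-algebra *)

Definition is_unit (R : realType) (M : cstarType R) (e : M) :=
  (forall a, e ** a = a) /\ (forall a, a ** e = a).

Section Positive.
Variables (R : realType) (M : cstarType R) (e : M).
Implicit Types a b c d g h k x y : M.
Hypothesis eU : is_unit e.

Lemma unit_mull a : e ** a = a. Proof. exact: eU.1. Qed.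
Lemma unit_mulr a : a ** e = a. Proof. exact: eU.2. Qed.

Definition sc (r : R) : M := (r%:C)%C *: e.

Lemma unit_star : e^* = e.
Proof. by rewrite -[LHS]unit_mulr -{2}(cstarK e) -cstarM unit_mulr cstarK. Qed.

Lemma nrm_unit : nrm e <= 1.
Proof. by have := nrm_starM e; rewrite unit_star unit_mull; have := nrm_ge0 e; nra. Qed.

Lemma sc_star r : (sc r)^* = sc r.
Proof. by rewrite cstarZr unit_star. Qed.

Lemma sc_mul r a : sc r ** a = (r%:C)%C *: a.
Proof. by rewrite cmulZl unit_mull. Qed.

Lemma sc_mulr r a : a ** sc r = (r%:C)%C *: a.
Proof. by rewrite cmulZr unit_mulr. Qed.

Lemma scD r s : sc (r + s) = sc r + sc s.
Proof. by rewrite /sc rmorphD scalerDl. Qed.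

Lemma scB r s : sc (r - s) = sc r - sc s.
Proof. by rewrite /sc rmorphB scalerBl. Qed.

Lemma sc0 : sc 0 = 0.
Proof. exact: scale0r. Qed.

Lemma nrm_sc r : nrm (sc r) <= `|r|.
Proof. by rewrite nrmZ nrmcR ler_piMr ?nrm_unit. Qed.

Definition commutes a b := a ** b = b ** a.

Lemma commutes_sc a r : commutes a (sc r).
Proof. by rewrite /commutes sc_mul sc_mulr. Qed.

Lemma commutesC a b : commutes a b -> commutes b a. Proof. by []. Qed.

Lemma commutesD a b c : commutes a b -> commutes a c -> commutes a (b + c).
Proof. by rewrite /commutes => h1 h2; rewrite cmulDl cmulDr h1 h2. Qed.

Lemma commutesN a b : commutes a b -> commutes a (- b).
Proof. by rewrite /commutes => h; rewrite cmulNl cmulNr h. Qed.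

Lemma commutesB a b c : commutes a b -> commutes a c -> commutes a (b - c).
Proof. by move=> h1 h2; apply: commutesD => //; exact: commutesN. Qed.

Lemma commutesM a b c : commutes a b -> commutes a c -> commutes a (b ** c).
Proof. by rewrite /commutes => h1 h2; rewrite cmulA h1 -cmulA h2 cmulA. Qed.

Lemma nrm_sqr a : a^* = a -> nrm (a ** a) = nrm a ^+ 2.
Proof. by move=> as_; rewrite -{1}as_ nrm_starM. Qed.

(** [a + i b] is the multiple by [sqrt t] of a unitary. *)
Lemma sum_squares_le a b (t : R) : a^* = a -> b^* = b -> commutes a b -> 0 < t ->
  a ** a + b ** b = sc t -> nrm (a ** a) <= t.
Proof.
move=> as_ bs ab t0 h.
have s0 : 0 < Num.sqrt t by rewrite sqrtr_gt0.
set u := (((Num.sqrt t)^-1)%:C)%C.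
have uu : u * u = ((t^-1)%:C)%C.
  by rewrite -rmorphM -invfM -expr2 sqr_sqrtr// ltW.
have : nrm (u *: a) <= 1.
  (* For [c = 1 - u b] the equation [2 c = (u a)^2 + c^2] says [(u a)^2 +
     (u b)^2 = 1]. *)
  apply: (@unitary_part_le1 _ _ (u *: a) (e - u *: b)).
  - by rewrite cstarZr as_.
  - by rewrite cstarB unit_star cstarZr bs.
  - rewrite cmulBl cmulBr unit_mull unit_mulr !cmulZl !cmulZr (_ : a ** b = b ** a)//.
  - rewrite cmulBl !cmulBr unit_mull unit_mulr unit_mull !cmulZl !cmulZr !scalerA.
    have -> : (u * u) *: (a ** a) = e - (u * u) *: (b ** b).
      apply/eqP; rewrite -subr_eq opprK -scalerDr h /sc scalerA uu -rmorphM mulVf.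
        by rewrite scale1r.
      by rewrite gt_eqF.
    by zmodule.
rewrite nrm_sqr// nrmZ nrmcR ger0_norm ?invr_ge0 ?sqrtr_ge0//.
rewrite mulrC ler_pdivrMr// mul1r => h1.
by have := sqr_sqrtr (ltW t0); have := nrm_ge0 a; nra.
Qed.

(** Positivity is expressed through the norm, which makes sums of positive
    elements obviously positive. *)
Definition pos h := h^* = h /\ exists t : R, nrm (sc t - h) <= t.

(** If [2 d = x + d^2] then [(1 - d)^2 = 1 - x]; the general case follows by
    scaling. *)
Lemma shifted_sqrt x (s : R) : x^* = x -> nrm x < s -> exists g,
  [/\ g^* = g, g ** g = sc s - x, pos g &
      forall y, commutes x y -> commutes g y].
Proof.
move=> xs xl; have s0 : 0 < s by apply: le_lt_trans xl; exact: nrm_ge0.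
have [||d [ds dd dn dc]] := @half_sqrt _ _ (((s^-1)%:C)%C *: x).
- by rewrite cstarZr xs.
- by rewrite nrmZ nrmcR ger0_norm ?invr_ge0 ?(ltW s0)// mulrC ltr_pdivrMr// mul1r.
set w := ((Num.sqrt s)%:C)%C.
have ww : w * w = (s%:C)%C by rewrite -rmorphM -expr2 sqr_sqrtr// ltW.
exists (w *: (e - d)); split.
- by rewrite cstarZr cstarB unit_star ds.
- rewrite cmulZl cmulZr scalerA ww cmulBl !cmulBr unit_mull unit_mulr unit_mull.
  have -> : e - d - (d - d ** d) = e - ((s^-1)%:C)%C *: x.
    have -> : d ** d = d + d - ((s^-1)%:C)%C *: x by rewrite dd addrAC subrr add0r.
    by zmodule.
  by rewrite scalerBr scalerA -rmorphM mulfV ?scale1r// gt_eqF.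
- split; first by rewrite cstarZr cstarB unit_star ds.
  exists (Num.sqrt s); rewrite /sc -/w -scalerBr nrmZ nrmcR ger0_norm ?sqrtr_ge0//.
  rewrite ler_piMr ?sqrtr_ge0// opprB addrC subrK.
  apply: le_trans dn _; rewrite nrmZ nrmcR ger0_norm ?invr_ge0 ?(ltW s0)//.
  by rewrite mulrC ler_pdivrMr// mul1r ltW.
- move=> y hy; rewrite /commutes cmulZl cmulZr cmulBl cmulBr unit_mull unit_mulr dc//.
  by rewrite cmulZl cmulZr hy.
Qed.

(** [h + eps] is [(t + eps) - (t - h)], where [|t - h| <= t]. *)
Lemma pos_approx_sqrt h (eps : R) : pos h -> 0 < eps -> exists g,
  [/\ g^* = g, g ** g = h + sc eps, pos g &
      forall y, commutes h y -> commutes g y].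
Proof.
move=> [hs [t ht]] e0; have [||g [gs gg gp gc]] := @shifted_sqrt (sc t - h) (t + eps).
- by rewrite cstarB sc_star hs.
- by apply: le_lt_trans ht _; rewrite ltrDl.
exists g; split=> //; first by rewrite gg scD; zmodule.
move=> y hy; apply: gc; apply: commutesC; apply: commutesB.
  exact: commutes_sc.
exact: commutesC.
Qed.

Lemma pos_square g : g^* = g -> pos (g ** g).
Proof.
move=> gs; split; first by rewrite cstarM gs.
set t := nrm (g ** g) + 1; exists t.
have t1 : nrm (g ** g) < t by rewrite ltrDl.
have [|c [cs cc _ ccom]] := shifted_sqrt _ t1; first by rewrite cstarM gs.
rewrite -cc; apply: (@sum_squares_le c g) => //.
- by apply: ccom; rewrite /commutes cmulA.
- by apply: le_lt_trans t1; exact: nrm_ge0.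
- by rewrite cc subrK.
Qed.

(** This frees the definition of positivity from its existential quantifier: any
    bound of the norm serves as the constant. *)
Lemma pos_norm h (s : R) : pos h -> nrm h <= s -> nrm (sc s - h) <= s.
Proof.
move=> hp hs; apply/ler_addgt0Pr => eps e0; set d := eps / 3.
have d0 : 0 < d by rewrite divr_gt0.
have [g [gs gg _ gc]] := pos_approx_sqrt hp d0.
have nd : nrm (sc d) <= d by have := nrm_sc d; rewrite gtr0_norm.
have gl : nrm (g ** g) < s + 2 * d.
  by rewrite gg; apply: le_lt_trans (nrmD _ _) _; lra.
have [|c [cs cc _ ccom]] := shifted_sqrt _ gl; first by rewrite cstarM gs.
have s0 : 0 < s + 2 * d by apply: le_lt_trans gl; exact: nrm_ge0.
have -> : sc s - h = c ** c - sc d.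
  by rewrite cc gg mulr_natl mulr2n !scD; zmodule.
have cg : commutes c g by apply: ccom; rewrite /commutes cmulA.
have := sum_squares_le cs gs cg s0; rewrite cc subrK => /(_ erefl) h1.
apply: le_trans (nrmBD _ _) _; move: h1 nd; rewrite /d; lra.
Qed.

Lemma posD h k : pos h -> pos k -> pos (h + k).
Proof.
move=> [hs [t ht]] [ks [s hs']]; split; first by rewrite cstarD hs ks.
exists (t + s); rewrite scD opprD addrACA.
by apply: le_trans (nrmD _ _) _; rewrite lerD.
Qed.

Lemma posZ (r : R) h : 0 <= r -> pos h -> pos ((r%:C)%C *: h).
Proof.
move=> r0 [hs [t ht]]; split; first by rewrite cstarZr hs.
exists (r * t); rewrite /sc rmorphM -scalerA -scalerBr nrmZ nrmcR ger0_norm//.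
by rewrite ler_wpM2l.
Qed.

Lemma pos_sc (r : R) : 0 <= r -> pos (sc r).
Proof.
move=> r0; split; first exact: sc_star.
by exists r; rewrite subrr nrm0.
Qed.

Lemma pos_limit h : h^* = h ->
  (forall eps : R, 0 < eps -> exists2 k, pos k & nrm (h - k) <= eps) -> pos h.
Proof.
move=> hs happ; split=> //; exists (nrm h + 1); apply/ler_addgt0Pr => eps e0.
pose d := Num.min eps 1.
have d0 : 0 < d by rewrite lt_min e0 ltr01.
have [k kp hk] := happ d d0.
have de : d <= eps by rewrite ge_min lexx.
have d1 : d <= 1 by rewrite ge_min lexx orbT.
have kn : nrm k <= nrm h + 1.
  have := nrmBD h (h - k); rewrite opprB addrC subrK => h1.
  by apply: le_trans h1 _; rewrite lerD2l (le_trans hk).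
have h1 := pos_norm kp kn.
have -> : sc (nrm h + 1) - h = (sc (nrm h + 1) - k) + (k - h).
  by zmodule.
apply: le_trans (nrmD _ _) _; rewrite [nrm (k - h)]nrmB.
by apply: lerD => //; exact: le_trans hk de.
Qed.

(** The square of the product of commuting approximate roots of [h] and [k]
    approximates [h k]. *)
Lemma pos_mul h k : pos h -> pos k -> commutes h k -> pos (h ** k).
Proof.
move=> hp kp hk; apply: pos_limit; first by rewrite cstarM hp.1 kp.1.
move=> eps e0; set C := nrm h + nrm k + 1.
have C0 : 0 < C by have := nrm_ge0 h; have := nrm_ge0 k; rewrite /C; lra.
pose d := Num.min (eps / C) 1.
have d0 : 0 < d by rewrite lt_min ltr01 divr_gt0.
have d1 : d <= 1 by rewrite ge_min lexx orbT.
have dC : d * C <= eps by rewrite -ler_pdivlMr// ge_min lexx.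
have [a [as_ aa _ ac]] := pos_approx_sqrt hp d0.
have [b [bs bb _ bc]] := pos_approx_sqrt kp d0.
have ba : commutes b a.
  by apply: bc; apply: commutesC; apply: ac.
exists ((a ** b) ** (a ** b)).
  by apply: pos_square; rewrite cstarM as_ bs.
have -> : a ** b ** (a ** b) = h ** k + (d%:C)%C *: (h + k) + sc (d * d).
  rewrite -cmulA [b ** _]cmulA ba -[a ** b ** b]cmulA cmulA aa bb.
  rewrite cmulDl !cmulDr sc_mul !sc_mulr /sc [((d * d)%:C)%C]rmorphM -scalerA.
  by rewrite scalerDr; zmodule.
have -> : h ** k - (h ** k + (d%:C)%C *: (h + k) + sc (d * d)) =
  - ((d%:C)%C *: (h + k) + sc (d * d)) by zmodule.
rewrite nrmN; apply: le_trans (nrmD _ _) _; rewrite nrmZ nrmcR gtr0_norm//.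
have := nrm_sc (d * d); rewrite gtr0_norm ?mulr_gt0// => h1.
have h2 := nrmD h k; apply: le_trans dC; rewrite /C.
by have := nrm_ge0 (h + k); nra.
Qed.

(** Apply [sum_squares_le] to approximate roots of [h] and of [t - h]. *)
Lemma pos_le_norm h (t : R) : 0 <= t -> pos h -> pos (sc t - h) -> nrm h <= t.
Proof.
move=> t0 hp tp; apply/ler_addgt0Pr => eps e0; set d := eps / 3.
have d0 : 0 < d by rewrite divr_gt0.
have nd : nrm (sc d) <= d by have := nrm_sc d; rewrite gtr0_norm.
have [a [as_ aa _ ac]] := pos_approx_sqrt hp d0.
have [b [bs bb _ bc]] := pos_approx_sqrt tp d0.
have ba : commutes b a.
  apply: bc; apply: commutesC; apply: commutesB; first exact: commutes_sc.
  by apply: ac.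
have s0 : 0 < t + 2 * d by lra.
have := @sum_squares_le a b _ as_ bs (commutesC ba) s0; rewrite aa bb.
have -> : h + sc d + (sc t - h + sc d) = sc (t + 2 * d).
  by rewrite mulr_natl mulr2n !scD; zmodule.
move=> /(_ erefl) h1.
have := nrmBD (h + sc d) (sc d); rewrite addrK; rewrite /d in h1 nd *; lra.
Qed.

Lemma pos_oppr_eq0 h : pos h -> pos (- h) -> h = 0.
Proof.
move=> hp hn; apply: nrm_eq0; apply/eqP; rewrite eq_le nrm_ge0 andbT.
by apply: pos_le_norm => //; rewrite sc0 sub0r.
Qed.

Lemma pos_le_nrm h : h^* = h -> pos (sc (nrm h) - h).
Proof.
move=> hs; split; first by rewrite cstarB sc_star hs.
by exists (nrm h); rewrite opprB addrC subrK.
Qed.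

Lemma pos_monotone h k : pos h -> pos k -> nrm h <= nrm (h + k).
Proof.
move=> hp kp; apply: pos_le_norm => //; first exact: nrm_ge0.
have -> : sc (nrm (h + k)) - h = sc (nrm (h + k)) - (h + k) + k by zmodule.
by apply: posD => //; apply: pos_le_nrm; rewrite (posD hp kp).1.
Qed.

Lemma pos_eq0_sqr h : h^* = h -> h ** h = 0 -> h = 0.
Proof. by move=> hs hh; apply: star_eq0; rewrite hs. Qed.

(** Both roots of [h + s] and [h + t] being positive and commuting, the fourth
    power of their difference is at most [(s - t)^2]. *)
Lemma sqrt_shift_close h g k (s t : R) : pos g -> pos k -> commutes g k ->
  g ** g = h + sc s -> k ** k = h + sc t -> nrm (g - k) ^+ 2 <= `|s - t|.
Proof.
move=> gp kp gk gg kk; set X := g - k.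
have Xs : X^* = X by rewrite cstarB gp.1 kp.1.
have kg : k ** g = g ** k by rewrite gk.
have Xg : commutes X g by rewrite /commutes cmulBl cmulBr kg.
have Xk : commutes X k by rewrite /commutes cmulBl cmulBr kg.
have st : X ** (g + k) = sc (s - t).
  by rewrite cmulBl !cmulDr kg gg kk scB; zmodule.
have XX : commutes (X ** X) (g ** k).
  by apply: commutesM; apply: commutesC; apply: commutesM; apply: commutesC.
have key : sc ((s - t) ^+ 2) - (X ** X) ** (X ** X) =
    (X ** X) ** ((4%:R : R)%:C%C *: (g ** k)).
  have -> : sc ((s - t) ^+ 2) = (X ** X) ** ((g + k) ** (g + k)).
    have -> : sc ((s - t) ^+ 2) = sc (s - t) ** sc (s - t).
      by rewrite sc_mul /sc scalerA -rmorphM.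
    have Xgk : commutes X (g + k) by exact: commutesD.
    by rewrite -{1}st -{1}st -!cmulA; congr (_ ** _); rewrite cmulA -Xgk -cmulA.
  rewrite -cmulBr; congr (_ ** _).
  rewrite [4%:R%:C%C]rmorph_nat scaler_nat !mulrS mulr0n.
  rewrite cmulBl !cmulBr cmulDl !cmulDr kg; zmodule.
have XXs : (X ** X)^* = X ** X by rewrite cstarM Xs.
have p1 : pos (sc ((s - t) ^+ 2) - (X ** X) ** (X ** X)).
  rewrite key; apply: pos_mul; first exact: pos_square.
    by apply: posZ; rewrite ?ler0n//; exact: pos_mul.
  by rewrite /commutes cmulZl cmulZr XX.
have := pos_le_norm (exprn_ge0 2 (normr_ge0 (s - t))) (pos_square XXs).
rewrite real_normK ?num_real// => /(_ p1).
rewrite nrm_sqr// nrm_sqr// -[X in _ <= X]real_normK ?num_real//.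
by rewrite ler_pXn2r ?nnegrE ?exprn_ge0 ?nrm_ge0.
Qed.

(** The roots of the [h + 1 / (n + 1)] converge by [sqrt_shift_close]. *)
Lemma pos_sqrt h : pos h -> exists g,
  [/\ pos g, g ** g = h & forall y, commutes h y -> commutes g y].
Proof.
move=> hp.
have inv0 n : 0 < n.+1%:R^-1 :> R by rewrite invr_gt0.
pose u n := projT1 (cid (pos_approx_sqrt hp (inv0 n))).
have hu n : [/\ (u n)^* = u n, u n ** u n = h + sc n.+1%:R^-1, pos (u n) &
    forall y, commutes h y -> commutes (u n) y].
  exact: projT2 (cid (pos_approx_sqrt hp (inv0 n))).
have up n : pos (u n) by case: (hu n).
have uu n : u n ** u n = h + sc n.+1%:R^-1 by case: (hu n).
have uc n y : commutes h y -> commutes (u n) y by case: (hu n) => _ _ _; apply.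
have arch (d : R) : 0 < d -> exists N, forall n, (N <= n)%N -> n.+1%:R^-1 < d.
  move=> d0; have [N _ hN] := near_infty_natSinv_lt (PosNum d0).
  by exists N => n Nn; exact: (hN n Nn).
have [g hg] : exists g, forall d : R, 0 < d ->
    exists N, forall n, (N <= n)%N -> nrm (u n - g) < d.
  apply: nrm_complete => d d0.
  have [N hN] := arch (d ^+ 2) (exprn_gt0 2 d0).
  exists N => m n Nm Nn; rewrite -(ltr_pXn2r (ltn0Sn 1)) ?nnegrE ?nrm_ge0 ?(ltW d0)//.
  have cmn : commutes (u m) (u n).
    by apply: (uc m); apply: commutesC; apply: (uc n).
  apply: le_lt_trans (sqrt_shift_close (up m) (up n) cmn (uu m) (uu n)) _.
  rewrite ltr_norml; have := hN m Nm; have := hN n Nn.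
  move: (inv0 m) (inv0 n); set p := m.+1%:R^-1; set q := n.+1%:R^-1.
  by move=> p0 q0 p1 q1; apply/andP; split; lra.
have near (d : R) : 0 < d -> exists2 n, nrm (u n - g) < d & n.+1%:R^-1 < d.
  move=> d0; have [N hN] := hg d d0; have [M' hM] := arch d d0.
  by exists (maxn N M'); [exact/hN/leq_maxl | exact/hM/leq_maxr].
have half (d : R) : 0 < d -> 0 < d / 2 by move=> d0; rewrite divr_gt0.
have gs : g^* = g.
  apply/eqP; rewrite -subr_eq0; apply/eqP/nrm_small => d d0.
  have [n hn _] := near _ (half d d0).
  have := nrm_tri (g^*) (u n) g; rewrite -{1}(up n).1 -cstarB nrm_star.
  by rewrite [nrm (g - _)]nrmB; lra.
exists g; split.
- apply: pos_limit => // d d0; have [n hn _] := near d d0.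
  by exists (u n) => //; rewrite nrmB ltW.
- apply/eqP; rewrite -subr_eq0; apply/eqP/nrm_small => d d0.
  set C := 2 * nrm g + 2.
  have C0 : 0 < C by have := nrm_ge0 g; rewrite /C; lra.
  pose d' := Num.min (d / C) 1.
  have d'0 : 0 < d' by rewrite lt_min ltr01 divr_gt0.
  have d1 : d' <= 1 by rewrite ge_min lexx orbT.
  have dC : d' * C <= d by rewrite -ler_pdivlMr// ge_min lexx.
  have [n hn hn'] := near d' d'0.
  have -> : g ** g - h = - ((u n - g) ** u n) - g ** (u n - g) + sc n.+1%:R^-1.
    rewrite cmulBl cmulBr uu; zmodule.
  apply: le_trans (nrmD _ _) _; apply: le_trans (lerD (nrmBD _ _) (nrm_sc _)) _.
  rewrite nrmN (gtr0_norm (inv0 n)).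
  have h1 := nrmM (u n - g) (u n); have h2 := nrmM g (u n - g).
  have h3 := nrmD (u n - g) g; rewrite subrK in h3.
  have := nrm_ge0 (u n - g); have := nrm_ge0 g; move: hn hn' (inv0 n).
  set p := n.+1%:R^-1; set q := nrm (u n - g); rewrite -/q in h1 h2 h3.
  move=> q1 p1 p0 g0 q0; apply: le_trans dC; rewrite /C.
  have k1 : q * nrm (u n) <= q * (1 + nrm g) by apply: ler_wpM2l => //; lra.
  have k2 : q * nrm g <= d' * nrm g by apply: ler_wpM2r => //; lra.
  by lra.
- move=> y hy; apply/eqP; rewrite -subr_eq0; apply/eqP/nrm_small => d d0.
  have C0 : 0 < 2 * nrm y + 1 by have := nrm_ge0 y; lra.
  have [n hn _] := near (d / (2 * nrm y + 1)) (divr_gt0 d0 C0).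
  have -> : g ** y - y ** g = (g - u n) ** y - y ** (g - u n).
    have := uc n y hy; rewrite /commutes => e1.
    rewrite cmulBl cmulBr e1; zmodule.
  have b1 := nrmBD ((g - u n) ** y) (y ** (g - u n)).
  have b2 := nrmM (g - u n) y; have b3 := nrmM y (g - u n).
  have : nrm (g - u n) * (2 * nrm y + 1) <= d.
    by rewrite -ler_pdivlMr// nrmB ltW.
  have := nrm_ge0 (g - u n); lra.
Qed.

(** With [x = a + a^*] and [y = i a - i a^*], the sum [a a^* + a^* a] is [(x^2 +
    y^2) / 2], which is positive. *)
Lemma pos_star_flip a : pos (- (a^* ** a)) -> pos (a ** a^*).
Proof.
move=> hp; pose x := a + a^*; pose y := 'i *: (a - a^*).
have xs : x^* = x by rewrite cstarD cstarK addrC.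
have ys : y^* = y.
  by rewrite cstarZ conj_i cstarB cstarK scaleNr -scalerN opprB.
have xy : ((2^-1 : R)%:C)%C *: (x ** x + y ** y) = a ** a^* + a^* ** a.
  rewrite /x /y cmulZl cmulZr scalerA -expr2 sqrCi scaleN1r.
  rewrite !cmulDl !cmulDr !(cmulNl, cmulNr).
  set p := a ** a; set q := a ** a^*; set r := a^* ** a; set t := a^* ** a^*.
  have -> : p + q + (r + t) - (p - q + (- r - - t)) = (q + r) + (q + r).
    by zmodule.
  rewrite [LHS]scalerDr -scalerDl -rmorphD /= (_ : 2^-1 + 2^-1 = 1 :> R) ?scale1r//; lra.
have -> : a ** a^* = ((2^-1 : R)%:C)%C *: (x ** x + y ** y) + - (a^* ** a).
  by rewrite xy addrK.
apply: posD => //; apply: posZ; first by rewrite invr_ge0 ler0n.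
by apply: posD; exact: pos_square.
Qed.

(** Let [g] be the root of [- a^* a]. Flipping [a g] shows that the positive
    element [a a^* a a^*] is also negative. *)
Lemma neg_star_eq0 a : pos (- (a^* ** a)) -> a = 0.
Proof.
move=> hp; have [g [gp gg _]] := pos_sqrt hp; have gs := gp.1.
have Ps : (a ** a^*)^* = a ** a^* by rewrite cstarM cstarK.
have neg : pos (- ((a ** a^*) ** (a ** a^*))).
  have -> : - ((a ** a^*) ** (a ** a^*)) = (a ** g) ** (a ** g)^*.
    rewrite cstarM gs -[RHS]cmulA [g ** (g ** _)]cmulA gg cmulNl cmulNr.
    by rewrite !cmulA.
  apply: pos_star_flip.
  have -> : - ((a ** g)^* ** (a ** g)) = (g ** g) ** (g ** g).
    rewrite cstarM gs {2}gg cmulNr -!cmulA; congr (- (_ ** _)).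
    rewrite [a^* ** (a ** g)]cmulA -[a^* ** a]opprK -gg cmulNl cmulNr.
    by rewrite -cmulA.
  by apply: pos_square; rewrite cstarM gs.
have := pos_oppr_eq0 (pos_square Ps) neg => /(pos_eq0_sqr Ps).
rewrite -{1}(cstarK a) => /star_eq0 as0.
by rewrite -(cstarK a) as0 cstar0.
Qed.

(** The argument of Fukamiya and Kaplansky: [h = c^* c] is compared with its
    absolute value [g], and [d = c (g - h)] satisfies [- d^* d >= 0]. *)
Theorem pos_star c : pos (c^* ** c).
Proof.
set h := c^* ** c; have hs : h^* = h by rewrite cstarM cstarK.
have [g [gp gg gc]] := pos_sqrt (pos_square hs).
have gh : commutes g h by apply: gc; rewrite /commutes cmulA.
pose y := g - h; have ys : y^* = y by rewrite cstarB gp.1 hs.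
have hg : h ** g = g ** h by [].
have hy : h ** y = - (g ** y).
  by rewrite /y !cmulBr gg hg opprB.
(* [h y = - g y] gives [- (c y)^* (c y) = g y^2], a product of commuting
   positive elements. *)
have d0 : c ** y = 0.
  apply: neg_star_eq0.
  have -> : - ((c ** y)^* ** (c ** y)) = g ** (y ** y).
    rewrite cstarM ys -cmulA [c^* ** _]cmulA -/h hy cmulNr opprK.
    have yg : y ** g = g ** y by rewrite /y cmulBl cmulBr hg.
    by rewrite cmulA yg -cmulA.
  apply: pos_mul => //; first exact: pos_square.
  have gy : commutes g y by apply: commutesB.
  exact: commutesM.
have hy0 : h ** y = 0 by rewrite /h -cmulA d0 cmul0r.
have gy0 : g ** y = 0 by rewrite -[LHS]opprK -hy hy0 oppr0.
have y0 : y = 0.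
  by apply: (pos_eq0_sqr ys); rewrite {1}/y cmulBl gy0 hy0 subrr.
by have -> : h = g by apply/eqP; rewrite eq_sym -subr_eq0 -/y y0.
Qed.

End Positive.

Section UnitalCauchySchwarz.
Variables (R : realType) (M : cstarType R) (e : M).
Hypothesis eU : is_unit e.
Local Notation pos := (pos e).
Local Notation sc := (sc e).

Lemma pos0 : pos 0.
Proof. by have := pos_sc eU (lexx 0); rewrite sc0. Qed.

Lemma pos_sum (I : Type) (s : seq I) (x : I -> M) :
  pos (\sum_(i <- s) (x i)^* ** x i).
Proof.
elim: s => [|i s ih]; first by rewrite big_nil; exact: pos0.
by rewrite big_cons; apply: posD => //; exact: (pos_star eU).
Qed.

(** With [g] the root of [k] this is [(g b)^* (g b)]. *)
Lemma pos_conj k b : pos k -> pos (b^* ** k ** b).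
Proof.
move=> kp; have [g [gp gg _]] := pos_sqrt eU kp.
have -> : b^* ** k ** b = (g ** b)^* ** (g ** b).
  by rewrite cstarM gp.1 -gg !cmulA.
exact: (pos_star eU).
Qed.

(** The usual proof of the Cauchy-Schwarz inequality: the sum of the
    [z_i^* z_i] for [z_i = t x_i - y_i b] is positive. *)
Lemma cauchy_schwarz_unital (I : Type) (s : seq I) (x y : I -> M) :
  nrm (\sum_(i <- s) (x i)^* ** y i) ^+ 2 <=
  nrm (\sum_(i <- s) (x i)^* ** x i) * nrm (\sum_(i <- s) (y i)^* ** y i).
Proof.
set X := \sum_(i <- s) (x i)^* ** x i; set Y := \sum_(i <- s) (y i)^* ** y i.
pose b := \sum_(i <- s) (y i)^* ** x i.
have bs : b^* = \sum_(i <- s) (x i)^* ** y i.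
  by rewrite cstar_sum; apply: eq_bigr => i _; rewrite cstarM cstarK.
have Xp : pos X by exact: pos_sum.
have Yp : pos Y by exact: pos_sum.
rewrite -bs nrm_star.
(* An upper bound [t] of [Y] with [t > 0] avoids dividing by the norm of
   [Y]. *)
suff main (t : R) : nrm Y < t -> nrm b ^+ 2 <= nrm X * t.
  apply/ler_addgt0Pr => eps e0.
  have C0 : 0 < nrm X + 1 by have := nrm_ge0 X; lra.
  have d0 : 0 < eps / (nrm X + 1) by rewrite divr_gt0.
  have /main h : nrm Y < nrm Y + eps / (nrm X + 1) by rewrite ltrDl.
  apply: le_trans h _; rewrite mulrDr lerD2l mulrCA ler_piMr ?(ltW e0)//.
  by rewrite ler_pdivrMr// mul1r; lra.
move=> Yt; have t0 : 0 < t by apply: le_lt_trans Yt; exact: nrm_ge0.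
pose z i := (t%:C)%C *: x i - y i ** b.
have zE : \sum_(i <- s) (z i)^* ** z i =
    (t%:C)%C *: ((t%:C)%C *: X - b^* ** b) - ((t%:C)%C *: (b^* ** b) - b^* ** Y ** b).
  rewrite /X /Y scalerBr !scaler_sumr cmul_sumr cmul_suml.
  have -> : b^* ** b = \sum_(i <- s) (b^* ** ((y i)^* ** x i)).
    by rewrite /b cmul_sumr.
  have e2 : \sum_(i <- s) (b^* ** ((y i)^* ** x i)) =
      \sum_(i <- s) (((x i)^* ** y i) ** b).
    by rewrite -cmul_sumr -cmul_suml -bs.
  rewrite {2}e2 !scaler_sumr -!sumrB; apply: eq_bigr => i _.
  rewrite /z cstarB cstarZr cstarM cmulBl !cmulBr !cmulZl !cmulZr !cmulA.
  by zmodule.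
have kp : pos (sc t - Y).
  split; first by rewrite cstarB (sc_star eU) Yp.1.
  by exists t; rewrite opprB addrC subrK ltW.
have key : pos ((t%:C)%C *: X - b^* ** b).
  have h : pos ((t%:C)%C *: ((t%:C)%C *: X - b^* ** b)).
    have -> : (t%:C)%C *: ((t%:C)%C *: X - b^* ** b) =
      \sum_(i <- s) (z i)^* ** z i + b^* ** (sc t - Y) ** b.
      by rewrite zE cmulBr cmulBl (sc_mulr eU) cmulZl subrK.
    by apply: posD => //; [exact: pos_sum | exact: pos_conj].
  have := posZ (ltW (_ : 0 < t^-1)) h.
  by rewrite invr_gt0 => /(_ t0); rewrite scalerA -rmorphM mulVf ?scale1r ?gt_eqF.
rewrite -nrm_starM mulrC.
apply: (pos_le_norm eU); first by rewrite mulr_ge0 ?nrm_ge0 ?ltW.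
  exact: (pos_star eU).
have -> : sc (t * nrm X) - b^* ** b =
    (t%:C)%C *: (sc (nrm X) - X) + ((t%:C)%C *: X - b^* ** b).
  by rewrite scalerBr /sc scalerA -rmorphM; zmodule.
apply: posD => //; apply: posZ; first exact: ltW.
by apply: (pos_le_nrm eU); exact: Xp.1.
Qed.

Lemma sum_star_monotone_unital (I : Type) (s t : seq I) (x : I -> M) :
  nrm (\sum_(i <- s) (x i)^* ** x i) <= nrm (\sum_(i <- s ++ t) (x i)^* ** x i).
Proof. by rewrite big_cat /=; apply: (pos_monotone eU); exact: pos_sum. Qed.

(** In the sense of spectra, [x (1 - x)^n] is at most [1 / (n + 1)] because the
    decreasing powers telescope. *)
Lemma nrm_power_small x n : pos x -> pos (sc 1 - x) ->
  nrm (x ** iter n (cmul (sc 1 - x)) e) * n.+1%:R <= 1.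
Proof.
move=> xp; set k := sc 1 - x => kp.
pose K m := iter m (cmul k) e.
have KS m : K m.+1 = k ** K m by [].
have kx : commutes k x.
  apply: commutesC; apply: commutesB => //; exact: (commutes_sc eU).
have com c m : commutes c k -> commutes c (K m).
  move=> ck; elim: m => [|m ih]; first by rewrite /commutes (unit_mull eU) (unit_mulr eU).
  by rewrite KS; exact: commutesM.
have Kp m : pos (K m).
  elim: m => [|m ih]; last by rewrite KS; apply: (pos_mul eU) => //; apply: com.
  by have := pos_sc eU ler01; rewrite /sc scale1r.
have xKp m : pos (x ** K m) by apply: (pos_mul eU) => //; apply: com.
have kK m : k ** K m = K m - x ** K m.
  by rewrite /k cmulBl /sc scale1r unit_mull.
have tele m : \sum_(i < m) (x ** K i) = sc 1 - K m.
  elim: m => [|m ih]; first by rewrite big_ord0 /sc scale1r subrr.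
  by rewrite big_ord_recr KS kK /= ih; zmodule.
(* The summands decrease, so each of the first [n + 1] is at least the
   last. *)
have dec m j : pos (x ** K m - x ** K (m + j)%N).
  elim: j => [|j ih]; first by rewrite addn0 subrr; exact: pos0.
  have -> : x ** K m - x ** K (m + j.+1)%N =
    (x ** K m - x ** K (m + j)%N) + x ** (x ** K (m + j)%N).
    by rewrite addnS KS kK cmulBr; zmodule.
  apply: posD => //; apply: (pos_mul eU) => //.
  by apply: commutesM => //; apply: com.
have np : pos (sc 1 - (n.+1%:R%:C)%C *: (x ** K n)).
  have -> : sc 1 - (n.+1%:R%:C)%C *: (x ** K n) =
      K n.+1 + \sum_(i < n.+1) (x ** K i - x ** K n).
    rewrite sumrB tele sumr_const card_ord.
    rewrite [((n.+1%:R)%:C)%C]rmorph_nat scaler_nat; zmodule.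
  apply: posD => //; apply: big_ind => [||i _]; [exact: pos0|exact: posD|].
  by have := dec i (n - i)%N; rewrite subnKC// -ltnS.
have := pos_le_norm eU ler01 (posZ (ler0n R n.+1) (xKp n)) np.
by rewrite nrmZ nrmcR normr_nat mulrC.
Qed.

End UnitalCauchySchwarz.

(** * Multipliers, and consequences in algebras without unit *)

Section Multipliers.
Variables (R : realType) (A : cstarType R).

Lemma self_cs (x y : A) :
  nrm (x^* ** y) ^+ 2 <= nrm (x^* ** x) * nrm (y^* ** y).
Proof.
rewrite !nrm_starM -exprMn ler_pXn2r ?nnegrE ?mulr_ge0 ?nrm_ge0//.
by rewrite -(nrm_star x); exact: nrmM.
Qed.

Lemma self_star (x y : A) : (x^* ** y)^* = y^* ** x.
Proof. by rewrite cstarM cstarK. Qed.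

Lemma self_complete (u : nat -> A) :
  (forall e : R, 0 < e -> exists N, forall m n, (N <= m)%N -> (N <= n)%N ->
     nrm ((u m - u n)^* ** (u m - u n)) < e) ->
  exists l, forall e : R, 0 < e -> exists N, forall n, (N <= n)%N ->
     nrm ((u n - l)^* ** (u n - l)) < e.
Proof.
move=> hu; have [|l hl] := @nrm_complete R A u.
  move=> e e0; have [N hN] := hu _ (exprn_gt0 2 e0).
  exists N => m n Nm Nn; have := hN m n Nm Nn; rewrite nrm_starM.
  by rewrite ltr_pXn2r ?nnegrE ?nrm_ge0// ltW.
exists l => e e0; have s0 : 0 < Num.sqrt e by rewrite sqrtr_gt0.
have [N hN] := hl _ s0; exists N => n Nn; rewrite nrm_starM.
rewrite -[ltRHS](sqr_sqrtr (ltW e0)) ltr_pXn2r ?nnegrE ?nrm_ge0 ?sqrtr_ge0//.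
exact: hN.
Qed.

Definition self_module : hilbert_module A A :=
  @HilbertModule R A A (fun x y => x^* ** y)
    (fun x y z => cmulDr (x^*) y z) (fun c x y => cmulZr c (x^*) y) self_star
    (@star_eq0 R A) self_cs self_complete.

Definition multiplier := adjop self_module.

Lemma left_mul_adjointable (a : A) : adjointable self_module (cmul a).
Proof.
split; last by exists (cmul (a^*)) => x y /=; rewrite cstarM cstarK cmulA.
have hnE x : hn self_module x = nrm x.
  by rewrite /hn /= nrm_starM sqrtr_sqr ger0_norm ?nrm_ge0.
by exists (nrm a) => x; rewrite !hnE; exact: nrmM.
Qed.

(** An isometric embedding of [A] into a unital algebra, to which the theory of
    positive elements applies. *)
Definition left_mul (a : A) : multiplier := mk_adjop (left_mul_adjointable a).

Lemma id_adjointable : adjointable self_module id.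
Proof. by split; [exists 1 => x; rewrite mul1r | exists id]. Qed.

Definition mult_unit : multiplier := mk_adjop id_adjointable.

Lemma mult_unitP : is_unit mult_unit.
Proof. by split=> a; exact: adjop_ext. Qed.

Lemma left_mul_hom : star_hom left_mul.
Proof.
split.
- by move=> c a b; apply: adjop_ext => x /=; rewrite cmulDl cmulZl.
- by move=> a b; apply: adjop_ext => x /=; rewrite cmulA.
- move=> a; apply/esym; apply: adjop_star_uniq => x y /=.
  by rewrite cstarM cstarK cmulA.
Qed.

Lemma nrm_left_mul a : nrm (left_mul a) = nrm a.
Proof.
apply/eqP; rewrite eq_le (hom_contractive left_mul_hom)/=.
have [->|a0] := eqVneq a 0; first by rewrite nrm0 nrm_ge0.
have p0 : 0 < nrm a.
  by rewrite lt_neqAle nrm_ge0 andbT eq_sym; apply: contra a0 => /eqP/nrm_eq0/eqP.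
have := opnP (left_mul a) (a^*).
rewrite /hn /= !nrm_starM !sqrtr_sqr !ger0_norm ?nrm_ge0// nrm_Mstar nrm_star.
by rewrite expr2 ler_pM2r.
Qed.

Lemma cauchy_schwarz (I : Type) (s : seq I) (x y : I -> A) :
  nrm (\sum_(i <- s) (x i)^* ** y i) ^+ 2 <=
  nrm (\sum_(i <- s) (x i)^* ** x i) * nrm (\sum_(i <- s) (y i)^* ** y i).
Proof.
have E (u v : I -> A) : nrm (\sum_(i <- s) (u i)^* ** v i) =
    nrm (\sum_(i <- s) (left_mul (u i))^* ** left_mul (v i)).
  rewrite -nrm_left_mul (hom_sum left_mul_hom); congr nrm; apply: eq_bigr => i _.
  by rewrite (homM left_mul_hom) (homS left_mul_hom).
rewrite !E; exact: (cauchy_schwarz_unital mult_unitP).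
Qed.

Lemma sum_star_monotone (I : Type) (s t : seq I) (x : I -> A) :
  nrm (\sum_(i <- s) (x i)^* ** x i) <= nrm (\sum_(i <- s ++ t) (x i)^* ** x i).
Proof.
have E r : nrm (\sum_(i <- r) (x i)^* ** x i) =
    nrm (\sum_(i <- r) (left_mul (x i))^* ** left_mul (x i)).
  rewrite -nrm_left_mul (hom_sum left_mul_hom); congr nrm; apply: eq_bigr => i _.
  by rewrite (homM left_mul_hom) (homS left_mul_hom).
rewrite !E; exact: (sum_star_monotone_unital mult_unitP).
Qed.

End Multipliers.

(** Powers of [1 - a^* a] (for [a] small) kill [a], so [a] is approximated by
    elements of the form [a a^* a c]. *)
Lemma ideal_cube (R : realType) (A : cstarType R) (I : set A) (a : A) :
  closed_ideal I -> I (a ** a^* ** a) -> I a.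
Proof.
move=> cI Ia; have eU := mult_unitP A; set e := mult_unit A in eU.
set L := @left_mul R A; have LH : star_hom L by exact: left_mul_hom.
set t := nrm a ^+ 2 + 1.
have t0 : 0 < t by have := exprn_ge0 2 (nrm_ge0 a); rewrite /t; lra.
pose x := ((t^-1)%:C)%C *: (a^* ** a).
have xp : pos e (L x).
  rewrite (homZ LH) (homM LH) (homS LH); apply: posZ; first by rewrite invr_ge0 ltW.
  exact: (pos_star eU).
(* Together with the positivity of [L x] this puts [1 - x] between 0 and
   1. *)
have x1 : nrm (L x) <= 1.
  apply: le_trans (hom_contractive LH _) _.
  rewrite nrmZ nrmcR gtr0_norm ?invr_gt0// nrm_starM mulrC ler_pdivrMr// mul1r.
  by rewrite lerDl.
set k := sc e 1 - L x.
have kp : pos e k.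
  split; first by rewrite cstarB (sc_star eU) xp.1.
  by exists 1; rewrite opprB addrC subrK.
have k1 : nrm k <= 1 by exact: (pos_norm eU).
pose K n := iter n (cmul k) e.
have K1 n : nrm (K n) <= 1.
  elim: n => [|n ih]; first exact: (nrm_unit eU).
  rewrite /= -/(K n); apply: le_trans (nrmM _ _) _.
  by have := nrm_ge0 k; have := nrm_ge0 (K n); nra.
have Ks n : commutes k (K n).
  elim: n => [|n ih]; first by rewrite /commutes /K /= (unit_mull eU) (unit_mulr eU).
  by rewrite /K /= -/(K n); exact: commutesM.
have Kstar n : (K n)^* = K n.
  elim: n => [|n ih]; first exact: (unit_star eU).
  by rewrite /K /= -/(K n) cstarM ih kp.1 Ks.
(* [b n] is [a (1 - x)^n], formed without a unit. *)
pose b n := iter n (fun c => c - c ** x) a.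
have bS n : b n.+1 = b n - b n ** x by [].
have bL n : L (b n) = L a ** K n.
  elim: n => [|n ih]; first by rewrite /K /= (unit_mulr eU).
  rewrite bS (homB LH) (homM LH) ih -cmulA /K /= -/(K n) (_ : k ** K n = K n ** k) ?Ks//.
  by rewrite /k cmulBr /sc scale1r (unit_mulr eU) cmulBr.
have IB c d : I c -> I d -> I (c - d).
  move=> Ic Id; apply: (subspaceD (ideal_subspace cI)) => //.
  by rewrite -scaleN1r; apply: (subspaceZ (ideal_subspace cI)).
have Iab n : I (a - b n).
  elim: n => [|n ih]; first by rewrite subrr; exact: (subspace0 (ideal_subspace cI)).
  have -> : a - b n.+1 = (a - b n) + (a ** x - (a - b n) ** x).
    by rewrite bS cmulBl; zmodule.
  apply: (subspaceD (ideal_subspace cI)) => //; apply: IB; last first.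
    by case: cI => _ _ Mr; exact: Mr.
  rewrite cmulZr cmulA; exact: (subspaceZ (ideal_subspace cI)).
have bn n : nrm (b n) ^+ 2 * n.+1%:R <= t.
  have -> : nrm (b n) ^+ 2 = t * nrm (K n ** (L x ** K n)).
    rewrite -(nrm_left_mul (b n)) -/(L _) bL -nrm_starM cstarM Kstar.
    have -> : K n ** (L a)^* ** (L a ** K n) = (t%:C)%C *: (K n ** (L x ** K n)).
      rewrite /x (homZ LH) (homM LH) (homS LH) cmulZl cmulZr scalerA -rmorphM.
      by rewrite mulfV ?scale1r ?gt_eqF// !cmulA.
    by rewrite nrmZ nrmcR gtr0_norm.
  rewrite -mulrA ler_piMr ?(ltW t0)//.
  have := nrm_power_small eU n xp kp; rewrite -/k -/(K n).
  apply: le_trans; rewrite ler_wpM2r ?ler0n//.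
  apply: le_trans (nrmM _ _) _; rewrite ler_piMl ?nrm_ge0//.
have cl := subspace_closed (ideal_subspace cI).
move/closedP: cl; apply => eps e0.
have [N _ hN] := near_infty_natSinv_lt (PosNum (divr_gt0 (exprn_gt0 2 e0) t0)).
exists (a - b N) => //; rewrite opprB addrC subrK.
have := hN N (leqnn N); rewrite /= ltr_pdivlMr// mulrC ltr_pdivrMr ?ltr0n// => h.
rewrite -(ltr_pXn2r (ltn0Sn 1)) ?nnegrE ?nrm_ge0 ?(ltW e0)//.
have n0 : (0 : R) < N.+1%:R by rewrite ltr0n.
by rewrite -(ltr_pM2r n0); apply: le_lt_trans (bn N) h.
Qed.

(** * The standard Hilbert module of square-summable sequences *)

Section SequenceLimits.
Variables (R : realType) (V : normedModType (complex R)).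
Implicit Types (u v : nat -> V) (l : V).

Definition tends u l := forall e : R, 0 < e ->
  exists N, forall n, (N <= n)%N -> nrm (u n - l) < e.

Lemma tends_close u l v m : tends u l -> tends v m -> forall e : R, 0 < e ->
  exists N, forall n, (N <= n)%N -> nrm (u n - l) < e /\ nrm (v n - m) < e.
Proof.
move=> hu hv e e0; have [N hN] := hu e e0; have [M hM] := hv e e0.
exists (maxn N M) => n; rewrite geq_max => /andP[Nn Mn].
by split; [exact: hN | exact: hM].
Qed.

Lemma tends_uniq u l m : tends u l -> tends u m -> l = m.
Proof.
move=> hl hm; apply/eqP; rewrite -subr_eq0; apply/eqP/nrm_small => e e0.
have e20 : 0 < e / 2 by rewrite divr_gt0.
have [N /(_ N (leqnn N)) [h1 h2]] := tends_close hl hm e20.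
by have := nrm_tri l (u N) m; rewrite [nrm (l - u N)]nrmB; lra.
Qed.

Lemma tendsD u v l m : tends u l -> tends v m ->
  tends (fun n => u n + v n) (l + m).
Proof.
move=> hu hv e e0; have e20 : 0 < e / 2 by rewrite divr_gt0.
have [N hN] := tends_close hu hv e20; exists N => n Nn; have [h1 h2] := hN n Nn.
by rewrite opprD addrACA; apply: le_lt_trans (nrmD _ _) _; lra.
Qed.

Lemma tendsZ c u l : tends u l -> tends (fun n => c *: u n) (c *: l).
Proof.
move=> hu e e0; have c0 : 0 < nrm c + 1 by have := nrm_ge0 c; lra.
have [N hN] := hu _ (divr_gt0 e0 c0); exists N => n Nn; have := hN n Nn.
rewrite ltr_pdivlMr// -scalerBr nrmZ => h; apply: le_lt_trans h.
by rewrite mulrC ler_wpM2l ?nrm_ge0// lerDl.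
Qed.

Lemma tends_nrm_le u l (c : R) : tends u l -> (forall n, nrm (u n) <= c) ->
  nrm l <= c.
Proof.
move=> hu hc; apply/ler_addgt0Pr => e e0; have [N /(_ N (leqnn N)) h] := hu e e0.
by have := nrm_tri l (u N) 0; rewrite !subr0 nrmB; have := hc N; lra.
Qed.

Lemma tends_cst u l N : (forall n, (N <= n)%N -> u n = l) -> tends u l.
Proof. by move=> h e e0; exists N => n Nn; rewrite h// subrr nrm0. Qed.

Lemma tends_sum (I : Type) (s : seq I) (u : I -> nat -> V) (l : I -> V) :
  (forall i, tends (u i) (l i)) ->
  tends (fun n => \sum_(i <- s) u i n) (\sum_(i <- s) l i).
Proof.
move=> h; elim: s => [|i s ih].
  by apply: (@tends_cst _ _ 0) => n _; rewrite !big_nil.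
have := tendsD (h i) ih; rewrite big_cons; congr tends.
by apply/funext => n; rewrite big_cons.
Qed.

End SequenceLimits.

Lemma tends_star (R : realType) (A : cstarType R) (u : nat -> A) l :
  tends u l -> tends (fun n => (u n)^*) (l^*).
Proof.
move=> hu e e0; have [N hN] := hu e e0; exists N => n Nn.
by rewrite -cstarB nrm_star hN.
Qed.

Lemma tendsM (R : realType) (A : cstarType R) (u v : nat -> A) l m :
  tends u l -> tends v m -> tends (fun n => u n ** v n) (l ** m).
Proof.
move=> hu hv e e0; set C := nrm l + nrm m + 1.
have C0 : 0 < C by have := nrm_ge0 l; have := nrm_ge0 m; rewrite /C; lra.
pose d := Num.min (e / C) 1.
have d0 : 0 < d by rewrite lt_min ltr01 divr_gt0.
have d1 : d <= 1 by rewrite ge_min lexx orbT.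
have dC : d * C <= e by rewrite -ler_pdivlMr// ge_min lexx.
have [N hN] := tends_close hu hv d0; exists N => n /hN [h1 h2].
have -> : u n ** v n - l ** m =
    (u n - l) ** (v n - m) + (u n - l) ** m + l ** (v n - m).
  by rewrite !(cmulBl, cmulBr); zmodule.
apply: le_lt_trans (nrmD _ _) _; apply: le_lt_trans (lerD (nrmD _ _) (lexx _)) _.
have b1 := nrmM (u n - l) (v n - m); have b2 := nrmM (u n - l) m.
have b3 := nrmM l (v n - m).
have p1 := nrm_ge0 (u n - l); have p2 := nrm_ge0 (v n - m).
have p3 := nrm_ge0 l; have p4 := nrm_ge0 m.
apply: lt_le_trans dC; rewrite /C.
have q1 : nrm (u n - l) * nrm (v n - m) <= nrm (v n - m).
  by rewrite ler_piMl//; lra.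
have q2 : nrm (u n - l) * nrm m <= d * nrm m by rewrite ler_wpM2r// ltW.
have q3 : nrm l * nrm (v n - m) <= nrm l * d by rewrite ler_wpM2l// ltW.
by lra.
Qed.

Section Ell2.
Variables (R : realType) (A : cstarType R).
Implicit Types f g h : nat -> A.

Definition segment m n f g : A := \sum_(i <- index_iota m n) (f i)^* ** g i.

Lemma segment_cs m n f g :
  nrm (segment m n f g) ^+ 2 <= nrm (segment m n f f) * nrm (segment m n g g).
Proof. exact: cauchy_schwarz. Qed.

Lemma segment_le m n m' n' f : (m' <= m)%N -> (n <= n')%N ->
  nrm (segment m n f f) <= nrm (segment m' n' f f).
Proof.
move=> hm hn; have [mn|nm] := leqP m n; last first.
  by rewrite /segment big_geq ?(ltnW nm)// nrm0 nrm_ge0.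
have le s t : nrm (\sum_(i <- s) (f i)^* ** f i) <=
    nrm (\sum_(i <- s) (f i)^* ** f i + \sum_(i <- t) (f i)^* ** f i).
  by rewrite -big_cat; exact: sum_star_monotone.
have -> : segment m' n' f f =
    segment m n f f + (segment n n' f f + segment m' m f f).
  rewrite /segment (@big_cat_nat _ _ _ m m' n')//=; last by rewrite (leq_trans mn).
  by rewrite (@big_cat_nat _ _ _ n m n')//= addrC addrA.
by rewrite /segment -big_cat; exact: le.
Qed.

Lemma segment_star m n f g : (segment m n f g)^* = segment m n g f.
Proof.
by rewrite /segment cstar_sum; apply: eq_bigr => i _; rewrite cstarM cstarK.
Qed.

Lemma segmentDr m n f g h :
  segment m n f (g + h) = segment m n f g + segment m n f h.
Proof. by rewrite /segment -big_split; apply: eq_bigr => i _; exact: cmulDr. Qed.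

Lemma segmentZr m n f c g : segment m n f (c *: g) = c *: segment m n f g.
Proof. by rewrite /segment scaler_sumr; apply: eq_bigr => i _; exact: cmulZr. Qed.

Lemma segmentDl m n f g h :
  segment m n (f + g) h = segment m n f h + segment m n g h.
Proof. by rewrite -!(segment_star _ _ h) segmentDr cstarD. Qed.

Lemma segmentB m n f g : segment 0 m f g - segment 0 n f g =
  if (n <= m)%N then segment n m f g else - segment m n f g.
Proof.
have key a b : (a <= b)%N -> segment 0 b f g = segment 0 a f g + segment a b f g.
  by move=> ab; rewrite /segment -big_cat_nat.
case: leqP => [nm|mn]; first by rewrite (key _ _ nm) addrAC subrr add0r.
by rewrite (key _ _ (ltnW mn)) opprD addrA subrr add0r.
Qed.

Lemma segment_add_le m n f g : nrm (segment m n (f + g) (f + g)) <=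
  2 * nrm (segment m n f f) + 2 * nrm (segment m n g g).
Proof.
rewrite segmentDl !segmentDr.
set a := nrm (segment m n f f); set b := nrm (segment m n g g).
have h1 := nrmD (segment m n f f + segment m n f g) (segment m n g f + segment m n g g).
have h2 := nrmD (segment m n f f) (segment m n f g).
have h3 := nrmD (segment m n g f) (segment m n g g).
have a0 : 0 <= a by exact: nrm_ge0.
have b0 : 0 <= b by exact: nrm_ge0.
have h4 : nrm (segment m n g f) = nrm (segment m n f g).
  by rewrite -segment_star nrm_star.
have h5 : 2 * nrm (segment m n f g) <= a + b.
  rewrite -(ler_pXn2r (ltn0Sn 1)) ?nnegrE ?mulr_ge0 ?addr_ge0 ?nrm_ge0//.
  have := segment_cs m n f g; rewrite -/a -/b exprMn.
  move: (nrm _) => p; have := sqr_ge0 (a - b); rewrite !expr2; lra.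
by rewrite -/a in h2; rewrite -/b in h3; lra.
Qed.

(** The series of the [f_i^* f_i] converges in norm; boundedness of its partial
    sums is a weaker condition in general. *)
Definition square_summable f := forall e : R, 0 < e ->
  exists N, forall m n, (N <= m)%N -> nrm (segment m n f f) < e.

Definition ell2_pred : {pred nat -> A} := [pred f | `[< square_summable f >]].

Lemma ell2_submod : submod_closed ell2_pred.
Proof.
split.
  apply/asboolP => e e0; exists 0%N => m n _.
  by rewrite /segment big1 ?nrm0// => i _; rewrite cmul0r.
move=> c f g /asboolP hf /asboolP hg; apply/asboolP => e e0.
have c0 : 0 < 4 * (nrm c ^+ 2 + 1).
  by have := exprn_ge0 2 (nrm_ge0 c); lra.
have e40 : 0 < e / 4 by rewrite divr_gt0.
have [N hN] := hf _ (divr_gt0 e0 c0); have [M hM] := hg _ e40.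
exists (maxn N M) => m n; rewrite geq_max => /andP[Nm Mm].
apply: le_lt_trans (segment_add_le _ _ _ _) _.
have := hM m n Mm; have := hN m n Nm.
rewrite ltr_pdivlMr//.
have -> : segment m n (c *: f) (c *: f) = (Num.conj c * c) *: segment m n f f.
  by rewrite segmentZr -segment_star segmentZr cstarZ segment_star scalerA mulrC.
rewrite nrmZ nrmcM nrmcJ -expr2.
have := nrm_ge0 (segment m n f f); move: (nrm (segment m n f f)) => p; lra.
Qed.

HB.instance Definition _ := GRing.isSubmodClosed.Build _ _ ell2_pred ell2_submod.

Record ell2 := Ell2 { ell2_fun :> nat -> A; _ : ell2_fun \in ell2_pred }.

HB.instance Definition _ := [isSub for ell2_fun].
HB.instance Definition _ := gen_eqMixin ell2.
HB.instance Definition _ := gen_choiceMixin ell2.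
HB.instance Definition _ := [SubChoice_isSubLmodule of ell2 by <:].

Implicit Types x y z : ell2.

Lemma ell2P x : square_summable x.
Proof. by case: x => x /= /asboolP. Qed.

Definition mk_ell2 f (h : square_summable f) : ell2 :=
  Ell2 (introT (asboolP _) h : f \in ell2_pred).

Lemma ell2_ext x y : (forall i, x i = y i) -> x = y.
Proof. by move=> h; apply: val_inj; apply/funext. Qed.

Lemma ell2_pairing x y : exists l, tends (fun n => segment 0 n x y) l.
Proof.
apply: nrm_complete => e e0.
have [N hN] := ell2P x e0; have [M hM] := ell2P y e0.
have small m n : (maxn N M <= m)%N -> nrm (segment m n x y) < e.
  rewrite geq_max => /andP[Nm Mm]; have := segment_cs m n x y.
  have := hN m n Nm; have := hM m n Mm.
  have := nrm_ge0 (segment m n x x); have := nrm_ge0 (segment m n y y).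
  have := nrm_ge0 (segment m n x y).
  move: (nrm _) (nrm _) (nrm _) => p q r p0 q0 r0 qe re h.
  by rewrite ltNge; apply/negP => ep; nra.
exists (maxn N M) => m n hm hn; rewrite segmentB; case: ifP => _.
  exact: small.
by rewrite nrmN; exact: small.
Qed.

Definition pairing x y : A := projT1 (cid (ell2_pairing x y)).

Lemma pairingP x y : tends (fun n => segment 0 n x y) (pairing x y).
Proof. exact: projT2 (cid (ell2_pairing x y)). Qed.

Lemma pairing_eq x y l : tends (fun n => segment 0 n x y) l -> pairing x y = l.
Proof. by move=> h; apply: tends_uniq h; exact: pairingP. Qed.

Lemma pairingDr x y z : pairing x (y + z) = pairing x y + pairing x z.
Proof.
apply: pairing_eq; have := tendsD (pairingP x y) (pairingP x z); congr tends.
by apply/funext => n; rewrite -segmentDr.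
Qed.

Lemma pairingZr c x y : pairing x (c *: y) = c *: pairing x y.
Proof.
apply: pairing_eq; have := tendsZ c (pairingP x y); congr tends.
by apply/funext => n; rewrite -segmentZr.
Qed.

Lemma pairing_star x y : (pairing x y)^* = pairing y x.
Proof.
apply/esym/pairing_eq; have := tends_star (pairingP x y); congr tends.
by apply/funext => n; rewrite segment_star.
Qed.

Lemma segment_le_pairing m n x : nrm (segment m n x x) <= nrm (pairing x x).
Proof.
apply/ler_addgt0Pr => e e0; have [N hN] := pairingP x x e0.
apply: le_trans (segment_le x (leq0n m) (leq_maxl n N)) _.
have := hN (maxn n N) (leq_maxr _ _).
have := nrm_tri (segment 0 (maxn n N) x x) (pairing x x) 0.
by rewrite !subr0; lra.
Qed.

Lemma coord_le x i : nrm (x i) ^+ 2 <= nrm (pairing x x).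
Proof.
have := segment_le_pairing i i.+1 x.
by rewrite /segment /index_iota subSnn /= big_seq1 nrm_starM.
Qed.

Lemma pairing_def x : pairing x x = 0 -> x = 0.
Proof.
move=> h; apply: ell2_ext => i; apply: nrm_eq0; apply/eqP.
by rewrite -sqrf_eq0 eq_le sqr_ge0 andbT -(nrm0 A) -h coord_le.
Qed.

Lemma pairing_cs x y :
  nrm (pairing x y) ^+ 2 <= nrm (pairing x x) * nrm (pairing y y).
Proof.
have p0 : 0 <= nrm (pairing x x) * nrm (pairing y y).
  by rewrite mulr_ge0 ?nrm_ge0.
rewrite -[leRHS](sqr_sqrtr p0) ler_pXn2r ?nnegrE ?nrm_ge0 ?sqrtr_ge0//.
apply: (tends_nrm_le (pairingP x y)) => n.
rewrite -(ler_pXn2r (ltn0Sn 1)) ?nnegrE ?nrm_ge0 ?sqrtr_ge0// sqr_sqrtr//.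
apply: le_trans (segment_cs _ _ _ _) _.
by apply: ler_pM; rewrite ?nrm_ge0 ?segment_le_pairing.
Qed.

Lemma ell2_complete (u : nat -> ell2) :
  (forall e : R, 0 < e -> exists N, forall m n, (N <= m)%N -> (N <= n)%N ->
     nrm (pairing (u m - u n) (u m - u n)) < e) ->
  exists l, forall e : R, 0 < e -> exists N, forall n, (N <= n)%N ->
     nrm (pairing (u n - l) (u n - l)) < e.
Proof.
move=> hu.
have lim i : exists a, tends (fun n => u n i) a.
  apply: nrm_complete => e e0; have [N hN] := hu _ (exprn_gt0 2 e0).
  exists N => m n Nm Nn; rewrite -(ltr_pXn2r (ltn0Sn 1)) ?nnegrE ?nrm_ge0 ?(ltW e0)//.
  by apply: le_lt_trans (hN m n Nm Nn); exact: (coord_le (u m - u n) i).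
pose l i := projT1 (cid (lim i)).
have hl i : tends (fun n => u n i) (l i) by exact: projT2 (cid (lim i)).
have unif (e : R) : 0 < e -> exists N, forall n, (N <= n)%N -> forall a b,
    nrm (segment a b ((u n : nat -> A) - l) ((u n : nat -> A) - l)) <= e.
  move=> e0; have [N hN] := hu e e0; exists N => n Nn a b.
  pose v m := (u n : nat -> A) - (u (m + N)%N : nat -> A).
  apply: (@tends_nrm_le _ _ (fun m => segment a b (v m) (v m))).
    apply: tends_sum => i.
    have ci : tends (fun m => v m i) (((u n : nat -> A) - l) i).
      move=> d d0; have [M hM] := hl i d d0; exists M => m Mm.
      have -> : v m i - ((u n : nat -> A) - l) i = - (u (m + N)%N i - l i).
        rewrite /v; change ((u n i - u (m + N)%N i) - (u n i - l i) = - (u (m + N)%N i - l i)).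
        by zmodule.
      by rewrite nrmN hM// (leq_trans Mm)// leq_addr.
    exact: tendsM (tends_star ci) ci.
  move=> m; apply: le_trans (ltW (hN n (m + N)%N Nn (leq_addl _ _))).
  exact: (segment_le_pairing a b (u n - u (m + N)%N)).
have sl : square_summable l.
  move=> e e0; have e80 : 0 < e / 8 by rewrite divr_gt0.
  have [N /(_ N (leqnn N)) hN] := unif _ e80.
  have [M hM] := ell2P (u N) e80; exists M => m n Mm.
  have -> : l = (u N : nat -> A) + - ((u N : nat -> A) - l).
    by rewrite opprB addrC subrK.
  apply: le_lt_trans (segment_add_le _ _ _ _) _.
  have -> : segment m n (- ((u N : nat -> A) - l)) (- ((u N : nat -> A) - l)) =
      segment m n ((u N : nat -> A) - l) ((u N : nat -> A) - l).
    apply: eq_bigr => i _.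
    change ((- ((u N : nat -> A) - l) i)^* ** (- ((u N : nat -> A) - l) i) =
      (((u N : nat -> A) - l) i)^* ** ((u N : nat -> A) - l) i).
    by rewrite cstarN cmulNl cmulNr opprK.
  by have := hN m n; have := hM m n Mm; lra.
exists (mk_ell2 sl) => e e0; have e20 : 0 < e / 2 by rewrite divr_gt0.
have [N hN] := unif _ e20; exists N => n Nn.
apply: le_lt_trans (_ : e / 2 < e); last by lra.
apply: (tends_nrm_le (pairingP _ _)) => m; exact: hN.
Qed.

Definition ell2_module : hilbert_module A ell2 :=
  @HilbertModule R A ell2 pairing pairingDr pairingZr pairing_star pairing_def
    pairing_cs ell2_complete.

Lemma pairingE_single i x y : (forall j, j != i -> x j = 0) ->
  pairing x y = (x i)^* ** y i.
Proof.
move=> h; apply: pairing_eq; apply: (@tends_cst _ _ _ _ i.+1) => n ni.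
rewrite /segment big_mkord (bigD1 (Ordinal ni))//= big1 ?addr0// => j ji.
by rewrite h ?cstar0 ?cmul0l.
Qed.

Definition single_fun i (a : A) : nat -> A := fun j => if j == i then a else 0.

Lemma single_summable i a : square_summable (single_fun i a).
Proof.
move=> e e0; exists i.+1 => m n im; rewrite /segment big_nat_cond big1 ?nrm0//.
move=> j /andP[/andP[mj _] _]; rewrite /single_fun gtn_eqF ?cmul0r//.
exact: leq_trans mj.
Qed.

Definition single i a : ell2 := mk_ell2 (single_summable i a).

Lemma singleE i a j : single i a j = if j == i then a else 0.
Proof. by []. Qed.

Lemma pairing_singlel i a x : pairing (single i a) x = a^* ** x i.
Proof.
rewrite (@pairingE_single i) ?singleE ?eqxx// => j ji.
by rewrite singleE (negbTE ji).
Qed.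

Lemma pairing_singler i a x : pairing x (single i a) = (x i)^* ** a.
Proof. by rewrite -pairing_star pairing_singlel cstarM cstarK. Qed.

(** These operators contain the tensor product of [A] with the compact
    operators, through [munit]. *)
Definition stab := adjop ell2_module.

Lemma unit_adjointable i j a :
  adjointable ell2_module (fun x : ell2 => single i (a ** x j)).
Proof.
split; last first.
  exists (fun x : ell2 => single j (a^* ** x i)) => x y /=.
  by rewrite pairing_singler pairing_singlel cstarM cstarK cmulA.
exists (nrm a) => x; rewrite -(ler_pXn2r (ltn0Sn 1)) ?nnegrE ?mulr_ge0 ?nrm_ge0 ?hn_ge0//.
rewrite exprMn !hn_sqr /= pairing_singlel singleE eqxx nrm_starM.
apply: le_trans (_ : (nrm a * nrm (x j)) ^+ 2 <= _).
  by rewrite ler_pXn2r ?nnegrE ?mulr_ge0 ?nrm_ge0// nrmM.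
by rewrite exprMn ler_wpM2l ?exprn_ge0 ?nrm_ge0// coord_le.
Qed.

(** The elementary tensor of [a] with the matrix unit of row [i] and column
    [j]. *)
Definition munit i j a : stab := mk_adjop (unit_adjointable i j a).

Lemma munitE i j a x : munit i j a x = single i (a ** x j). Proof. by []. Qed.

Lemma munit_mul i j k a b : munit i j a ** munit j k b = munit i k (a ** b).
Proof.
by apply: adjop_ext => x; apply: ell2_ext => l; rewrite /= /single_fun eqxx cmulA.
Qed.

Lemma munit_mul0 i j k l a b : j != k -> munit i j a ** munit k l b = 0.
Proof.
move=> jk; apply: adjop_ext => x; apply: ell2_ext => m.
by rewrite /= /single_fun (negbTE jk) cmul0r; case: eqP.
Qed.

Lemma munit_star i j a : (munit i j a)^* = munit j i (a^*).
Proof.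
apply: adjop_star_uniq => x y /=.
by rewrite pairing_singler pairing_singlel cstarM cstarK cmulA.
Qed.

Lemma munit0 i j : munit i j 0 = 0.
Proof.
apply: adjop_ext => x /=; apply: ell2_ext => m.
by rewrite singleE cmul0l; case: eqP.
Qed.

Lemma munitD i j a b : munit i j (a + b) = munit i j a + munit i j b.
Proof.
apply: adjop_ext => x; apply: ell2_ext => m.
change (single i ((a + b) ** x j) m = single i (a ** x j) m + single i (b ** x j) m).
by rewrite !singleE cmulDl; case: eqP; rewrite ?addr0.
Qed.

Lemma munitZ i j c a : munit i j (c *: a) = c *: munit i j a.
Proof.
apply: adjop_ext => x; apply: ell2_ext => m.
change (single i ((c *: a) ** x j) m = c *: single i (a ** x j) m).
by rewrite !singleE cmulZl; case: eqP; rewrite ?scaler0.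
Qed.

Lemma munit_sum (I : Type) (s : seq I) (P : pred I) (F : I -> A) i j :
  munit i j (\sum_(k <- s | P k) F k) = \sum_(k <- s | P k) munit i j (F k).
Proof. by elim/big_rec2: _ => [|k x y _ <-]; rewrite ?munit0 ?munitD. Qed.

Lemma munit_diag_hom i : star_hom (munit i i).
Proof.
split.
- by move=> c a b; rewrite munitD munitZ.
- by move=> a b; rewrite munit_mul.
- by move=> a; rewrite munit_star.
Qed.

Section Ideal.
Variables (I : set A) (cI : closed_ideal I).

(** An ideal of [stab] from which [I] can be read off, by [munit_ideal]. *)
Definition stab_ideal : set stab := [set T | forall x y, I (pairing x (T y))].

Lemma stab_ideal_ideal : closed_ideal stab_ideal.
Proof.
have cS := ideal_subspace cI; split; first split.
- move=> x y; have -> : pairing x ((0 : stab) y) = 0.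
    exact: (ip0r ell2_module x).
  exact: (subspace0 cS).
- move=> S T hS hT x y.
  have -> : pairing x ((S + T) y) = pairing x (S y) + pairing x (T y).
    exact: pairingDr.
  exact: (subspaceD cS).
- move=> c T hT x y.
  have -> : pairing x ((c *: T) y) = c *: pairing x (T y) by exact: pairingZr.
  exact: (subspaceZ cS).
- apply/closedP => T hT x y.
  move/closedP: (subspace_closed cS); apply => e e0.
  have C0 : 0 < hn ell2_module x * hn ell2_module y + 1.
    by have := mulr_ge0 (hn_ge0 ell2_module x) (hn_ge0 ell2_module y); lra.
  have [S hS ST] := hT _ (divr_gt0 e0 C0); exists (pairing x (S y)) => //.
  have -> : pairing x (T y) - pairing x (S y) = pairing x ((T - S) y).
    by apply/esym; exact: (ipBr ell2_module x (T y) (S y)).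
  apply: le_lt_trans (ip_le ell2_module x ((T - S) y)) _.
  have h := opnP (T - S) y; rewrite nrm_opn ltr_pdivlMr// in ST.
  have h1 : hn ell2_module x * hn ell2_module ((T - S) y) <=
      hn ell2_module x * (opn (T - S) * hn ell2_module y).
    by rewrite ler_wpM2l ?hn_ge0.
  apply: le_lt_trans h1 (le_lt_trans _ ST).
  by rewrite mulrCA ler_wpM2l ?opn_ge0// lerDl.
- move=> S T hT x y.
  have -> : pairing x ((S ** T) y) = pairing ((S^* : stab) x) (T y).
    exact: (adjop_starP S x (T y)).
  exact: hT.
- by move=> S T hS x y; exact: (hS x (T y)).
Qed.

(** The coefficients of [munit i j a] are the [b a c]; with [w = a a^* a] one of
    them is [w w^* w], so [ideal_cube] applies twice. *)
Lemma munit_ideal i j a : stab_ideal (munit i j a) <-> I a.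
Proof.
split=> [h|Ia x y]; last first.
  rewrite munitE pairing_singler; apply: (idealMl cI).
  by case: cI => _ _ Mr; exact: Mr.
set w := a ** a^* ** a.
apply: (ideal_cube cI); apply: (ideal_cube cI); rewrite -/w.
have := h (single i (a ** a^*)) (single j (w^* ** w)).
rewrite munitE pairing_singlel !singleE !eqxx cstarM cstarK cmulA -/w.
by rewrite cmulA.
Qed.

End Ideal.
End Ell2.

(** * Cuntz-Krieger families *)

Lemma projection_le1 (R : realType) (B : cstarType R) (p : B) :
  projection p -> nrm p <= 1.
Proof.
move=> [ps pp]; have := nrm_starM p; rewrite ps pp.
by have := nrm_ge0 p; nra.
Qed.

Lemma sum_single (V : zmodType) (I : eqType) (s : seq I) (P : pred I)
    (G : I -> V) (a : I) : a \in s -> uniq s ->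
  (forall b, b != a -> P b -> G b = 0) ->
  \sum_(b <- s | P b) G b = if P a then G a else 0.
Proof.
move=> as_ us h; rewrite big_mkcond (bigD1_seq a)//= big1 ?addr0// => b ba.
by case: ifP => // Pb; exact: h.
Qed.

Section Implementers.
Variables (R : realType) (E : digraph) (B : cstarType R).
Variables (q : dvertex E -> B) (t : dedge E -> B).
Hypothesis ck : cuntz_krieger_family q t.

Lemma ck_vertex_mul x y : q x ** q y = if x == y then q x else 0.
Proof.
case: eqP => [->|/eqP xy]; first by have [] := ck_proj ck y.
exact: (ck_vertex_orth ck).
Qed.

Lemma ck_vertex_star x : (q x)^* = q x.
Proof. by have [] := ck_proj ck x. Qed.

Lemma ck_edge_range a : t a ** q (drange a) = t a.
Proof. by rewrite -(ck_initial ck) cmulA (ck_pisom ck). Qed.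

Lemma ck_source_edge a : q (dsource a) ** t a = t a.
Proof.
have h : q (dsource a) ** (t a ** (t a)^*) = t a ** (t a)^*.
  have := congr1 (@cstar _ _) (ck_final_le ck a).
  by rewrite !cstarM cstarK ck_vertex_star.
by rewrite -{1}(ck_pisom ck a) cmulA h (ck_pisom ck).
Qed.

Lemma ck_vertex_edge x a : q x ** t a = if x == dsource a then t a else 0.
Proof.
rewrite -ck_source_edge cmulA ck_vertex_mul.
by case: eqP => [->|_]; rewrite ?cmul0l.
Qed.

Lemma ck_edge_vertex a x : (t a)^* ** q x = if x == dsource a then (t a)^* else 0.
Proof.
rewrite -(ck_vertex_star x) -cstarM ck_vertex_edge.
by case: eqP; rewrite ?cstar0.
Qed.

Lemma ck_range_edge a : q (drange a) ** (t a)^* = (t a)^*.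
Proof. by rewrite -{1}(ck_vertex_star (drange a)) -cstarM ck_edge_range. Qed.

Lemma ck_edge_mul a b : (t a)^* ** t b = if a == b then q (drange a) else 0.
Proof.
case: eqP => [->|/eqP ab]; first exact: (ck_initial ck).
have := ck_final_orth ck ab => h.
have ea : (t a)^* ** (t a ** (t a)^*) = (t a)^*.
  by have := congr1 (@cstar _ _) (ck_pisom ck a); rewrite !cstarM cstarK.
by rewrite -ea -(ck_pisom ck b) -cmulA (cmulA _ _ (t b)) h cmul0l cmul0r.
Qed.

Definition vsum (V : seq (dvertex E)) : B := \sum_(x <- V) q x.

Lemma vsum_vertex V x : uniq V -> vsum V ** q x = if x \in V then q x else 0.
Proof.
move=> uV; rewrite /vsum cmul_suml; case: ifP => xV.
  rewrite (bigD1_seq x)//= ck_vertex_mul eqxx big1 ?addr0// => y yx.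
  by rewrite ck_vertex_mul (negbTE yx).
rewrite big_seq big1// => y yV; rewrite ck_vertex_mul; case: eqP => // e.
by rewrite -e yV in xV.
Qed.

Lemma vsum_star V : (vsum V)^* = vsum V.
Proof. by rewrite /vsum cstar_sum; apply: eq_bigr => x _; exact: ck_vertex_star. Qed.

Lemma vertex_vsum V x : uniq V -> q x ** vsum V = if x \in V then q x else 0.
Proof.
move=> uV; rewrite -{1}(ck_vertex_star x) -{1}vsum_star -cstarM vsum_vertex//.
by case: ifP; rewrite ?ck_vertex_star ?cstar0.
Qed.

Lemma vsum_proj V : uniq V -> projection (vsum V).
Proof.
move=> uV; split; first exact: vsum_star.
rewrite {2}/vsum cmul_sumr [RHS]big_seq big_seq; apply: eq_bigr => x xV.
by rewrite vsum_vertex// xV.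
Qed.

Lemma edge_vsum V a : uniq V -> drange a \in V -> t a ** vsum V = t a.
Proof. by move=> uV aV; rewrite -ck_edge_range -cmulA vertex_vsum// aV. Qed.

Lemma vsum_edge V a : uniq V -> dsource a \in V -> vsum V ** t a = t a.
Proof. by move=> uV aV; rewrite -ck_source_edge cmulA vsum_vertex// aV. Qed.

Lemma edge_star_vsum V a : uniq V -> dsource a \in V ->
  (t a)^* ** vsum V = (t a)^*.
Proof. by move=> uV aV; rewrite -[vsum V]vsum_star -cstarM vsum_edge. Qed.

Variables (k l : dedge E -> nat) (w : complex R).
Hypothesis w1 : `|w| = 1.

Lemma conj_unit_circle n : w ^+ n * Num.conj w ^+ n = 1.
Proof. by rewrite -exprMn -normCK w1 expr1n expr1n. Qed.

(** [U m] acts on the paths of degree at most [m] in the finite graph with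
    edges [F] as the second gauge action does: it multiplies [t_mu] by
    [w^(l mu)] and passes to the level [m - k mu].  As [U m] is bounded by 1,
    this makes the second action approximately inner on elements that are
    homogeneous for the first. *)
Record implements (F : seq (dedge E)) (V : seq (dvertex E)) (e : B)
    (U : nat -> B) : Prop := {
  imp_vertex : forall x, x \in V -> q x ** e = q x;
  imp_edge : forall a, a \in F -> t a ** e = t a;
  imp_edge_star : forall a, a \in F -> (t a)^* ** e = (t a)^*;
  imp_unitary : forall m, U m ** (U m)^* = e;
  imp_bounded : forall m, nrm (U m) <= 1;
  imp_comm : forall m x, U m ** q x = q x ** U m;
  imp_forward : forall m a, a \in F ->
    U (m + k a)%N ** t a = w ^+ l a *: (t a ** U m);
  imp_backward : forall m a, a \in F ->
    U m ** (t a)^* = Num.conj w ^+ l a *: ((t a)^* ** U (m + k a)%N)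
}.

Section Construction.
Variables (F : seq (dedge E)) (V : seq (dvertex E)).
Hypotheses (uF : uniq F) (uV : uniq V).
Hypotheses (sV : forall a, a \in F -> dsource a \in V)
           (rV : forall a, a \in F -> drange a \in V).

Definition ranges (m : nat) : B := \sum_(a <- F | (k a <= m)%N) t a ** (t a)^*.

(** The recursion unfolds to a sum over the paths [mu] with edges in [F], degree
    at most [m] and at most [N] edges, of [w^(l mu) t_mu P t_mu^*], where [P]
    removes the paths that can be prolonged by an edge of [F] within the degree
    bound; for paths with [N] edges, [P] is the sum of all vertices of [V]. *)
Fixpoint implementer (N m : nat) : B :=
  if N is N'.+1 then
    \sum_(a <- F | (k a <= m)%N)
      w ^+ l a *: (t a ** implementer N' (m - k a) ** (t a)^*)
    + (vsum V - ranges m)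
  else vsum V.

Lemma edge_star_ranges m a : a \in F ->
  (t a)^* ** ranges m = if (k a <= m)%N then (t a)^* else 0.
Proof.
move=> aF; rewrite cmul_sumr (@sum_single _ _ _ _ _ a)//; last first.
  by move=> b ba _; rewrite cmulA ck_edge_mul eq_sym (negbTE ba) cmul0l.
by rewrite cmulA (ck_initial ck) ck_range_edge.
Qed.

Lemma ranges_star m : (ranges m)^* = ranges m.
Proof. by rewrite cstar_sum; apply: eq_bigr => a _; rewrite cstarM cstarK. Qed.

Lemma ranges_edge m a : a \in F -> ranges m ** t a = if (k a <= m)%N then t a else 0.
Proof.
move=> aF; rewrite -[LHS]cstarK cstarM ranges_star edge_star_ranges//.
by case: ifP; rewrite ?cstarK ?cstar0.
Qed.

Lemma implementer_vsum N m : implementer N m ** vsum V = implementer N m.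
Proof.
case: N => [|N] /=; first exact: (vsum_proj uV).2.
rewrite cmulDl cmulBl (vsum_proj uV).2 !cmul_suml; congr (_ + (_ - _)).
  rewrite big_seq_cond [RHS]big_seq_cond; apply: eq_bigr => a /andP[aF _].
  by rewrite cmulZl -cmulA edge_star_vsum// sV.
rewrite /ranges big_seq_cond [RHS]big_seq_cond; apply: eq_bigr => a /andP[aF _].
by rewrite -cmulA edge_star_vsum// sV.
Qed.

Lemma implementer_comm N m x : implementer N m ** q x = q x ** implementer N m.
Proof.
have vc : vsum V ** q x = q x ** vsum V by rewrite vsum_vertex// vertex_vsum.
have rc b c : (t c ** b ** (t c)^*) ** q x = q x ** (t c ** b ** (t c)^*).
  rewrite -cmulA ck_edge_vertex !cmulA ck_vertex_edge.
  by case: eqP => _; rewrite ?cmul0l ?cmul0r.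
case: N => [|N] //=; rewrite cmulDl cmulDr cmulBl cmulBr vc.
congr (_ + (_ - _)); rewrite cmul_suml cmul_sumr; apply: eq_bigr => a _.
  by rewrite cmulZl cmulZr rc.
by have := rc (q (drange a)) a; rewrite ck_edge_range.
Qed.

Lemma implementer_edge N m a : a \in F -> (k a <= m)%N ->
  implementer N.+1 m ** t a = w ^+ l a *: (t a ** implementer N (m - k a)).
Proof.
move=> aF am; rewrite /= cmulDl cmulBl vsum_edge ?sV// ranges_edge// am subrr addr0.
rewrite cmul_suml (@sum_single _ _ _ _ _ a)// ?am; last first.
  by move=> b ba _; rewrite cmulZl -cmulA ck_edge_mul (negbTE ba) cmul0r scaler0.
rewrite cmulZl -cmulA (ck_initial ck); congr (_ *: _).
by rewrite -cmulA implementer_comm cmulA ck_edge_range.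
Qed.

Lemma edge_implementer N m a : a \in F -> (k a <= m)%N ->
  (t a)^* ** implementer N.+1 m = w ^+ l a *: (implementer N (m - k a) ** (t a)^*).
Proof.
move=> aF am; rewrite /= cmulDr cmulBr edge_star_vsum ?sV// edge_star_ranges// am.
rewrite subrr addr0 cmul_sumr (@sum_single _ _ _ _ _ a)// ?am; last first.
  by move=> b ba _; rewrite cmulZr !cmulA ck_edge_mul eq_sym (negbTE ba) !cmul0l scaler0.
rewrite cmulZr !cmulA (ck_initial ck); congr (_ *: _).
by rewrite -implementer_comm -cmulA ck_range_edge.
Qed.

(** The summands belonging to distinct first edges have orthogonal ranges, and
    [ranges m] is the sum of the ranges of the first edges. *)
Lemma implementer_unitary N m : implementer N m ** (implementer N m)^* = vsum V.
Proof.
elim: N m => [|N ih] m; first by rewrite /= vsum_star (vsum_proj uV).2.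
set X := \sum_(a <- F | (k a <= m)%N)
  w ^+ l a *: (t a ** implementer N (m - k a) ** (t a)^*).
have -> : implementer N.+1 m = X + (vsum V - ranges m) by [].
set P := vsum V - ranges m.
have Ps : P^* = P by rewrite cstarB vsum_star ranges_star.
have tP a : a \in F -> (k a <= m)%N -> (t a)^* ** P = 0.
  move=> aF am; rewrite cmulBr edge_star_vsum ?sV// edge_star_ranges// am.
  exact: subrr.
have XP : X ** P = 0.
  rewrite cmul_suml big_seq_cond big1// => a /andP[aF am].
  by rewrite cmulZl -cmulA tP// cmul0r scaler0.
have PX : P ** X^* = 0 by rewrite -[LHS]cstarK cstarM cstarK Ps XP cstar0.
have RP : ranges m ** P = 0.
  rewrite cmul_suml big_seq_cond big1// => a /andP[aF am].
  by rewrite -cmulA tP// cmul0r.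
have PP : P ** P = P.
  rewrite {1}/P cmulBl RP subr0 cmulBr (vsum_proj uV).2; congr (_ - _).
  rewrite cmul_sumr big_seq_cond /ranges [RHS]big_seq_cond.
  by apply: eq_bigr => a /andP[aF _]; rewrite cmulA vsum_edge// sV.
have XX : X ** X^* = ranges m.
  rewrite cmul_suml /ranges big_seq_cond [RHS]big_seq_cond.
  apply: eq_bigr => a /andP[aF am].
  have XsE : (t a)^* ** X^* =
      Num.conj w ^+ l a *: ((implementer N (m - k a))^* ** (t a)^*).
    rewrite -cstarM -[X]addr0 -(subrr P) addrA -[X + P]/(implementer N.+1 m).
    rewrite cmulBl implementer_edge// -[P ** t a]cstarK cstarM Ps tP// cstar0 subr0.
    by rewrite cstarZ cstarM rmorphXn.
  rewrite cmulZl -!cmulA XsE !cmulZr scalerA conj_unit_circle scale1r.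
  by rewrite (cmulA (implementer _ _)) ih cmulA edge_vsum ?rV.
have -> : vsum V = ranges m + P by rewrite /P addrC subrK.
rewrite cstarD Ps; clearbody X P.
by rewrite cmulDl !cmulDr XP PX PP XX addr0 add0r.
Qed.

Lemma nrm_implementer N m : nrm (implementer N m) <= 1.
Proof.
have := nrm_Mstar (implementer N m); rewrite implementer_unitary.
have := projection_le1 (vsum_proj uV); have := nrm_ge0 (implementer N m).
by move=> h0 h1 h2; rewrite h2 in h1; nra.
Qed.

Variable rho : nat -> dvertex E -> nat.
Hypothesis rhoP : forall a m, a \in F -> (k a <= m)%N ->
  (rho (m - k a) (drange a) < rho m (dsource a))%N.

(** A path leaving [x] of degree at most [m] has fewer than [rho m x] edges,
    so the recursion stabilises. *)
Lemma implementer_stable N m x : (rho m x <= N)%N ->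
  implementer N.+1 m ** q x = implementer N m ** q x.
Proof.
elim: N m x => [|N ih] m x hx.
  have z a : a \in F -> (k a <= m)%N -> (t a)^* ** q x = 0.
    move=> aF am; rewrite ck_edge_vertex; case: eqP => // e.
    have := rhoP aF am; rewrite -e => h.
    by move: (leq_trans h hx); rewrite ltn0.
  have zR : ranges m ** q x = 0.
    rewrite cmul_suml big_seq_cond big1// => a /andP[aF am].
    by rewrite -cmulA z// cmul0r.
  rewrite /= cmulDl cmulBl zR subr0 cmul_suml big_seq_cond big1 ?add0r//.
  by move=> a /andP[aF am]; rewrite cmulZl -cmulA z// cmul0r scaler0.
have -> : implementer N.+2 m = \sum_(a <- F | (k a <= m)%N)
   w ^+ l a *: (t a ** implementer N.+1 (m - k a) ** (t a)^*) +
   (vsum V - ranges m) by [].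
have -> : implementer N.+1 m = \sum_(a <- F | (k a <= m)%N)
   w ^+ l a *: (t a ** implementer N (m - k a) ** (t a)^*) +
   (vsum V - ranges m) by [].
rewrite !(cmulDl _ (vsum V - _)); congr (_ + _); rewrite !cmul_suml.
rewrite big_seq_cond [RHS]big_seq_cond; apply: eq_bigr => a /andP[aF am].
rewrite !cmulZl; congr (_ *: _); rewrite -!cmulA ck_edge_vertex.
case: eqP => [e|]; last by rewrite !cmul0r.
rewrite -{1}ck_range_edge -{2}(ck_range_edge a); congr (_ ** _).
rewrite !cmulA ih// -ltnS; apply: leq_trans hx; rewrite e; exact: rhoP.
Qed.

Definition depth m := \max_(x <- V) rho m x.

Definition limit_implementer m := implementer (depth m) m.

Lemma limit_implementerE N m : (depth m <= N)%N ->
  implementer N m = limit_implementer m.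
Proof.
move=> hN; rewrite -(subnKC hN); elim: (N - depth m)%N => [|j ih].
  by rewrite addn0.
rewrite addnS -ih -implementer_vsum -[RHS]implementer_vsum /vsum !cmul_sumr.
rewrite big_seq [RHS]big_seq; apply: eq_bigr => x xV.
apply: implementer_stable; apply: leq_trans (leq_addr _ _).
by rewrite /depth (@leq_bigmax_seq _ _ xpredT (rho m)).
Qed.

Lemma limit_implementer_implements :
  implements F V (vsum V) limit_implementer.
Proof.
split.
- by move=> x xV; rewrite vertex_vsum// xV.
- by move=> a aF; rewrite edge_vsum// rV.
- by move=> a aF; rewrite edge_star_vsum// sV.
- by move=> m; exact: implementer_unitary.
- by move=> m; exact: nrm_implementer.
- by move=> m x; exact: implementer_comm.
- move=> m a aF; set N := maxn (depth (m + k a)) (depth m).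
  rewrite -(@limit_implementerE N.+1 (m + k a)%N); last first.
    by apply: leq_trans (leqnSn _); exact: leq_maxl.
  rewrite -(@limit_implementerE N m) ?leq_maxr// implementer_edge ?leq_addl//.
  by rewrite addnK.
- move=> m a aF; set N := maxn (depth (m + k a)) (depth m).
  rewrite -(@limit_implementerE N.+1 (m + k a)%N); last first.
    by apply: leq_trans (leqnSn _); exact: leq_maxl.
  rewrite -(@limit_implementerE N m) ?leq_maxr// edge_implementer ?leq_addl//.
  by rewrite addnK scalerA mulrC conj_unit_circle scale1r.
Qed.

End Construction.

(** Close the vertex set under sources and ranges of the given edges. *)
Lemma implementers_exist (F0 : seq (dedge E)) (V0 : seq (dvertex E)) :
  (exists rho : nat -> dvertex E -> nat, forall a m, a \in F0 -> (k a <= m)%N ->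
     (rho (m - k a) (drange a) < rho m (dsource a))%N) ->
  exists e U, implements F0 V0 e U.
Proof.
move=> [rho hrho].
pose F := undup F0.
pose V := undup (V0 ++ [seq dsource a | a <- F0] ++ [seq drange a | a <- F0]).
have sV a : a \in F -> dsource a \in V.
  by rewrite !mem_undup => aF; rewrite !mem_cat (map_f (@dsource E) aF) orbT.
have rV a : a \in F -> drange a \in V.
  by rewrite !mem_undup => aF; rewrite !mem_cat (map_f (@drange E) aF) !orbT.
have rhoF a m : a \in F -> (k a <= m)%N ->
    (rho (m - k a) (drange a) < rho m (dsource a))%N.
  by rewrite mem_undup; exact: hrho.
have [h1 h2 h3 h4 h5 h6 h7 h8] :=
  limit_implementer_implements (undup_uniq _) (undup_uniq _) sV rV rhoF.
exists (vsum V), (limit_implementer F V rho); split=> //.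
- by move=> x xV; apply: h1; rewrite mem_undup mem_cat xV.
- by move=> a aF; apply: h2; rewrite mem_undup.
- by move=> a aF; apply: h3; rewrite mem_undup.
- by move=> m a aF; apply: h7; rewrite mem_undup.
- by move=> m a aF; apply: h8; rewrite mem_undup.
Qed.

End Implementers.

(** * Comparing two gauge actions *)

Section WeightedAction.
Variables (R : realType) (E : digraph) (B : cstarType R).
Variables (q : dvertex E -> B) (t : dedge E -> B).

Record weighted_action (k : dedge E -> nat) (g : complex R -> B -> B) : Prop := {
  weighted_hom : forall z, `|z| = 1 -> star_hom (g z);
  weighted_vertex : forall z x, `|z| = 1 -> g z (q x) = q x;
  weighted_edge : forall z a, `|z| = 1 -> g z (t a) = z ^+ k a *: t a
}.

(** For edges in a finite set, [rho m x] bounds the length of the paths that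
    leave [x] and have degree at most [m]. *)
Definition finite_degree (k : dedge E -> nat) := forall F : seq (dedge E),
  exists rho : nat -> dvertex E -> nat, forall a m, a \in F -> (k a <= m)%N ->
    (rho (m - k a) (drange a) < rho m (dsource a))%N.

Variables (k l : dedge E -> nat) (kap lam : complex R -> B -> B).
Hypothesis ck : cuntz_krieger_family q t.
Hypotheses (hk : weighted_action k kap) (hl : weighted_action l lam).
Variable w : complex R.
Hypothesis w1 : `|w| = 1.

Let lw := weighted_hom hl w1.

(** The level changes by [n] from one side to the other because [U m] counts
    only the degree that is left. It is required to be at least [M] on both
    sides since levels are natural numbers. *)
Definition homogeneous (n : int) (b : B) :=
  (forall z : complex R, `|z| = 1 -> kap z b = (z ^ n) *: b) /\
  exists (F : seq (dedge E)) (V : seq (dvertex E)) (M : nat),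
  forall (F' : seq (dedge E)) (V' : seq (dvertex E)) e U, {subset F <= F'} -> {subset V <= V'} ->
    implements q t k l w F' V' e U ->
    lam w b ** e = lam w b /\
    forall m m' : nat, (M <= m)%N -> (M <= m')%N -> m%:Z = m'%:Z + n ->
      U m ** b = lam w b ** U m'.

Lemma unit_neq0 (z : complex R) : `|z| = 1 -> z != 0.
Proof. by move=> z1; rewrite -normr_gt0 z1 ltr01. Qed.

Lemma unit_exprzN (z : complex R) (n : nat) : `|z| = 1 ->
  z ^ (- n%:Z) = Num.conj (z ^+ n).
Proof.
by move=> z1; rewrite -invr_expz -exprnP -exprVn invC_norm z1 expr1n invr1 mul1r rmorphXn.
Qed.

Lemma homogeneous0 n : homogeneous n 0.
Proof.
split=> [z z1|]; first by rewrite (hom0 (weighted_hom hk z1)) scaler0.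
exists [::], [::], 0%N => F' V' e U _ _ _; rewrite (hom0 lw).
by rewrite cmul0l; split=> // m m' _ _ _; rewrite cmul0l cmul0r.
Qed.

Lemma homogeneousD n a b : homogeneous n a -> homogeneous n b ->
  homogeneous n (a + b).
Proof.
move=> [ka [F [V [M ha]]]] [kb [F' [V' [M' hb]]]]; split=> [z z1|].
  by rewrite (homD (weighted_hom hk z1)) ka// kb// scalerDr.
exists (F ++ F'), (V ++ V'), (M + M')%N => F2 V2 e U sF sV iU.
have [||ea Ua] := ha F2 V2 e U _ _ iU.
- by move=> x xF; apply: sF; rewrite mem_cat xF.
- by move=> x xF; apply: sV; rewrite mem_cat xF.
have [||eb Ub] := hb F2 V2 e U _ _ iU.
- by move=> x xF; apply: sF; rewrite mem_cat xF orbT.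
- by move=> x xF; apply: sV; rewrite mem_cat xF orbT.
rewrite (homD lw) cmulDl ea eb; split=> // m m' hm hm' mm.
rewrite cmulDr cmulDl (Ua m m') ?(Ub m m') //; lia.
Qed.

Lemma homogeneousZ n c a : homogeneous n a -> homogeneous n (c *: a).
Proof.
move=> [ka [F [V [M ha]]]]; split=> [z z1|].
  by rewrite (homZ (weighted_hom hk z1)) ka// !scalerA mulrC.
exists F, V, M => F2 V2 e U sF sV iU; have [ea Ua] := ha F2 V2 e U sF sV iU.
rewrite (homZ lw) cmulZl ea; split=> // m m' hm hm' mm.
by rewrite cmulZr cmulZl (Ua m m').
Qed.

Lemma homogeneousM n n' a b : homogeneous n a -> homogeneous n' b ->
  homogeneous (n + n') (a ** b).
Proof.
move=> [ka [F [V [M ha]]]] [kb [F' [V' [M' hb]]]]; split=> [z z1|].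
  rewrite (homM (weighted_hom hk z1)) ka// kb// cmulZl cmulZr scalerA.
  by rewrite expfzDr// unit_neq0.
exists (F ++ F'), (V ++ V'), (M + M' + `|n| + `|n'|)%N => F2 V2 e U sF sV iU.
have [||ea Ua] := ha F2 V2 e U _ _ iU.
- by move=> x xF; apply: sF; rewrite mem_cat xF.
- by move=> x xF; apply: sV; rewrite mem_cat xF.
have [||eb Ub] := hb F2 V2 e U _ _ iU.
- by move=> x xF; apply: sF; rewrite mem_cat xF orbT.
- by move=> x xF; apply: sV; rewrite mem_cat xF orbT.
rewrite (homM lw) -cmulA eb; split=> // m m' hm hm' mm.
have [j jE] : exists j : nat, j%:Z = m'%:Z + n'.
  by exists (absz (m'%:Z + n')); rewrite gez0_abs; lia.
rewrite cmulA (Ua m j); try lia.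
by rewrite -!cmulA (Ub j m'); try lia.
Qed.

Lemma homogeneous_sum (I : Type) (s : seq I) (P : pred I) (G : I -> B) n :
  (forall i, P i -> homogeneous n (G i)) -> homogeneous n (\sum_(i <- s | P i) G i).
Proof.
move=> h; elim/big_rec: _ => [|i x Pi hx]; first exact: homogeneous0.
by apply: homogeneousD => //; exact: h.
Qed.

(** The adjoint is included because [homogeneous] describes [lam w b] through
    multiplication by the [U m] on one side. *)
Definition bihomogeneous n a := homogeneous n a /\ homogeneous (- n) (a^*).

Lemma bihomogeneous_vertex x : bihomogeneous 0 (q x).
Proof.
have h : homogeneous 0 (q x).
  split=> [z z1|]; first by rewrite (weighted_vertex hk) ?expr0z ?scale1r.
  exists [::], [:: x], 0%N => F V e U _ sV iU; rewrite (weighted_vertex hl)//.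
  split=> [|m m' _ _]; first by apply: (imp_vertex iU); apply: sV; rewrite inE.
  by rewrite addr0 => -[<-]; exact: (imp_comm iU).
by split; rewrite // oppr0 (ck_vertex_star ck).
Qed.

Lemma bihomogeneous_edge a : bihomogeneous (k a)%:Z (t a).
Proof.
split.
  split=> [z z1|]; first by rewrite (weighted_edge hk)// -exprnP.
  exists [:: a], [::], 0%N => F V e U sF _ iU; rewrite (weighted_edge hl)//.
  have aF : a \in F by apply: sF; rewrite inE.
  rewrite cmulZl (imp_edge iU)//; split=> // m m' _ _ mm.
  have -> : m = (m' + k a)%N by lia.
  by rewrite (imp_forward iU)// cmulZl.
split=> [z z1|].
  rewrite (homS (weighted_hom hk z1)) (weighted_edge hk)// cstarZ; congr (_ *: _).
  by rewrite unit_exprzN.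
exists [:: a], [::], 0%N => F V e U sF _ iU.
rewrite (homS lw) (weighted_edge hl)// cstarZ rmorphXn.
have aF : a \in F by apply: sF; rewrite inE.
rewrite cmulZl (imp_edge_star iU)//; split=> // m m' _ _ mm.
have -> : m' = (m + k a)%N by lia.
by rewrite (imp_backward iU)// cmulZl.
Qed.

(** Trigonometric polynomials for the first action. *)
Definition polynomial (b : B) := exists2 s : seq (int * B),
  (forall y, y \in s -> bihomogeneous y.1 y.2) & b = \sum_(y <- s) y.2.

Lemma polynomialD a b : polynomial a -> polynomial b -> polynomial (a + b).
Proof.
move=> [s hs ->] [s' hs' ->]; exists (s ++ s'); last by rewrite big_cat.
by move=> y; rewrite mem_cat => /orP[]; [exact: hs | exact: hs'].
Qed.

Lemma polynomial_hom n b : bihomogeneous n b -> polynomial b.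
Proof.
move=> h; exists [:: (n, b)]; last by rewrite big_seq1.
by move=> y; rewrite inE => /eqP ->.
Qed.

Lemma polynomialZ c a : polynomial a -> polynomial (c *: a).
Proof.
move=> [s hs ->]; exists [seq (y.1, c *: y.2) | y <- s].
  move=> _ /mapP[y ys ->] /=; have [h1 h2] := hs y ys.
  by split; rewrite ?cstarZ; exact: homogeneousZ.
by rewrite big_map scaler_sumr.
Qed.

Lemma polynomial_star a : polynomial a -> polynomial (a^*).
Proof.
move=> [s hs ->]; exists [seq (- y.1, y.2^*) | y <- s].
  move=> _ /mapP[y ys ->] /=; have [h1 h2] := hs y ys.
  by split; rewrite // opprK cstarK.
by rewrite big_map cstar_sum.
Qed.

Lemma polynomialM a b : polynomial a -> polynomial b -> polynomial (a ** b).
Proof.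
move=> [s hs ->] [s' hs' ->].
exists [seq (y.1 + y'.1, y.2 ** y'.2) | y <- s, y' <- s'].
  move=> _ /allpairsP[[y y'] /= [ys ys' ->]] /=.
  have [h1 h2] := hs y ys; have [h1' h2'] := hs' y' ys'; split.
    exact: homogeneousM.
  by rewrite opprD addrC cstarM; exact: homogeneousM.
rewrite big_flatten big_map cmul_suml; apply: eq_bigr => y _.
by rewrite big_map cmul_sumr.
Qed.

Lemma polynomial_dense : generates (range q `|` range t) ->
  forall b (e : R), 0 < e -> exists2 a, polynomial a & nrm (b - a) < e.
Proof.
move=> gen; pose T := [set b | forall e : R, 0 < e ->
  exists2 a, polynomial a & nrm (b - a) < e].
suff TT : T = setT by move=> b; have : T b by rewrite TT.
have sub a : polynomial a -> T a by move=> h e e0; exists a; rewrite ?subrr ?nrm0.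
apply: gen; last first.
  by move=> _ [[x _ <-]|[a _ <-]]; apply: sub;
    [exact: polynomial_hom (bihomogeneous_vertex x)
    |exact: polynomial_hom (bihomogeneous_edge a)].
split; first split.
- by apply: sub; exists [::] => //; rewrite big_nil.
- move=> a b ha hb e e0; have e20 : 0 < e / 2 by rewrite divr_gt0.
  have [a' pa h1] := ha _ e20; have [b' pb h2] := hb _ e20.
  exists (a' + b'); first exact: polynomialD.
  by rewrite opprD addrACA; apply: le_lt_trans (nrmD _ _) _; lra.
- move=> c a ha e e0; have c0 : 0 < nrm c + 1 by have := nrm_ge0 c; lra.
  have [a' pa h1] := ha _ (divr_gt0 e0 c0); exists (c *: a').
    exact: polynomialZ.
  rewrite ltr_pdivlMr// in h1; rewrite -scalerBr nrmZ; apply: le_lt_trans h1.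
  by rewrite mulrC ler_wpM2l ?nrm_ge0// lerDl.
- apply/closedP => x hx e e0; have e20 : 0 < e / 2 by rewrite divr_gt0.
  have [y Ty xy] := hx _ e20; have [a pa ya] := Ty _ e20; exists a => //.
  by apply: le_lt_trans (nrm_tri _ y _) _; lra.
- move=> a b ha hb e e0; set C := nrm a + nrm b + 1.
  have C0 : 0 < C by have := nrm_ge0 a; have := nrm_ge0 b; rewrite /C; lra.
  pose d := Num.min (e / C) 1.
  have d0 : 0 < d by rewrite lt_min ltr01 divr_gt0.
  have d1 : d <= 1 by rewrite ge_min lexx orbT.
  have dC : d * C <= e by rewrite -ler_pdivlMr// ge_min lexx.
  have [a' pa h1] := ha _ d0; have [b' pb h2] := hb _ d0.
  exists (a' ** b'); first exact: polynomialM.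
  have -> : a ** b - a' ** b' = (a - a') ** b + a' ** (b - b').
    by rewrite !(cmulBl, cmulBr); zmodule.
  apply: le_lt_trans (nrmD _ _) _.
  have b1 := nrmM (a - a') b; have b2 := nrmM a' (b - b').
  have b3 := nrm_tri a' a 0; rewrite !subr0 nrmB in b3.
  have p1 := nrm_ge0 (a - a'); have p2 := nrm_ge0 (b - b').
  have p3 := nrm_ge0 a; have p4 := nrm_ge0 b; have p5 := nrm_ge0 a'.
  apply: lt_le_trans dC; rewrite /C.
  have q1 : nrm (a - a') * nrm b <= d * nrm b by rewrite ler_wpM2r// ltW.
  have q2 : nrm a' * nrm (b - b') <= (1 + nrm a) * nrm (b - b').
    by rewrite ler_wpM2r//; lra.
  have q3 : (1 + nrm a) * nrm (b - b') < (1 + nrm a) * d by rewrite ltr_pM2l//; lra.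
  by lra.
- move=> a ha e e0; have [a' pa h1] := ha e e0; exists (a'^*).
    exact: polynomial_star.
  by rewrite -cstarB nrm_star.
Qed.

(** For homogeneous [y] one has [lam w y = U m y (U m')^*], and [U m x (U m')^*]
    lies in [J]; both sides are contractive in [x - y]. *)
Lemma implemented_near_ideal (J : set B) (n : int) x y (e : R) :
  closed_ideal J -> finite_degree k -> J x -> homogeneous n y ->
  nrm (x - y) <= e -> exists2 x', J x' & nrm (lam w x - x') <= 2 * e.
Proof.
move=> cJ fd Jx [_ [F [V [M hF]]]] xy.
have [e0 [U iU]] := implementers_exist ck l w1 V (fd F).
have [ye Uy] := hF F V e0 U (fun _ h => h) (fun _ h => h) iU.
set m' := (M + `|n|)%N; pose m := absz (m'%:Z + n).
have mE : m%:Z = m'%:Z + n by rewrite /m gez0_abs /m'; lia.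
have hy := Uy m m' _ _ mE; exists (U m ** x ** (U m')^*).
  case: cJ => _ Ml Mr; apply: Mr; exact: Ml.
have ly : lam w y = U m ** y ** (U m')^*.
  rewrite hy; [|by rewrite /m' in mE *; lia|exact: leq_addr].
  by rewrite -cmulA (imp_unitary iU) ye.
have -> : lam w x - U m ** x ** (U m')^* =
    lam w (x - y) - U m ** (x - y) ** (U m')^*.
  rewrite (homB lw) {1}ly cmulBr cmulBl; zmodule.
apply: le_trans (nrmBD _ _) _.
have h1 := hom_contractive lw (x - y).
have h2 := nrmM (U m ** (x - y)) ((U m')^*); have h3 := nrmM (U m) (x - y).
have h4 := imp_bounded iU m; have h5 := imp_bounded iU m'; rewrite nrm_star in h2.
have p1 := nrm_ge0 (x - y); have p2 := nrm_ge0 (U m); have p3 := nrm_ge0 (U m').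
have q1 : nrm (U m) * nrm (x - y) <= nrm (x - y) by rewrite ler_piMl.
have q2 : nrm (U m ** (x - y)) * nrm (U m') <= nrm (U m ** (x - y)).
  by rewrite ler_piMr ?nrm_ge0.
by lra.
Qed.

(** ** Fejer means over the roots of unity *)

Section Fejer.
Variables (N : nat) (zeta : complex R).
Hypotheses (N0 : (0 < N)%N) (zetaN : zeta ^+ N = 1).
Hypothesis zeta_prim : forall d : int, d != 0 -> (`|d| < N)%N -> zeta ^ d != 1.

Lemma zeta1 : `|zeta| = 1.
Proof.
apply/eqP; rewrite -(@pexpr_eq1 _ _ N)// -?normrX ?zetaN ?normr1//.
Qed.

Lemma zetaX1 i : `|zeta ^+ i| = 1.
Proof. by rewrite normrX zeta1 expr1n. Qed.

Lemma zeta_exprz1 i (n : int) : `|(zeta ^+ i) ^ n| = 1.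
Proof.
case: n => n; first by rewrite -exprnP normrX zetaX1 expr1n.
by rewrite NegzE -invr_expz normfV -exprnP normrX zetaX1 expr1n invr1.
Qed.

(** The spectral component of degree [n], averaged over [N]-th roots of unity
    instead of the circle. *)
Definition component (n : int) (b : B) : B :=
  (N%:R^-1 : complex R) *: \sum_(i < N) ((zeta ^+ i) ^ (- n)) *: kap (zeta ^+ i) b.

Lemma nrm_natV (m : nat) : nrm (m%:R^-1 : complex R) = m%:R^-1.
Proof.
by rewrite nrmcV -(rmorph_nat (real_complex R)) nrmcR normr_nat.
Qed.

Lemma componentB n a b : component n (a - b) = component n a - component n b.
Proof.
rewrite /component -scalerBr -sumrB; congr (_ *: _); apply: eq_bigr => i _.
by rewrite (homB (weighted_hom hk (zetaX1 i))) scalerBr.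
Qed.

Lemma component_sum (I : Type) (s : seq I) (G : I -> B) n :
  component n (\sum_(i <- s) G i) = \sum_(i <- s) component n (G i).
Proof.
rewrite /component -scaler_sumr exchange_big; congr (_ *: _).
apply: eq_bigr => i _.
by rewrite (hom_sum (weighted_hom hk (zetaX1 i))) scaler_sumr.
Qed.

Lemma nrm_component n b : nrm (component n b) <= nrm b.
Proof.
rewrite nrmZ nrm_natV mulrC ler_pdivrMr ?ltr0n//.
apply: le_trans (nrm_sum _ _ _) _.
apply: le_trans (_ : \sum_(i < N) nrm b <= _).
  apply: ler_sum => i _; rewrite nrmZ (nrmcP _).1 ?zeta_exprz1// mul1r.
  exact: (hom_contractive (weighted_hom hk (zetaX1 i))).
by rewrite sumr_const card_ord mulr_natr.
Qed.

Lemma component_ideal (J : set B) n b : closed_ideal J ->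
  action_invariant kap J -> J b -> J (component n b).
Proof.
move=> cJ Jk Jb; have [J0 JD JZ _] := ideal_subspace cJ.
apply: (JZ); elim/big_rec: _ => [|i x _ Jx]; first exact: J0.
by apply: JD => //; apply: JZ; apply: Jk => //; exact: zetaX1.
Qed.

Lemma zeta_sum (d : int) : (`|d| < N)%N ->
  \sum_(i < N) (zeta ^+ i) ^ d = if d == 0 then N%:R else 0.
Proof.
move=> dN; case: eqP => [->|/eqP d0].
  rewrite (eq_bigr (fun=> 1)) => [|i _]; last by rewrite expr0z.
  by rewrite sumr_const card_ord.
have -> : \sum_(i < N) (zeta ^+ i) ^ d = \sum_(i < N) (zeta ^ d) ^+ i.
  by apply: eq_bigr => i _; exact: (exprzAC zeta i d).
have /eqP := subrX1 (zeta ^ d) N.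
have -> : (zeta ^ d) ^+ N = 1.
  by rewrite (exprzAC zeta d N : (zeta ^ d) ^+ N = (zeta ^+ N) ^ d) zetaN exp1rz.
rewrite subrr eq_sym mulf_eq0 subr_eq0 (negbTE (zeta_prim d0 dN)) /=.
by move=> /eqP.
Qed.

Lemma component_homogeneous n d y : homogeneous d y -> (`|d - n| < N)%N ->
  component n y = if n == d then y else 0.
Proof.
move=> [ky _] dN; rewrite /component.
have -> : \sum_(i < N) (zeta ^+ i) ^ (- n) *: kap (zeta ^+ i) y =
    (\sum_(i < N) (zeta ^+ i) ^ (d - n)) *: y.
  rewrite scaler_suml; apply: eq_bigr => i _; rewrite ky ?zetaX1// scalerA.
  have z0 := unit_neq0 (zetaX1 i).
  by rewrite [d - n]addrC (expfzDr (- n) d z0).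
rewrite zeta_sum// subr_eq0 eq_sym; case: eqP => _; last by rewrite scale0r scaler0.
by rewrite scalerA mulVf ?scale1r// pnatr_eq0 -lt0n.
Qed.

Lemma component_homogeneous_self n d y : homogeneous d y -> (`|d - n| < N)%N ->
  homogeneous n (component n y).
Proof.
move=> hy dN; rewrite (component_homogeneous hy dN).
by case: eqP => [->|_]; [|exact: homogeneous0].
Qed.

Definition fejer (M : nat) (b : B) : B :=
  (M%:R^-1 : complex R) *: \sum_(i < M) \sum_(j < M) component (i%:Z - j%:Z) b.

Lemma fejerB M a b : fejer M (a - b) = fejer M a - fejer M b.
Proof.
rewrite /fejer -scalerBr -sumrB; congr (_ *: _); apply: eq_bigr => i _.
by rewrite -sumrB; apply: eq_bigr => j _; exact: componentB.
Qed.

Lemma fejer_sum (I : Type) (s : seq I) (G : I -> B) M :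
  fejer M (\sum_(i <- s) G i) = \sum_(i <- s) fejer M (G i).
Proof.
rewrite /fejer -scaler_sumr [in RHS]exchange_big; congr (_ *: _).
apply: eq_bigr => i _; rewrite [in RHS]exchange_big; apply: eq_bigr => j _.
exact: component_sum.
Qed.

(** The Fejer kernel is nonnegative with mean 1. *)
Lemma nrm_fejer M b : (0 < M <= N)%N -> nrm (fejer M b) <= nrm b.
Proof.
move=> /andP[M0 MN].
pose ker (s : nat) : complex R :=
  M%:R^-1 * \sum_(i < M) \sum_(j < M) (zeta ^+ s) ^ (j%:Z - i%:Z).
have fE : fejer M b = (N%:R^-1 : complex R) *:
    \sum_(s < N) ker s *: kap (zeta ^+ s) b.
  rewrite /fejer /component; under eq_bigr do rewrite -scaler_sumr.
  rewrite -scaler_sumr !scalerA mulrC -scalerA; congr (_ *: _).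
  under eq_bigr do rewrite exchange_big; rewrite exchange_big scaler_sumr.
  apply: eq_bigr => s _; rewrite -scalerA scaler_suml; congr (_ *: _).
  apply: eq_bigr => i _; rewrite scaler_suml; apply: eq_bigr => j _.
  by rewrite opprB.
have ker_ge0 s : 0 <= ker s.
  have -> : ker s = M%:R^-1 * `|\sum_(j < M) (zeta ^+ s) ^+ j| ^+ 2.
    rewrite /ker; congr (_ * _); rewrite normCK rmorph_sum mulr_sumr.
    apply: eq_bigr => i _; rewrite mulr_suml; apply: eq_bigr => j _.
    rewrite (expfzDr j%:Z (- i%:Z) (unit_neq0 (zetaX1 s))) -exprnP; congr (_ * _).
    exact: unit_exprzN (zetaX1 s).
  by rewrite mulr_ge0 ?invr_ge0 ?ler0n ?exprn_ge0.
have ker_sum : \sum_(s < N) ker s = N%:R.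
  rewrite /ker -mulr_sumr exchange_big.
  rewrite (eq_bigr (fun=> N%:R)) => [|i _]; last first.
    rewrite exchange_big (eq_bigr (fun j : 'I_M => if j == i then N%:R else 0)).
      by rewrite (bigD1 i)//= eqxx big1 ?addr0// => j /negbTE ->.
    move=> j _; rewrite zeta_sum; last by have := ltn_ord i; have := ltn_ord j; lia.
    by rewrite subr_eq0 eqz_nat.
  by rewrite sumr_const card_ord -[N%:R *+ M]mulr_natl mulrA mulVf ?mul1r// pnatr_eq0 -lt0n.
rewrite fE nrmZ nrm_natV mulrC ler_pdivrMr ?ltr0n//.
apply: le_trans (nrm_sum _ _ _) _.
apply: le_trans (_ : \sum_(s < N) nrm (ker s) * nrm b <= _).
  apply: ler_sum => s _; rewrite nrmZ ler_wpM2l ?nrm_ge0//.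
  exact: (hom_contractive (weighted_hom hk (zetaX1 s))).
rewrite -mulr_suml mulrC ler_wpM2l ?nrm_ge0// -lecR rmorph_sum /=.
under eq_bigr => s _ do rewrite -nrmE ger0_norm//.
by rewrite ker_sum [(N%:R)%:C%C]rmorph_nat.
Qed.

(** For [|d| <= M] the Fejer kernel multiplies degree [d] by [1 - |d| / M]. *)
Lemma fejer_homogeneous M d y : (0 < M)%N -> (M + `|d| < N)%N ->
  homogeneous d y ->
  nrm (fejer M y - y) * M%:R <= `|d|%N%:R * nrm y.
Proof.
move=> M0 MN hy.
pose c (i : 'I_M) : bool := (0 <= i%:Z - d < M%:Z).
have inner (i : 'I_M) :
    \sum_(j < M) component (i%:Z - j%:Z) y = (c i)%:R *: y :> B.
  rewrite (eq_bigr (fun j : 'I_M => if j%:Z == i%:Z - d then y else 0)); last first.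
    move=> j _; rewrite (component_homogeneous hy).
      by congr (if _ then _ else _); apply/eqP/eqP; lia.
    by have := ltn_ord i; have := ltn_ord j; lia.
  case: (boolP (c i)) => ci /=; rewrite /c in ci.
    have jM : (absz (i%:Z - d) < M)%N by lia.
    have jE : (absz (i%:Z - d))%:Z = i%:Z - d by lia.
    rewrite (bigD1 (Ordinal jM))//= jE eqxx big1 ?addr0 ?scale1r// => j ji.
    case: eqP => // e; move: ji; have -> : j = Ordinal jM by apply: val_inj => /=; lia.
    by rewrite eqxx.
  rewrite scale0r big1// => j _; case: eqP => // e.
  by have := ltn_ord j; lia.
have -> : fejer M y - y =
    (M%:R^-1 : complex R) *: \sum_(i < M) ((c i)%:R - 1) *: y.
  rewrite /fejer (eq_bigr _ (fun i _ => inner i)) -!scaler_suml sumrB sumr_const card_ord.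
  rewrite scalerBl scalerBr; congr (_ - _).
  by rewrite scalerA mulVf ?scale1r// pnatr_eq0 -lt0n.
rewrite -scaler_suml !nrmZ nrm_natV mulrC mulVKf ?pnatr_eq0 -?lt0n//.
rewrite ler_wpM2r ?nrm_ge0//; apply: le_trans (nrm_sum _ _ _) _.
have -> : \sum_(i < M) nrm ((c i)%:R - 1 : complex R) = (\sum_(i < M) ~~ c i)%:R.
  rewrite natr_sum; apply: eq_bigr => i _.
  by case: (c i); rewrite ?subrr ?nrm0// sub0r nrmN nrmc1.
rewrite ler_nat.
have low n : (\sum_(i < M) (i < n) <= n)%N.
  elim: M {M0 MN c inner} => [|m ih]; first by rewrite big_ord0.
  rewrite big_ord_recr /=; case: ltnP => mn; last by rewrite addn0.
  rewrite addn1; apply: leq_trans mn; rewrite ltnS.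
  apply: leq_trans (_ : \sum_(i < m) 1 <= _)%N; last by rewrite sum1_card card_ord.
  by apply: leq_sum => i _; case: (_ < _)%N.
have [d0|d0] := leP 0 d.
  apply: leq_trans (low `|d|%N); apply: leq_sum => i _; rewrite /c.
  by case: ltnP => //; case: (boolP (_ && _)) => //; have := ltn_ord i; lia.
rewrite (reindex_inj rev_ord_inj).
apply: leq_trans (low `|d|%N); apply: leq_sum => i _; rewrite /c /=.
by case: ltnP => //; case: (boolP (_ && _)) => //; have := ltn_ord i; lia.
Qed.

Lemma fejer_close M (s : seq (int * B)) K (C : R) : (0 < M)%N ->
  (forall y, y \in s -> homogeneous y.1 y.2) ->
  (forall y, y \in s -> (`|y.1| <= K)%N) -> (M + K < N)%N ->
  \sum_(y <- s) `|y.1|%N%:R * nrm y.2 <= C ->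
  nrm (fejer M (\sum_(y <- s) y.2) - \sum_(y <- s) y.2) * M%:R <= C.
Proof.
move=> M0 hs sK MN sC; apply: le_trans sC.
rewrite fejer_sum -sumrB; apply: le_trans (ler_wpM2r (ler0n _ _) (nrm_sum _ _ _)) _.
rewrite mulr_suml big_seq [leRHS]big_seq; apply: ler_sum => y ys.
by apply: fejer_homogeneous => //; [apply: leq_ltn_trans MN; rewrite leq_add2l sK | exact: hs].
Qed.

End Fejer.

(** The degrees that occur in a finite computation are separated by the averages
    over such roots. *)
Lemma roots_of_unity (m : nat) : exists N (zeta : complex R),
  [/\ (m < N)%N, (0 < N)%N, zeta ^+ N = 1 &
    forall d : int, d != 0 -> (`|d| < N)%N -> zeta ^ d != 1].
Proof.
(* The order of a [2^r]-th root of -1 divides [2^(r+1)] but not [2^r], so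
   it is [2^(r+1)]. *)
pose r := m; pose zeta : complex R := (2 ^ r).-root (-1).
have z2 : zeta ^+ (2 ^ r) = -1 by rewrite rootCK// expn_gt0.
have zN : zeta ^+ (2 ^ r.+1) = 1 by rewrite expnSr exprM z2 sqrrN expr1n.
exists (2 ^ r.+1)%N, zeta; split=> //.
- by apply: ltn_trans (ltn_expl _ (ltnSn 1)) _; rewrite ltn_exp2l.
- by rewrite expn_gt0.
have two_gt0 : (0 < 2 ^ r.+1)%N by rewrite expn_gt0.
have [n0 n0P n0dvd] := prim_order_exists two_gt0 zN.
have n0E : n0 = (2 ^ r.+1)%N.
  have /(dvdn_pfactor _ _ (isT : prime 2)) [j jr nj] := n0dvd.
  move: jr; rewrite leq_eqVlt => /orP[/eqP <- //|]; rewrite ltnS => jr.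
  have : (n0 %| 2 ^ r)%N by rewrite nj dvdn_exp2l.
  rewrite (prim_order_dvd n0P) z2 => /eqP e.
  by have := lt_trans (ltrN10 (complex R)) (ltr01); rewrite e ltxx.
have nat1 n : (0 < n < 2 ^ r.+1)%N -> zeta ^+ n != 1.
  by move=> /andP[n1 nN]; rewrite -(prim_order_dvd n0P) n0E gtnNdvd.
case=> n d0 dN; first by apply: nat1; rewrite dN andbT lt0n.
by rewrite NegzE -invr_expz invr_eq1; apply: nat1.
Qed.

(** Approximate innerness moves the spectral components of an element of [J]
    inside [J]; the element itself is a limit of Fejer means of these. *)
Theorem weighted_action_ideal (J : set B) b : closed_ideal J ->
  finite_degree k -> generates (range q `|` range t) ->
  action_invariant kap J -> J b -> J (lam w b).
Proof.
move=> cJ fd gen Jk Jb; have [J0 JD JZ Jc] := ideal_subspace cJ.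
move/closedP: Jc; apply => e e0.
pose d := e / 8; have d0 : 0 < d by rewrite divr_gt0.
have dense := polynomial_dense gen.
have bound (s : seq (int * B)) : exists K, forall y, y \in s -> (`|y.1| <= K)%N.
  exists (\max_(y <- s) `|y.1|%N) => y ys.
  exact: (@leq_bigmax_seq _ s xpredT (fun y => `|y.1|%N)).
have [a [s hs aE] ab] := dense b d d0; have [K hK] := bound s.
pose C : R := \sum_(y <- s) `|y.1|%N%:R * nrm y.2.
have C0 : 0 <= C by apply: sumr_ge0 => y _; rewrite mulr_ge0 ?ler0n ?nrm_ge0.
(* [M] makes the Fejer mean of [a] close to [a]. The second approximation
   [a'] is needed within [d / M] because the Fejer mean is [1 / M] times
   a sum of [M^2] components. *)
pose M := (Num.trunc (C / d)).+1.
have MC : C < M%:R * d.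
  by rewrite -ltr_pdivrMr//; exact: truncnS_gt.
have M0 : (0 < M)%N by [].
have M0' : (0 : R) < M%:R by rewrite ltr0n.
have [a' [s' hs' aE'] ab'] := dense b _ (divr_gt0 d0 M0').
have [K' hK'] := bound s'.
have [N [zeta [NB N0 zN zprim]]] := roots_of_unity (M + M + K + K').
pose F := fejer N zeta M.
have MN : (0 < M <= N)%N by rewrite M0 /=; clear -NB; lia.
have Fb : nrm (b - F b) < 3 * d.
  have h1 : nrm (F a - a) < d.
    have MK : (M + K < N)%N by clear -NB; lia.
    have := fejer_close N0 zN zprim M0 (fun y ys => (hs y ys).1) hK MK (lexx C).
    rewrite -aE -/F => h; rewrite -(ltr_pM2r M0'); apply: le_lt_trans h _.
    by rewrite mulrC.
  have h2 := nrm_fejer N0 zN zprim (b - a) MN.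
  rewrite fejerB// -/F in h2.
  have h3 := nrm_tri b a (F b); have h4 := nrm_tri a (F a) (F b).
  rewrite [nrm (a - F a)]nrmB [nrm (F a - F b)]nrmB in h4.
  lra.
have part i j : (i < M)%N -> (j < M)%N ->
    exists2 x', J x' & nrm (lam w (component N zeta (i%:Z - j%:Z) b) - x') <=
      2 * (d / M%:R).
  move=> iM jM.
  apply: (@implemented_near_ideal J (i%:Z - j%:Z) _
    (component N zeta (i%:Z - j%:Z) a')) => //.
  - exact: component_ideal.
  - rewrite aE' component_sum// big_seq; apply: homogeneous_sum => y ys.
    have := hK' y ys => yK.
    apply: (component_homogeneous_self N0 zN zprim (hs' y ys).1).
    by clear -NB iM jM yK; lia.
  - rewrite -componentB//; apply: le_trans (nrm_component N0 zN _ _) _.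
    exact: ltW.
pose x (i j : 'I_M) := s2val (cid2 (part i j (ltn_ord i) (ltn_ord j))).
have Jx i j : J (x i j) by exact: s2valP (cid2 (part i j (ltn_ord i) (ltn_ord j))).
have hx (i j : 'I_M) : nrm (lam w (component N zeta (i%:Z - j%:Z) b) - x i j) <= 2 * (d / M%:R).
  exact: s2valP' (cid2 (part i j (ltn_ord i) (ltn_ord j))).
exists ((M%:R^-1 : complex R) *: \sum_(i < M) \sum_(j < M) x i j).
  apply: (JZ); elim/big_rec: _ => [|i z _ Jz]; first exact: J0.
  apply: (JD) => //; elim/big_rec: _ => [|j z' _ Jz']; first exact: J0.
  exact: JD.
have near : nrm (lam w (F b) - (M%:R^-1 : complex R) *: \sum_(i < M) \sum_(j < M) x i j)
    <= 2 * d.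
  rewrite /F /fejer (homZ lw) (hom_sum lw) -scalerBr -sumrB nrmZ nrm_natV mulrC.
  rewrite ler_pdivrMr//; apply: le_trans (nrm_sum _ _ _) _.
  apply: le_trans (_ : \sum_(i < M) 2 * d <= _); last first.
    by rewrite sumr_const card_ord mulr_natr.
  apply: ler_sum => i _; rewrite (hom_sum lw) -sumrB.
  apply: le_trans (nrm_sum _ _ _) _.
  apply: le_trans (_ : \sum_(j < M) 2 * (d / M%:R) <= _).
    by apply: ler_sum => j _; exact: hx.
  by rewrite sumr_const card_ord -[_ *+ M]mulr_natr -mulrA divfK// gt_eqF.
have h1 := hom_contractive lw (b - F b); rewrite (homB lw) in h1.
apply: le_lt_trans (nrm_tri _ (lam w (F b)) _) _.
rewrite /d in h1 near Fb *; lra.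
Qed.

End WeightedAction.

(** * Exel-Laca families *)

Section FiniteSums.
Variables (R : realType) (A : cstarType R).

Lemma fsum_mull (T : choiceType) (S : set T) (F : T -> A) a : finite_set S ->
  (\sum_(v \in S) F v) ** a = \sum_(v \in S) (F v ** a).
Proof. by move=> fS; rewrite !fsbig_finite// cmul_suml. Qed.

Lemma fsum_mulr (T : choiceType) (S : set T) (F : T -> A) a : finite_set S ->
  a ** (\sum_(v \in S) F v) = \sum_(v \in S) (a ** F v).
Proof. by move=> fS; rewrite !fsbig_finite// cmul_sumr. Qed.

Lemma fsum_star (T : choiceType) (S : set T) (F : T -> A) : finite_set S ->
  (\sum_(v \in S) F v)^* = \sum_(v \in S) (F v)^*.
Proof. by move=> fS; rewrite !fsbig_finite// cstar_sum. Qed.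

Lemma fsum_seq (V : zmodType) (T : choiceType) (S : set T) (s : seq T) (F : T -> V) :
  uniq s -> (forall x, S x <-> x \in s) -> \sum_(x \in S) F x = \sum_(x <- s) F x.
Proof.
move=> us h; rewrite [RHS]fsbig_seq//; have -> // : S = [set` s].
by apply/seteqP; split=> x /h.
Qed.

(** Right multiplication by [c] or by [1 - c]; the latter makes sense in an
    algebra without unit. *)
Definition cut (d : bool * A) (a : A) : A := if d.1 then a ** d.2 else a - a ** d.2.

Definition cuts (ds : seq (bool * A)) (a : A) : A :=
  foldl (fun a d => cut d a) a ds.

Lemma cuts_cat s1 s2 a : cuts (s1 ++ s2) a = cuts s2 (cuts s1 a).
Proof. exact: foldl_cat. Qed.

Lemma cutD d a b : cut d (a + b) = cut d a + cut d b.
Proof. by rewrite /cut; case: ifP => _; rewrite cmulDl// opprD addrACA. Qed.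

Lemma cut0 d : cut d 0 = 0.
Proof. by rewrite /cut cmul0l subrr; case: ifP. Qed.

Lemma cutsD ds a b : cuts ds (a + b) = cuts ds a + cuts ds b.
Proof. by elim: ds a b => //= d ds ih a b; rewrite cutD ih. Qed.

Lemma cuts0 ds : cuts ds 0 = 0.
Proof. by elim: ds => //= d ds ih; rewrite cut0. Qed.

Lemma cutsB ds a b : cuts ds (a - b) = cuts ds a - cuts ds b.
Proof. by apply/eqP; rewrite eq_sym subr_eq -cutsD subrK. Qed.

Lemma cuts_mull ds x a : cuts ds (x ** a) = x ** cuts ds a.
Proof.
elim: ds a => //= d ds ih a; rewrite -ih; congr cuts.
by rewrite /cut; case: ifP => _; rewrite ?cmulBr !cmulA.
Qed.

Lemma cuts_mulr ds x a : (forall d, d \in ds -> d.2 ** x = x ** d.2) ->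
  cuts ds (a ** x) = cuts ds a ** x.
Proof.
elim: ds a => //= d ds ih a h; rewrite -ih; last first.
  by move=> c cd; apply: h; rewrite inE cd orbT.
congr cuts; have hd : d.2 ** x = x ** d.2 by apply: h; rewrite inE eqxx.
by rewrite /cut; case: ifP => _; rewrite ?cmulBl -!cmulA hd.
Qed.

Lemma cuts_absorb ds x : (forall d, d \in ds -> x ** d.2 = if d.1 then x else 0) ->
  cuts ds x = x.
Proof.
elim: ds => //= d ds ih h; have -> : cut d x = x; last first.
  by apply: ih => c cd; apply: h; rewrite inE cd orbT.
have := h d; rewrite inE eqxx => /(_ isT) hd.
by rewrite /cut hd; case: d.1; rewrite ?subr0.
Qed.

Lemma cuts_mem ds d a : d \in ds -> d.2 ** d.2 = d.2 ->
  (forall c, c \in ds -> c.2 ** d.2 = d.2 ** c.2) ->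
  cuts ds a ** d.2 = if d.1 then cuts ds a else 0.
Proof.
move=> dds dd; elim: ds a dds => //= c ds ih a; rewrite inE => cds h.
have hds : forall c, c \in ds -> c.2 ** d.2 = d.2 ** c.2.
  by move=> b bd; apply: h; rewrite inE bd orbT.
case/orP: cds => [/eqP dc|dds]; last exact: ih.
rewrite -cuts_mulr// -dc /cut; case: ifP => _; first by rewrite -cmulA dd.
by rewrite cmulBl -cmulA dd subrr cuts0.
Qed.

Lemma cuts_commute ds ds' a :
  (forall d c, d \in ds -> c \in ds' -> d.2 ** c.2 = c.2 ** d.2) ->
  cuts ds (cuts ds' a) = cuts ds' (cuts ds a).
Proof.
elim: ds' a => //= c ds' ih a h; rewrite ih; last first.
  by move=> d b dd bd; apply: h => //; rewrite inE bd orbT.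
congr cuts; have hc d : d \in ds -> d.2 ** c.2 = c.2 ** d.2.
  by move=> dd; apply: h => //; rewrite inE eqxx.
by rewrite /cut; case: ifP => _; rewrite ?cutsB cuts_mulr.
Qed.

Lemma cuts_star ds a : a^* = a -> (forall d, d \in ds -> d.2^* = d.2) ->
  (forall d, d \in ds -> a ** d.2 = d.2 ** a) ->
  (forall c d, c \in ds -> d \in ds -> c.2 ** d.2 = d.2 ** c.2) ->
  (cuts ds a)^* = cuts ds a.
Proof.
elim: ds a => //= d ds ih a as_ sd ad dd; have dds : d \in d :: ds by rewrite inE eqxx.
have ds_ c : c \in ds -> c \in d :: ds by rewrite inE => ->; rewrite orbT.
apply: ih.
- rewrite /cut; case: ifP => _; rewrite ?cstarB cstarM sd// as_ ?ad//.
- by move=> c /ds_; exact: sd.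
- move=> c cds; rewrite /cut; case: ifP => _.
    by rewrite -cmulA dd// ?ds_// cmulA ad ?ds_// -cmulA.
  rewrite cmulBl cmulBr; congr (_ - _); first by rewrite ad// ds_.
  by rewrite -cmulA dd// ?ds_// cmulA ad ?ds_// -cmulA.
- by move=> b c /ds_ hb /ds_ hc; exact: dd.
Qed.

End FiniteSums.

Section ExelLacaFamily.
Variables (R : realType) (G : ultragraph) (num : enumeration G).
Variables (A : cstarType R) (p : uvertex G -> A) (s : uedge G -> A).
Hypothesis el : exel_laca_family p s.

Definition qproj (e : uedge G) : A := (s e)^* ** s e.

Lemma q_star e : (qproj e)^* = qproj e.
Proof. by rewrite /qproj cstarM cstarK. Qed.

Lemma q_idem e : qproj e ** qproj e = qproj e.
Proof. by rewrite /qproj -cmulA [s e ** (_ ** _)]cmulA (el_pisom el). Qed.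

Lemma s_q e : s e ** qproj e = s e.
Proof. by rewrite /qproj cmulA (el_pisom el). Qed.

Lemma p_star v : (p v)^* = p v. Proof. by have [] := el_proj el v. Qed.
Lemma p_idem v : p v ** p v = p v. Proof. by have [] := el_proj el v. Qed.

Definition edge_of (n : nat) : option (uedge G) :=
  if pselect (exists e, num e = n) is left h then Some (projT1 (cid h)) else None.

Lemma edge_of_num e : edge_of (num e) = Some e.
Proof.
rewrite /edge_of; case: pselect => [h|[]]; last by exists e.
by congr Some; apply: (@num_inj _ num); exact: projT2 (cid h).
Qed.

(** [q_(e_n)], extended by [q_(e_n) = 0] when there are fewer than [n] edges. *)
Definition qnum (n : nat) : A := if edge_of n is Some e then qproj e else 0.

Lemma Q_num e : qnum (num e) = qproj e.
Proof. by rewrite /qnum edge_of_num. Qed.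

Lemma QP n : (exists2 e, num e = n & qnum n = qproj e) \/
  ((forall e, num e <> n) /\ qnum n = 0).
Proof.
rewrite /qnum; case E : (edge_of n) => [e|]; [left; exists e => //|right; split=> // e en].
  by move: E; rewrite /edge_of; case: pselect => // h [<-]; exact: projT2 (cid h).
by move: E; rewrite -en edge_of_num.
Qed.

Lemma Q_star n : (qnum n)^* = qnum n.
Proof. by case: (QP n) => [[e _ ->]|[_ ->]]; rewrite ?q_star ?cstar0. Qed.

Lemma Q_idem n : qnum n ** qnum n = qnum n.
Proof. by case: (QP n) => [[e _ ->]|[_ ->]]; rewrite ?q_idem ?cmul0l. Qed.

Lemma Q_comm m n : qnum m ** qnum n = qnum n ** qnum m.
Proof.
case: (QP m) => [[e _ ->]|[_ ->]]; last by rewrite cmul0l cmul0r.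
case: (QP n) => [[f _ ->]|[_ ->]]; last by rewrite cmul0l cmul0r.
exact: (el_q_comm el).
Qed.

Lemma p_Q v n : p v ** qnum n = if `[< rnum num n v >] then p v else 0.
Proof.
case: (QP n) => [[e en ->]|[h ->]]; last first.
  by rewrite cmul0r; case: asboolP => // -[e /h].
case: asboolP => [[f fn fv]|h].
  have -> : e = f by apply: (@num_inj _ num); rewrite en fn.
  exact: (el_vertex_in el).
by apply: (el_vertex_out el) => ve; apply: h; exists e.
Qed.

Lemma p_p v v' : p v ** p v' = if v == v' then p v else 0.
Proof.
by case: eqP => [->|/eqP h]; [exact: p_idem | exact: (el_vertex_orth el)].
Qed.

Definition psum (S : set (uvertex G)) : A := \sum_(v \in S) p v.

Lemma p_psum v (S : set (uvertex G)) : finite_set S ->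
  p v ** psum S = if `[< S v >] then p v else 0.
Proof.
move=> fS; rewrite fsum_mulr//.
under eq_fsbigr do rewrite p_p.
case: asboolP => Sv.
  rewrite -(fsbig_widen [set v] S); last 2 first.
  - by move=> _ ->.
  - by move=> w [_ /= wv]; case: eqP => // e; case: wv.
  by rewrite fsbig_set1 eqxx.
by rewrite fsbig1// => w Sw; case: eqP => // e; move: Sv; rewrite e.
Qed.

Lemma psum_star S : finite_set S -> (psum S)^* = psum S.
Proof. by move=> fS; rewrite fsum_star//; apply: eq_fsbigr => v _; exact: p_star. Qed.

Lemma psum_idem S : finite_set S -> psum S ** psum S = psum S.
Proof.
move=> fS; rewrite {1}/psum fsum_mull//; apply: eq_fsbigr => v /set_mem Sv.
by rewrite p_psum//; case: asboolP.
Qed.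

(** ** The projections of words *)

Definition word_cuts (w : seq bool) (n : nat) : seq (bool * A) :=
  [seq (bit w i, qnum i) | i <- iota 1 n].

(** The projection [prod_(w_i = 1) q_(e_i) prod_(w_j = 0) (1 - q_(e_j))]; the
    first factor is repeated so that no unit is needed. *)
Definition wproj (w : seq bool) : A :=
  cuts (word_cuts w (size w)) (qnum (index true w).+1).

Lemma mem_word_cuts w n d : d \in word_cuts w n <->
  exists2 i, (1 <= i <= n)%N & d = (bit w i, qnum i).
Proof.
split=> [/mapP h|[i hi ->]].
  have [i hi ->] := h; exists i => //.
  by move: hi; rewrite mem_iota add1n.
by apply/mapP; exists i => //; rewrite mem_iota add1n.
Qed.

Lemma word_cuts_Q w n i a : (1 <= i <= n)%N ->
  cuts (word_cuts w n) a ** qnum i = if bit w i then cuts (word_cuts w n) a else 0.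
Proof.
move=> hi; apply: (@cuts_mem _ _ _ (bit w i, qnum i)) => /=.
- by apply/mem_word_cuts; exists i.
- exact: Q_idem.
- by move=> c /mem_word_cuts[j _ ->] /=; exact: Q_comm.
Qed.

Lemma word_cuts_mulQ w n i a :
  cuts (word_cuts w n) (a ** qnum i) = cuts (word_cuts w n) a ** qnum i.
Proof. by apply: cuts_mulr => c /mem_word_cuts[j _ ->] /=; exact: Q_comm. Qed.

Lemma bit_index w : has id w -> (1 <= (index true w).+1 <= size w)%N /\
  bit w (index true w).+1.
Proof.
move=> hw; have tw : true \in w by case/hasP: hw => -[].
by split; [rewrite /= index_mem | rewrite /bit /= nth_index].
Qed.

Lemma wprojE w i : (1 <= i <= size w)%N -> bit w i ->
  wproj w = cuts (word_cuts w (size w)) (qnum i).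
Proof.
move=> hi bi; have hw : has id w.
  apply/hasP; exists true => //; rewrite -bi mem_nth//.
  by case: i hi {bi} => //= i.
have [hj bj] := bit_index hw; rewrite /wproj; set j := (index true w).+1 in hj bj *.
have h a l : (1 <= l <= size w)%N -> bit w l ->
    cuts (word_cuts w (size w)) (a ** qnum l) = cuts (word_cuts w (size w)) a.
  by move=> hl bl; rewrite word_cuts_mulQ word_cuts_Q// bl.
by rewrite -(h (qnum j) i)// -(h (qnum i) j)// Q_comm.
Qed.

Lemma wproj_Q w i : (1 <= i <= size w)%N ->
  wproj w ** qnum i = if bit w i then wproj w else 0.
Proof. exact: word_cuts_Q. Qed.

Lemma wproj_absorb w x : (forall i, (1 <= i <= size w)%N ->
    x ** qnum i = if bit w i then x else 0) ->
  cuts (word_cuts w (size w)) x = x.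
Proof. by move=> h; apply: cuts_absorb => d /mem_word_cuts[i hi ->] /=; exact: h. Qed.

Lemma mul_wproj w x : has id w -> (forall i, (1 <= i <= size w)%N ->
    x ** qnum i = if bit w i then x else 0) -> x ** wproj w = x.
Proof.
move=> hw h; have [hj bj] := bit_index hw.
by rewrite /wproj -cuts_mull h// bj wproj_absorb.
Qed.

Lemma wproj_idem w : has id w -> wproj w ** wproj w = wproj w.
Proof. by move=> hw; apply: mul_wproj => // i; exact: wproj_Q. Qed.

Lemma wproj_star w : (wproj w)^* = wproj w.
Proof.
apply: cuts_star => [|d /mem_word_cuts[i _ ->]|d /mem_word_cuts[i _ ->]|].
- exact: Q_star.
- exact: Q_star.
- exact: Q_comm.
- by move=> c d /mem_word_cuts[i _ ->] /mem_word_cuts[j _ ->] /=; exact: Q_comm.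
Qed.

Lemma wproj_orth w w' i : (1 <= i <= size w)%N -> (1 <= i <= size w')%N ->
  bit w i != bit w' i -> wproj w ** wproj w' = 0.
Proof.
move=> hi hi'; case E : (bit w i) => E'.
  have bi' : bit w' i = false by case: (bit w' i) E'.
  have := wproj_Q hi; rewrite E => <-; rewrite -cmulA.
  have : (wproj w' ** qnum i)^* = 0 by rewrite wproj_Q// bi' cstar0.
  by rewrite cstarM wproj_star Q_star => ->; rewrite cmul0r.
have bi' : bit w' i by case: (bit w' i) E'.
have := wproj_Q hi'; rewrite bi' => h.
have h2 : qnum i ** wproj w' = wproj w'.
  by have := congr1 (@cstar _ _) h; rewrite cstarM Q_star wproj_star.
by rewrite -h2 cmulA wproj_Q// E cmul0l.
Qed.

Lemma rwordP w v : rword num w v <->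
  forall i, (1 <= i <= size w)%N -> bit w i = `[< rnum num i v >].
Proof.
split=> [[h1 h2] i hi|h].
  case E : (bit w i); apply/esym; first by apply/asboolP; apply: h1; rewrite /= hi E.
  by apply/asboolP => hv; apply: h2; exists i => //=; rewrite hi E.
split; first by move=> i /= /andP[hi bi]; apply/asboolP; rewrite -h.
by move=> [i /= /andP[hi bi] hv]; move: bi; rewrite h// => /negP; apply; apply/asboolP.
Qed.

Lemma p_wproj v w : has id w ->
  p v ** wproj w = if `[< rword num w v >] then p v else 0.
Proof.
move=> hw; case: asboolP => [/rwordP h|h].
  by apply: mul_wproj => // i hi; rewrite p_Q h.
have [i [hi]] : exists i, (1 <= i <= size w)%N /\ bit w i <> `[< rnum num i v >].
  apply: contrapT => hn; apply: h; apply/rwordP => i hi; apply: contrapT => hb.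
  by apply: hn; exists i.
have -> : p v ** wproj w = cuts (word_cuts w (size w)) (p v ** qnum (index true w).+1).
  by rewrite cuts_mull.
case: asboolP => hv hb.
  have bi : bit w i = false by case: (bit w i) hb.
  have -> : p v = p v ** qnum i by rewrite p_Q; case: asboolP.
  by rewrite -cmulA Q_comm cmulA word_cuts_mulQ word_cuts_Q// bi.
have bi : bit w i by case: (bit w i) hb.
rewrite cuts_mull -/(wproj w) (wprojE hi bi) -cuts_mull p_Q.
by case: asboolP => // _; rewrite cuts0.
Qed.

Lemma wproj_p v w : has id w ->
  wproj w ** p v = if `[< rword num w v >] then p v else 0.
Proof.
move=> hw; rewrite -[LHS]cstarK cstarM wproj_star p_star p_wproj//.
by case: ifP; rewrite ?p_star ?cstar0.
Qed.

Lemma psum_wproj S w : finite_set S -> has id w ->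
  psum S ** wproj w = psum (S `&` rword num w).
Proof.
move=> fS hw; rewrite fsum_mull// /psum fsbig_mkcondr; apply: eq_fsbigr => v _.
by rewrite p_wproj//; congr (if _ then _ else _); apply/asboolP/idP; rewrite inE.
Qed.

Lemma wproj_psum S w : finite_set S -> has id w ->
  wproj w ** psum S = psum S ** wproj w.
Proof.
move=> fS hw; rewrite fsum_mull// fsum_mulr//; apply: eq_fsbigr => v _.
by rewrite p_wproj// wproj_p.
Qed.

Lemma bit_rcons w b i : (1 <= i <= size w)%N -> bit (rcons w b) i = bit w i.
Proof. by case: i => // i /= hi; rewrite /bit nth_rcons /= hi. Qed.

Lemma bit_last w b : bit (rcons w b) (size w).+1 = b.
Proof. by rewrite /bit /= nth_rcons ltnn eqxx. Qed.

Lemma word_cuts_rcons w b : word_cuts (rcons w b) (size w).+1 =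
  rcons (word_cuts w (size w)) (b, qnum (size w).+1).
Proof.
have iotaS n : iota 1 n.+1 = rcons (iota 1 n) n.+1.
  by rewrite -[n.+1 in LHS]addn1 iotaD add1n cats1.
rewrite /word_cuts iotaS map_rcons bit_last; congr rcons.
by apply/eq_in_map => i; rewrite mem_iota add1n => hi; rewrite bit_rcons.
Qed.

Lemma wproj_split w : has id w ->
  wproj w = wproj (rcons w true) + wproj (rcons w false).
Proof.
move=> hw; have [hi bi] := bit_index hw; set i := (index true w).+1 in hi bi.
have hi' b : (1 <= i <= size (rcons w b))%N.
  by rewrite size_rcons; move/andP: hi => [-> /leqW ->].
have bi' b : bit (rcons w b) i by rewrite bit_rcons.
rewrite !(wprojE (hi' _) (bi' _)) (wprojE hi bi) !size_rcons !word_cuts_rcons.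
by rewrite -!cats1 !cuts_cat /= /cut /= addrC subrK.
Qed.

Lemma wproj_rcons_true w : wproj (rcons w true) =
  cuts (word_cuts w (size w)) (qnum (size w).+1).
Proof.
have hi : (1 <= (size w).+1 <= size (rcons w true))%N by rewrite size_rcons /=.
rewrite (wprojE hi) ?bit_last// size_rcons word_cuts_rcons -cats1 cuts_cat /=.
by rewrite /cut /= -word_cuts_mulQ Q_idem.
Qed.

Fixpoint words (n : nat) : seq (seq bool) :=
  if n is m.+1 then [seq rcons w true | w <- words m] ++ [seq rcons w false | w <- words m]
  else [:: [::]].

Lemma mem_words n w : (w \in words n) = (size w == n).
Proof.
elim: n w => [|n ih] w; first by rewrite inE; case: w.
rewrite mem_cat; case/lastP: w => [|w b].
  by apply/negbTE/norP; split; apply/mapP => -[[]].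
rewrite size_rcons eqSS -ih.
have inj (c : bool) : injective (fun w => rcons w c) by move=> x y; move/rcons_inj => [].
case: b; rewrite (mem_map (inj _)); last first.
  by case: mapP => // -[x _ /rcons_inj[]].
by rewrite orbC; case: mapP => // -[x _ /rcons_inj[]].
Qed.

Lemma words_uniq n : uniq (words n).
Proof.
elim: n => // n ih /=; rewrite cat_uniq !map_inj_uniq ?ih//=; last 2 first.
- by move=> x y; move/rcons_inj => [].
- by move=> x y; move/rcons_inj => [].
rewrite andbT; apply/hasPn => _ /mapP[w _ ->]; apply/negP => /mapP[w' _].
by move/rcons_inj => [].
Qed.

(** The product over [i] of [q_i + (1 - q_i)] is 1. *)
Lemma sum_words n a : \sum_(w <- words n) cuts (word_cuts w (size w)) a = a.
Proof.
elim: n => [|n ih]; first by rewrite /= big_seq1.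
rewrite /= big_cat /= !big_map -[RHS]ih -big_split /=; apply: eq_bigr => w _.
rewrite !size_rcons !word_cuts_rcons -!cats1 !cuts_cat /= /cut /=.
by rewrite addrC subrK.
Qed.

Lemma Q_sum_words n : qnum n.+1 = \sum_(w <- words n) wproj (rcons w true).
Proof.
rewrite -[LHS](sum_words n) big_seq [RHS]big_seq; apply: eq_bigr => w.
by rewrite mem_words => /eqP wn; rewrite wproj_rcons_true wn.
Qed.

(** The product relation is available for lists of edges without repetition;
    indices of missing edges contribute factors 0 or 1, and repeated factors are
    absorbed. *)
Lemma wproj_finite w : has id w -> finite_set (rword num w) ->
  wproj w = psum (rword num w).
Proof.
move=> hw fw; set n := size w.
have [[i hi]|all_edges] := pselect (exists i, [/\ (1 <= i <= n)%N, bit w i &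
    forall e, num e <> i]).
  have [bi ne] : bit w i /\ forall e, num e <> i by case: hi.
  have hi1 : (1 <= i <= n)%N by case: hi.
  have Qi : qnum i = 0 by case: (QP i) => [[e /ne]|[]].
  rewrite (wprojE hi1 bi) Qi cuts0 (_ : rword num w = set0) /psum ?fsbig_set0//.
  apply/seteqP; split=> // v /rwordP /(_ i hi1); rewrite bi => /esym/asboolP.
  by case=> e /ne.
have edge i : (1 <= i <= n)%N -> bit w i -> exists e, num e = i.
  move=> hi bi; apply: contrapT => h; apply: all_edges; exists i; split=> // e ei.
  by apply: h; exists e.
have [hj bj] := bit_index hw; have [e0 e0j] := edge _ hj bj.
pose L := undup (pmap edge_of (iota 1 n)).
have memL e : (e \in L) = (1 <= num e <= n)%N.
  rewrite mem_undup mem_pmap; apply/mapP/idP => [[i hi]|h]; last first.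
    by exists (num e); rewrite ?edge_of_num// mem_iota add1n.
  move: hi; rewrite mem_iota add1n => hi; rewrite /edge_of; case: pselect => // h [->].
  by rewrite (projT2 (cid h)).
pose lam := [seq e <- L | bit w (num e) && (e != e0)].
pose mu := [seq e <- L | ~~ bit w (num e)].
have ub : uniq (e0 :: lam) by rewrite /= mem_filter eqxx andbF filter_uniq ?undup_uniq.
have um : uniq mu by rewrite filter_uniq ?undup_uniq.
have dis : ~~ has (mem mu) (e0 :: lam).
  rewrite /= negb_or mem_filter negb_and negbK e0j bj /=.
  apply/hasPn => e; rewrite /= !mem_filter => /andP[/andP[be _] _].
  by rewrite negb_and negbK be.
have rf : rfin (e0 :: lam) mu = rword num w.
  apply/seteqP; split=> v.
    move=> [h1 h2]; apply/rwordP => i hi; case E : (bit w i).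
      have [e ei] := edge i hi E; apply/esym/asboolP; exists e => //.
      apply: h1; rewrite /= inE mem_filter memL ei hi E andbT /=.
      by case: eqP.
    apply/esym/asboolP => -[e ei ev]; apply: h2; exists e => //=.
    by rewrite mem_filter memL ei E hi.
  move=> /rwordP h; split=> [e|[f]] /=.
    rewrite inE mem_filter memL => he.
    have [he1 be] : (1 <= num e <= n)%N /\ bit w (num e).
      by case/orP: he => [/eqP ->|/andP[/andP[-> _] ->]]; rewrite // e0j.
    have := h _ he1; rewrite be => /esym/asboolP [e' /(@num_inj _ num) ->] //.
  rewrite mem_filter memL => /andP[bf hf] fv; move: bf; rewrite h// => /negP; apply.
  by apply/asboolP; exists f.
pose ds := [seq (true, qproj e) | e <- lam] ++ [seq (false, qproj e) | e <- mu].
have qE : qprod s e0 lam mu = cuts ds (qproj e0).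
  have fm (c : bool) l a : cuts [seq (c, qproj e) | e <- l] a =
      foldl (fun a e => if c then a ** qproj e else a - a ** qproj e) a l.
    by elim: l a => //= e l ih a; rewrite ih.
  by rewrite /ds cuts_cat !fm.
have := el_qprod el ub um dis; rewrite rf => /(_ fw); rewrite qE /psum => <-.
have memds d : d \in ds -> exists e, [/\ d.2 = qproj e, (1 <= num e <= n)%N &
    d.1 = bit w (num e)].
  rewrite mem_cat => /orP[] /mapP[e]; rewrite mem_filter memL => /andP[he h] ->.
    by exists e; split=> //=; case/andP: he => ->.
  by exists e; split=> //=; rewrite (negbTE he).
have qds d x : d \in ds -> d.2 ** qproj x = qproj x ** d.2.
  by move=> /memds[e [-> _ _]]; exact: (el_q_comm el).
have memq e : (1 <= num e <= n)%N -> e != e0 -> (bit w (num e), qproj e) \in ds.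
  move=> he ee; rewrite mem_cat; case E : (bit w (num e)); apply/orP.
    by left; apply/mapP; exists e => //; rewrite mem_filter memL he E ee.
  by right; apply/mapP; exists e => //; rewrite mem_filter memL he E.
have absx i : (1 <= i <= n)%N ->
    cuts ds (qproj e0) ** qnum i = if bit w i then cuts ds (qproj e0) else 0.
  move=> hi; case: (QP i) => [[e ei ->]|[ne ->]]; last first.
    rewrite cmul0r; case E : (bit w i) => //.
    by have [e ei] := edge i hi E; case: (ne e).
  have [ee|ee] := eqVneq e e0.
    rewrite -ei ee e0j bj -cuts_mulr ?q_idem// => d dd; exact: qds.
  rewrite -ei in hi *; have := memq e hi ee => dd.
  apply: (cuts_mem (d := (bit w (num e), qproj e))) => //=; first exact: q_idem.
  by move=> c cd; exact: qds.
rewrite -(wproj_absorb absx) cuts_commute; last first.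
  by move=> d c /mem_word_cuts[i _ ->] /memds[e [-> _ _]] /=; rewrite -Q_num Q_comm.
have -> : cuts (word_cuts w (size w)) (qproj e0) = wproj w.
  by rewrite -Q_num e0j -(wprojE hj bj).
apply/esym/cuts_absorb => d /memds[e [-> he ->]].
by rewrite -Q_num wproj_Q.
Qed.

(** ** The projections of the vertices of the graph *)

Variable sig : sigma_map num.

Definition short (n : nat) : set (uvertex G) :=
  [set v | Wp num v /\ (size (sig v) < n)%N].

Lemma short_finite n : finite_set (short n).
Proof.
pose D : set (seq bool) := [set` flatten [seq words i | i <- iota 0 n]].
have fD : finite_set D by exact: finite_seq.
apply: (@sub_finite_set _ _ (\bigcup_(w in D) [set v | Wp num v /\ sig v = w])).
  move=> v [Wv sv]; exists (sig v) => //; rewrite /D /=.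
  apply/flattenP; exists (words (size (sig v))); last by rewrite mem_words.
  by apply: map_f; rewrite mem_iota.
apply: bigcup_finite => // w _.
have [dw|ndw] := pselect (Delta num w); first exact: sigma_fin.
rewrite (_ : [set v | _] = set0)//; apply/seteqP; split=> // v [Wv sv].
by apply: ndw; rewrite -sv; exact: sigma_Delta.
Qed.

(** The vertices that [sigma] attaches to words shorter than [w] are represented
    by their own projections, so they are removed from the projection of [w]. *)
Definition Rword (w : seq bool) : A := wproj w - psum (short (size w)) ** wproj w.

(** The elements of the ultragraph algebra that play the role of the projections
    [U_x U_x^*]. *)
Definition Rvertex (x : E0 num) : A :=
  match x with inl v => p v | inr w => Rword (val w) end.

Lemma Delta_has w : Delta num w -> has id w.
Proof. by move=> [/has_idP]. Qed.

Lemma Delta_Wp w v : Delta num w -> rword num w v -> Wp num v.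
Proof. by move=> dw wv; exists w. Qed.

Lemma sigma_prefix w v : Wp num v -> rword num w v ->
  (size w <= size (sig v))%N -> take (size w) (sig v) = w.
Proof.
move=> Wv /rwordP h1 hs; have /rwordP h2 := sigma_rword sig Wv.
have st : size (take (size w) (sig v)) = size w by rewrite size_takel.
apply: (@eq_from_nth _ false) => [//|i]; rewrite st => iw.
rewrite nth_take//; have := h1 i.+1; have := h2 i.+1.
rewrite /bit /= => -> //; last exact: leq_trans hs.
by move=> ->.
Qed.

(** Otherwise [w] would be an initial segment of [sigma v], and initial segments
    of words of [Delta] with a letter 1 belong to [Delta]. *)
Lemma not_Delta_short w v : has id w -> ~ Delta num w -> rword num w v ->
  (size (sig v) < size w)%N.
Proof.
move=> hw ndw wv; rewrite ltnNge; apply/negP => hs; apply: ndw.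
have [Wv|nWv] := pselect (Wp num v).
  have tw := sigma_prefix Wv wv hs; rewrite -tw; apply: Delta_take.
    exact: sigma_Delta.
  by rewrite tw.
by move: hs; rewrite (sigma_W0 sig)// leqn0 size_eq0 => /eqP w0; rewrite w0 in hw.
Qed.

Lemma not_Delta_finite w : has id w -> ~ Delta num w -> finite_set (rword num w).
Proof.
by move=> /has_idP hw ndw; apply: contrapT => h; apply: ndw; split.
Qed.

(** A word outside [Delta] has a finite range, all of whose vertices are
    attached to shorter words, so that nothing is left of its projection. *)
Lemma cut_short w Y : has id w -> finite_set Y ->
  (forall v, rword num w v -> Y v <-> (size (sig v) < size w)%N) ->
  wproj w - psum Y ** wproj w = if `[< Delta num w >] then Rword w else 0.
Proof.
move=> hw fY hY; rewrite psum_wproj//; case: asboolP => dw.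
  rewrite /Rword psum_wproj//; last exact: short_finite.
  congr (_ - psum _); apply/seteqP; split=> v [h1 h2]; split=> //.
    by split; [exact: Delta_Wp h2 | exact/hY].
  by apply/hY => //; case: h1.
rewrite wproj_finite//; last exact: not_Delta_finite.
rewrite (_ : Y `&` _ = rword num w) ?subrr//.
apply/seteqP; split=> [v []//|v wv]; split=> //; apply/hY => //.
exact: not_Delta_short.
Qed.

Lemma Rword_wproj w : has id w -> Rword w ** wproj w = Rword w.
Proof. by move=> hw; rewrite /Rword cmulBl -cmulA wproj_idem. Qed.

Lemma Rword_star w : has id w -> (Rword w)^* = Rword w.
Proof.
move=> hw; have fs := short_finite (size w).
by rewrite /Rword cstarB cstarM wproj_star psum_star// wproj_psum.
Qed.

Lemma wproj_Rword w : has id w -> wproj w ** Rword w = Rword w.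
Proof.
by move=> hw; rewrite -[LHS]cstarK cstarM wproj_star Rword_star// Rword_wproj// Rword_star.
Qed.

Lemma Rword_idem w : has id w -> Rword w ** Rword w = Rword w.
Proof.
move=> hw; have fs := short_finite (size w).
rewrite {1}/Rword cmulBl -cmulA wproj_Rword//.
have -> : psum (short (size w)) ** Rword w = 0; last by rewrite subr0.
by rewrite /Rword cmulBr cmulA psum_idem// subrr.
Qed.

Lemma Rvertex_proj x : projection (Rvertex x).
Proof.
case: x => [v|w] /=; first exact: (el_proj el).
have hw := Delta_has (set_valP w).
by split; [exact: Rword_star | exact: Rword_idem].
Qed.

Lemma p_Rword v w : Delta num w -> p v ** Rword w =
  if `[< rword num w v /\ (size w <= size (sig v))%N >] then p v else 0.
Proof.
move=> dw; have hw := Delta_has dw; have fs := short_finite (size w).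
rewrite /Rword cmulBr cmulA p_psum//.
case: (asboolP (rword num w v /\ (size w <= size (sig v))%N)) => [[wv hs]|h].
  have -> : `[< short (size w) v >] = false.
    by apply/asboolP => -[_]; rewrite ltnNge hs.
  by rewrite cmul0l subr0 p_wproj//; case: asboolP.
case: asboolP => [_|sv]; first by rewrite subrr.
rewrite cmul0l subr0 p_wproj//; case: asboolP => // wv; case: h; split=> //.
by rewrite leqNgt; apply/negP => hs; apply: sv; split=> //; exact: Delta_Wp dw wv.
Qed.

Lemma Rword_orth w w' : has id w -> has id w' -> wproj w ** wproj w' = 0 ->
  Rword w ** Rword w' = 0.
Proof.
move=> hw hw' h.
by rewrite -Rword_wproj// -(wproj_Rword hw') cmulA -(cmulA _ (wproj w)) h cmul0r cmul0l.
Qed.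

(** The number of edges of the path [f_x]. *)
Definition level (x : E0 num) : nat :=
  match x with
  | inl v => if pselect (Wp num v) then (size (sig v) - index true (sig v))%N else 0%N
  | inr w => (size (val w) - (index true (val w)).+1)%N
  end.

Lemma index_prefix w v : Delta num w -> take (size w) v = w ->
  index true v = index true w.
Proof.
move=> dw tw; have tr : true \in w by case/hasP: (Delta_has dw) => -[].
by rewrite -{1}(cat_take_drop (size w) v) tw index_cat tr.
Qed.

(** Two words at the same level have their first letter 1 at different
    positions, or have the same length. A vertex [v] in the range of [w] that
    survives in [R_w] is attached to an extension of [w], hence has higher
    level. *)
Lemma Rvertex_orth x y : x != y -> level x = level y ->
  Rvertex x ** Rvertex y = 0.
Proof.
have pw v (w : Delta num) : level (inl v) = level (inr w) -> p v ** Rword (val w) = 0.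
  move=> /=; have dw := set_valP w; rewrite p_Rword//.
  case: asboolP => // -[wv hs]; have Wv := Delta_Wp dw wv.
  case: pselect => // Wv'; rewrite (index_prefix dw (sigma_prefix Wv wv hs)).
  have [/andP[_ h] _] := bit_index (Delta_has dw).
  rewrite -/(\val w) /= in h hs * => e; exfalso; move: (index true (sval w)) h e => j.
  by move=> h e; clear -h hs e; lia.
case: x y => [v|w] [v'|w'] /=.
- by move=> ne _; apply: (el_vertex_orth el); apply: contra ne => /eqP ->.
- by move=> _; exact: pw.
- move=> _ e; rewrite -[LHS]cstarK cstarM p_star Rword_star; last first.
    exact: Delta_has (set_valP w).
  by rewrite pw ?cstar0.
move=> ne e; have dw := set_valP w; have dw' := set_valP w'.
have hw := Delta_has dw; have hw' := Delta_has dw'.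
apply: Rword_orth => //.
have [/andP[_ i1] b1] := bit_index hw; have [/andP[_ i2] b2] := bit_index hw'.
have lt (u u' : seq bool) : has id u -> (index true u < index true u')%N ->
    bit u' (index true u).+1 = false.
  move=> _ ii; apply/negbTE; rewrite /bit /=; apply/negP => h.
  have := @before_find _ false (pred1 true) u' _ ii.
  by rewrite /= h.
have [ii|ii|ii] := ltngtP (index true (val w)) (index true (val w')).
- apply: (@wproj_orth _ _ (index true (val w)).+1); rewrite /= ?b1 ?lt//.
  exact: ltn_trans ii i2.
- apply: (@wproj_orth _ _ (index true (val w')).+1); rewrite /= ?b2 ?lt//.
  exact: ltn_trans ii i1.
have ss : size (val w) = size (val w').
  have cancel (a b c : nat) : (c < a)%N -> (c < b)%N -> (a - c.+1 = b - c.+1)%N -> a = b.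
    by clear; lia.
  by apply: (cancel _ _ _ _ i2); [rewrite -ii | move: e => /= <-; rewrite -ii].
have [i [hi di]] : exists i, (i < size (val w))%N /\
    nth false (val w) i <> nth false (val w') i.
  apply: contrapT => hn; move: ne; have -> : w = w'; last by rewrite eqxx.
  apply: val_inj; apply: (@eq_from_nth _ false) => // i iw.
  by apply: contrapT => d; apply: hn; exists i.
by apply: (@wproj_orth _ _ i.+1); rewrite /= -?ss ?hi// /bit /=; apply/eqP.
Qed.

Lemma sum_Delta (L : seq (seq bool)) :
  \sum_(d <- (pmap insub L : seq (Delta num))) Rword (val d) =
  \sum_(w <- L) if `[< Delta num w >] then Rword w else 0.
Proof.
elim: L => [|w L ih]; first by rewrite !big_nil.
rewrite big_cons /= -ih; case: asboolP => dw.
  have -> : insub w = Some (DeltaV dw) :> option (Delta num).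
    by rewrite (insubT (fun w => w \in Delta num) (mem_set dw)).
  by rewrite /= big_cons.
by rewrite insubF ?add0r//; apply/negP => /set_mem.
Qed.

Lemma sum_vertices_words (Y : set (uvertex G)) (L : seq (seq bool)) :
  finite_set Y -> uniq L -> exists xs : seq (E0 num),
  [/\ uniq xs, forall x, x \in xs <-> match x with
        inl v => Y v | inr d => val d \in L end &
      \sum_(x <- xs) Rvertex x =
      psum Y + \sum_(w <- L) if `[< Delta num w >] then Rword w else 0].
Proof.
move=> fY uL; exists ([seq inl v | v <- finmap.enum_fset (fset_set Y)] ++
  [seq inr d | d <- (pmap insub L : seq (Delta num))]); split.
- rewrite cat_uniq !map_inj_uniq//; last 2 first.
  + by move=> x y [].
  + by move=> x y [].
  have -> : uniq (finmap.enum_fset (fset_set Y)) by exact: finmap.fset_uniq.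
  rewrite pmap_sub_uniq// andbT /=; apply/hasPn => _ /mapP[d _ ->].
  by apply/negP => /mapP[].
- move=> [v|d]; rewrite mem_cat; split.
  + case/orP => /mapP[u + []]; last by [].
    by move=> + ->; rewrite in_fset_set// => /set_mem.
  + by move=> /mem_set Yv; apply/orP; left; rewrite map_f// in_fset_set.
  + case/orP => /mapP[u + []]; first by [].
    by move=> + ->; rewrite mem_pmap_sub.
  + by move=> dL; apply/orP; right; rewrite map_f// mem_pmap_sub.
rewrite big_cat !big_map /= sum_Delta /psum fsbig_finite//.
Qed.

(** The vertices among the elements of [X(e)]. *)
Definition near_range (e : uedge G) : set (uvertex G) :=
  [set v | urange e v /\ (size (sig v) < num e)%N].

(** Every vertex of [r(e)] outside [W_+] lies in the finite range of the word of
    length [num e] that describes it. *)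
Lemma near_range_finite e : finite_set (near_range e).
Proof.
set n := num e.
pose F w := if `[< has id w /\ ~ Delta num w >] then rword num w else set0.
apply: (@sub_finite_set _ _ (short n `|` \bigcup_(w in [set` words n]) F w)); last first.
  rewrite finite_setU; split; first exact: short_finite.
  apply: bigcup_finite => [|w _]; first exact: finite_seq.
  rewrite /F; case: asboolP => // -[hw ndw]; exact: not_Delta_finite.
move=> v [ve sv]; have [Wv|nWv] := pselect (Wp num v); first by left.
right; pose w := [seq `[< rnum num i v >] | i <- iota 1 n].
have sw : size w = n by rewrite size_map size_iota.
have bw i : (1 <= i <= n)%N -> bit w i = `[< rnum num i v >].
  case: i => // i /= hi; rewrite /bit (nth_map 0%N) ?size_iota//= nth_iota//.
have n0 : (0 < n)%N := num_gt0 num e.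
have hn : (1 <= n <= n)%N by rewrite n0 leqnn.
have bn : bit w n by rewrite bw//; apply/asboolP; exists e.
have wv : rword num w v by apply/rwordP => i; rewrite sw; exact: bw.
exists w; first by rewrite /= mem_words sw.
rewrite /F; case: asboolP => // -[]; split; last by move=> dw; apply: nWv; exists w.
apply/hasP; exists true => //; rewrite -bn /bit mem_nth// sw.
by case: (n) n0.
Qed.

Lemma p_q v e : urange e v -> p v ** qproj e = p v.
Proof. exact: (el_vertex_in el). Qed.

Lemma psum_q (Y : set (uvertex G)) e : finite_set Y -> Y `<=` urange e ->
  psum Y ** qproj e = psum Y.
Proof.
move=> fY Ye; rewrite fsum_mull//; apply: eq_fsbigr => v /set_mem Yv.
by rewrite p_q//; exact: Ye.
Qed.

(** [q_e] is the sum of the projections of the words of length [num e] ending in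
    1; removing the vertices [v] with [|sigma v| < num e] leaves [R_w] for those
    of them in [Delta] and 0 for the others. *)
Lemma Xset_sum e : exists xs : seq (E0 num),
  [/\ uniq xs, forall x, x \in xs <-> Xset sig e x &
      \sum_(x <- xs) Rvertex x = qproj e].
Proof.
have [m em] : exists m, num e = m.+1.
  by exists (num e).-1; rewrite prednK// num_gt0.
have fY := near_range_finite e.
have uL : uniq [seq rcons w true | w <- words m].
  by rewrite map_inj_uniq ?words_uniq// => x y /rcons_inj[].
have [xs [uxs mxs sxs]] := sum_vertices_words fY uL.
exists xs; split=> //.
  move=> x; split=> [/mxs|h]; last (apply/mxs; move: h); case: x => [v|d] //=.
    move=> /mapP[w]; rewrite mem_words => /eqP wm ->.
    by rewrite em size_rcons wm; split=> //; rewrite -wm bit_last.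
  rewrite em => -[sd bd]; case/lastP: (val d) sd bd => [//|w b].
  rewrite size_rcons => -[wm]; rewrite -wm bit_last => ->.
  by apply: map_f; rewrite mem_words.
rewrite sxs big_map; have -> : qproj e = psum (near_range e) ** qproj e +
    (qproj e - psum (near_range e) ** qproj e) by rewrite addrC subrK.
congr (_ + _); first by rewrite psum_q// => v [].
rewrite -Q_num em Q_sum_words cmul_sumr -sumrB big_seq [RHS]big_seq.
apply: eq_bigr => w; rewrite mem_words => /eqP wm; rewrite cut_short//.
  by rewrite has_rcons.
move=> v wv; rewrite size_rcons wm -em; split=> [[]//|sv]; split=> //.
move/rwordP: wv => /(_ m.+1); rewrite size_rcons wm leqnn -{2}wm bit_last => /(_ isT).
by move/esym/asboolP => [f]; rewrite -em => /(@num_inj _ num) ->.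
Qed.

(** If a vertex of [r(e)] is not itself in [X(e)], the initial segment of length
    [num e] of its word is. *)
Lemma Xset_inhabited e : Xset sig e !=set0.
Proof.
have [v ve] := urange_neq0 e.
have [h|h] := ltnP (size (sig v)) (num e); first by exists (inl v).
have Wv : Wp num v.
  apply: contrapT => nW; move: h.
  by rewrite (sigma_W0 sig nW) leqNgt num_gt0.
have n0 := num_gt0 num e; set n := num e in h n0.
have bn : bit (sig v) n.
  have /rwordP /(_ n) := sigma_rword sig Wv; rewrite n0 h => /(_ isT) ->.
  by apply/asboolP; exists e.
have st : size (take n (sig v)) = n by rewrite size_takel.
have bt : bit (take n (sig v)) n by rewrite /bit nth_take// prednK.
have dw : Delta num (take n (sig v)).
  apply: Delta_take; first exact: sigma_Delta.
  by apply/hasP; exists true => //; rewrite -bt /bit mem_nth// st prednK.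
by exists (inr (DeltaV dw)).
Qed.

(** The relation [s_E(bar x) = w] without the proofs that [sbar] takes as
    arguments. *)
Definition bar_source (w : Delta num) (x : E0 num) : Prop :=
  match x with
  | inl v => Wp num v /\ sig v = val w
  | inr d => Gammap num (val d) /\ take (size (val d)).-1 (val d) = val w
  end.

(** The projection of [w] splits according to the next letter; passing from
    length [|w|] to [|w| + 1] removes in addition the vertices [v] with [sigma v
    = w], which are the ranges of the remaining bars. *)
Lemma bar_sum (w : Delta num) : exists xs : seq (E0 num),
  [/\ uniq xs, forall x, x \in xs <-> bar_source w x &
      \sum_(x <- xs) Rvertex x = Rword (val w)].
Proof.
have dw := set_valP w; have hw := Delta_has dw; set n := size (val w).
have fY : finite_set [set v | Wp num v /\ sig v = val w] by exact: sigma_fin.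
have uL : uniq [:: rcons (val w) true; rcons (val w) false].
  by rewrite /= inE andbT; apply/eqP => /rcons_inj[].
have [xs [uxs mxs sxs]] := sum_vertices_words fY uL.
exists xs; split=> //.
  move=> x; split=> [/mxs|h]; last (apply/mxs; move: h); case: x => [v|d] //=.
    move=> h; have {h} [b db] : exists b, val d = rcons (val w) b.
      by move: h; rewrite !inE => /orP[] /eqP h; [exists true|exists false].
    have := set_valP d; rewrite /= -/(val d) db => ddb.
    rewrite size_rcons /= -cats1 take_size_cat// cats1; split=> //; split=> //.
    move=> [k /rcons_inj[e _] _]; move: hw; rewrite /= e has_nseq /= andbF//.
  move=> [_]; rewrite -/(val d) -/(val w).
  have := Delta_has (set_valP d); rewrite /= -/(val d).
  case/lastP: (val d) => [//|u b] _.
  rewrite size_rcons /= -cats1 take_size_cat// cats1 => ->; rewrite !inE.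
  by case: b; rewrite eqxx ?orbT.
rewrite sxs !big_cons big_nil addr0.
have fs := short_finite.
have hr b : has id (rcons (val w) b) by rewrite has_rcons hw orbT.
have cutE b : (if `[< Delta num (rcons (val w) b) >] then Rword (rcons (val w) b) else 0) =
    wproj (rcons (val w) b) - psum (short n.+1) ** wproj (rcons (val w) b).
  rewrite cut_short// => v vb; rewrite size_rcons; split=> [[]//|sv]; split=> //.
  apply: (Delta_Wp dw); have := @rword_take _ num _ n _ vb.
  by rewrite -cats1 take_size_cat.
rewrite !cutE addrACA -opprD -cmulDr -wproj_split// /Rword.
have -> : psum (short n.+1) ** wproj (val w) =
    psum (short n) ** wproj (val w) + psum [set v | Wp num v /\ sig v = val w].
  rewrite !psum_wproj// /psum (fsbigID (short n)); last first.
    exact: finite_setIl.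
  have eqS (S S' : set (uvertex G)) : S = S' ->
      \sum_(v \in S) p v = \sum_(v \in S') p v by move=> ->.
  congr (_ + _); apply: eqS; apply/seteqP; split=> v.
  - by move=> [[_ wv] sv].
  - by move=> [[Wv sv] wv]; split=> //; split=> //; split=> //; exact: ltnW.
  - move=> [[[Wv sv] wv] ns]; split=> //.
    have ss : size (sig v) = n.
      apply/eqP; rewrite eqn_leq -ltnS sv leqNgt; apply/negP => h; exact: ns.
    by rewrite -(sigma_prefix Wv wv) -/n ?ss// -ss take_size.
  - move=> [Wv sv]; split; last by move=> []; rewrite /short /= sv ltnn.
    by split; [split=> //; rewrite sv | rewrite -sv; exact: sigma_rword].
by zmodule.
Qed.

Lemma bar_level w x : bar_source w x -> level x = (level (inr w)).+1.
Proof.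
have dw := set_valP w; have hw := Delta_has dw.
have [/andP[_ hi] _] := bit_index hw.
case: x => [v|d] /= [].
  by case: pselect => // Wv _ ->; rewrite -/(val w); move: hi; rewrite /=; lia.
move=> [dd _]; move: dd hw hi dw; move=> /=; move: (sval d) (sval w) => u w' du hw' hi dw' ut.
have u0 : (0 < size u)%N by case: (u) (Delta_has du).
have sw : size w' = (size u).-1 by rewrite -ut size_takel ?leq_pred.
have -> : index true u = index true w' by apply: index_prefix => //; rewrite sw.
by move: u0 hi; rewrite sw; lia.
Qed.

Lemma orthogonal_sum_absorb (T : eqType) (xs : seq T) (F : T -> A) x :
  uniq xs -> x \in xs -> F x ** F x = F x ->
  (forall y, y \in xs -> x != y -> F x ** F y = 0) ->
  F x ** (\sum_(y <- xs) F y) = F x.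
Proof.
move=> uxs xxs Fx h; rewrite cmul_sumr (bigD1_seq x)//= Fx big_seq_cond big1 ?addr0//.
by move=> y /andP[yxs]; rewrite eq_sym => yx; exact: h.
Qed.

Lemma Rvertex_idem x : Rvertex x ** Rvertex x = Rvertex x.
Proof. by have [] := Rvertex_proj x. Qed.

Lemma Rvertex_star x : (Rvertex x)^* = Rvertex x.
Proof. by have [] := Rvertex_proj x. Qed.

Lemma Xset_orth e x y : Xset sig e x -> Xset sig e y -> x != y ->
  Rvertex x ** Rvertex y = 0.
Proof.
have pR v w : Xset sig e (inl v) -> Xset sig e (inr w) -> p v ** Rword (val w) = 0.
  move=> [_ sv] [sw _]; rewrite p_Rword; last exact: set_valP.
  by case: asboolP => // -[_]; rewrite -/(val w) sw leqNgt sv.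
case: x y => [v|w] [v'|w'] hx hy ne /=.
- by apply: (el_vertex_orth el); apply: contra ne => /eqP ->.
- exact: pR.
- have dw := Delta_has (set_valP w).
  by rewrite -[LHS]cstarK cstarM p_star Rword_star// pR ?cstar0.
have hw := Delta_has (set_valP w); have hw' := Delta_has (set_valP w').
have [i [hi di]] : exists i, (i < num e)%N /\
    nth false (val w) i <> nth false (val w') i.
  apply: contrapT => hn; move: ne; have -> : w = w'; last by rewrite eqxx.
  apply: val_inj; apply: (@eq_from_nth _ false); first by rewrite hx.1 hy.1.
  by move=> i; rewrite hx.1 => iw; apply: contrapT => d; apply: hn; exists i.
apply: Rword_orth => //; apply: (@wproj_orth _ _ i.+1) => /=.
- by have := hx.1 => /= ->.
- by have := hy.1 => /= ->.
- by rewrite /bit; exact/eqP.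
Qed.

Lemma Rvertex_q e x : Xset sig e x -> Rvertex x ** qproj e = Rvertex x.
Proof.
have [xs [uxs mxs <-]] := Xset_sum e => ex.
apply: orthogonal_sum_absorb => //; [exact/mxs | exact: Rvertex_idem |].
by move=> y /mxs ey; exact: (Xset_orth ex).
Qed.

Lemma Rvertex_bar w x : bar_source w x -> Rvertex x ** Rword (val w) = Rvertex x.
Proof.
have [xs [uxs mxs <-]] := bar_sum w => wx.
apply: orthogonal_sum_absorb => //; [exact/mxs | exact: Rvertex_idem |].
by move=> y /mxs wy xy; apply: (Rvertex_orth xy); rewrite (bar_level wx) (bar_level wy).
Qed.

Lemma s_star_source e : (s e)^* ** p (usource e) = (s e)^*.
Proof.
have := el_final_le el e; rewrite /ple => h.
have hs : (s e)^* ** (s e ** (s e)^*) = (s e)^*.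
  by rewrite -[RHS](congr1 (@cstar _ _) (el_pisom el e)) !cstarM cstarK.
by rewrite -{1}hs -cmulA h hs.
Qed.

Lemma s_star_s e f : e != f -> (s e)^* ** s f = 0.
Proof.
move=> ef; have hs g : (s g)^* ** (s g ** (s g)^*) = (s g)^*.
  by rewrite -[RHS](congr1 (@cstar _ _) (el_pisom el g)) !cstarM cstarK.
have hf : s f = s f ** (s f)^* ** s f by rewrite (el_pisom el).
rewrite -hs hf; have := el_final_orth el ef.
move: (s e ** _) (s f ** _) => x y xy.
by rewrite cmulA -[_ ** x ** y]cmulA xy cmul0r cmul0l.
Qed.

End ExelLacaFamily.

(** * Paths *)

Section Paths.
Variables (R : realType) (E : digraph).

Lemma tpathE (B : cstarType R) (q : dvertex E -> B) (t : dedge E -> B) f :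
  tpath q t f =
  if [seq t b | b <- f.2] is x :: l then foldl (@cmul _ _) x l else q f.1.
Proof. by case: f => x [|a l]. Qed.

(** A path of length 0 is a vertex, and the source projection of a longer path
    is absorbed by its first edge. *)
Lemma foldl_start (B : cstarType R) (x : B) (l : seq B) :
  (if l is a :: _ then x ** a = a else True) ->
  foldl (@cmul _ _) x l = if l is a :: l' then foldl (@cmul _ _) a l' else x.
Proof. by case: l => //= a l ->. Qed.

Lemma tpath_hom (B D : cstarType R) (q : dvertex E -> B) (t : dedge E -> B)
    (h : B -> D) f : star_hom h ->
  h (tpath q t f) = tpath (h \o q) (h \o t) f.
Proof.
move=> hh; case: f => x [//|a l]; rewrite /tpath /=; move: (t a) => y.
elim: l y => //= b l ih y; rewrite ih; congr foldl; exact: (homM hh).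
Qed.

Lemma eq_tpath (B : cstarType R) (q q' : dvertex E -> B) (t t' : dedge E -> B) f :
  q =1 q' -> {in f.2, t =1 t'} -> tpath q t f = tpath q' t' f.
Proof. by move=> qq /eq_in_map tt; rewrite !tpathE qq tt. Qed.

End Paths.

(** * A Cuntz-Krieger family in the stabilization *)

Section Stabilization.
Variables (R : realType) (G : ultragraph) (num : enumeration G).
Variables (A : cstarType R) (p : uvertex G -> A) (s : uedge G -> A).
Hypothesis el : exel_laca_family p s.
Variable sig : sigma_map num.

Local Notation Rv := (Rvertex p s sig).
Local Notation Rw := (Rword p s sig).
Local Notation lev := (level sig).
Local Notation src := (@sE G num sig).
Local Notation barred := (@WGp G num).

Lemma sbar_source (y : E0 num) (hy : WGp y) :
  exists w, sbar sig hy = inr w /\ bar_source sig w y.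
Proof.
case: y hy => [v|d] hy; first by exists (DeltaV (sigma_Delta sig hy)).
by exists (DeltaV (Gammap_belast hy)).
Qed.

Lemma sE_bar (x : barred) : exists w, src (inl x) = inr w /\ bar_source sig w (val x).
Proof. exact: (sbar_source (set_valP x)). Qed.

Lemma sE_bar_neq (x : barred) v : src (inl x) <> inl v.
Proof. by have [w [-> _]] := sE_bar x. Qed.

Lemma bar_sourceP w (y : E0 num) : bar_source sig w y ->
  exists2 x : barred, val x = y & src (inl x) = inr w.
Proof.
move=> wy; have hy : barred y by case: y wy => [v|d] [].
exists (exist _ y (mem_set hy)) => //.
have [u [-> uy]] := sE_bar (exist _ y (mem_set hy)); congr inr; apply: val_inj.
by move: uy => /= uy; case: y wy uy {hy} => [v|d] [_ <-] [_ <-].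
Qed.

(** The element of the ultragraph algebra standing for an edge; the positions of
    source and range are added in [stab_edge]. *)
Definition coef (a : E1 sig) : A :=
  match a with
  | inl x => Rv (val x)
  | inr ex => s (tag ex) ** Rv (val (tagged ex))
  end.

Definition stab_vertex (x : dvertex (ugraph_graph sig)) : stab A :=
  munit (lev x) (lev x) (Rv x).

Definition stab_edge (a : dedge (ugraph_graph sig)) : stab A :=
  munit (lev (src a)) (lev (rE a)) (coef a).

Lemma coef_initial a : (coef a)^* ** coef a = Rv (rE a).
Proof.
case: a => [x|[e x]] /=; first by rewrite Rvertex_star// Rvertex_idem.
rewrite cstarM -cmulA [_ ** (s e ** _)]cmulA Rvertex_star//.
by rewrite cmulA (@Rvertex_q _ _ num _ _ _ el sig e) ?Rvertex_idem//; exact: set_valP.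
Qed.

Lemma coef_mul_range a : coef a ** Rv (rE a) = coef a.
Proof. by case: a => [x|[e x]] /=; rewrite -?cmulA Rvertex_idem. Qed.

Lemma coef_final_source a : coef a ** (coef a)^* ** Rv (src a) = coef a ** (coef a)^*.
Proof.
case: a => [x|[e x]].
  have [w [-> wx]] := sE_bar x; rewrite /= Rvertex_star// Rvertex_idem//.
  exact: Rvertex_bar.
by rewrite /= cstarM -!cmulA (s_star_source el).
Qed.

Lemma coef_orth a b : a != b -> src a = src b -> (coef a)^* ** coef b = 0.
Proof.
case: a b => [x|[e x]] [y|[f y]] ab.
- move=> sxy; rewrite /= Rvertex_star//; apply: (Rvertex_orth el).
    by apply: contra ab => /eqP/val_inj ->.
  have [w [ex wx]] := sE_bar x; have [u [ey uy]] := sE_bar y.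
  rewrite (bar_level wx) (bar_level uy); congr (_.+1); congr level.
  by rewrite -ex -ey.
- by have [w [-> _]] := sE_bar x.
- by have [w [-> _]] := sE_bar y.
move=> _; rewrite /= cstarM -cmulA [X in _ ** X]cmulA.
have [ef|/(s_star_s el) h] := eqVneq e f; last by rewrite h cmul0l cmul0r.
rewrite -{f}ef in y ab *; have ex := set_valP x; have ey := set_valP y.
rewrite cmulA -/(qproj s e) (Rvertex_star el) (Rvertex_q el ex).
apply: (Xset_orth el ex ey); apply: contra ab => /eqP/val_inj ->.
by rewrite eqxx.
Qed.

Lemma sum_subtype (T : choiceType) (P : set T) (xs : seq T) : uniq xs ->
  (forall x, x \in xs -> P x) -> exists ys : seq P,
  [/\ uniq ys, forall y, (y \in ys) = (val y \in xs) &
      forall (V : zmodType) (F : T -> V), \sum_(y <- ys) F (val y) = \sum_(x <- xs) F x].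
Proof.
move=> uxs xsP; exists (pmap insub xs); split.
- exact: pmap_sub_uniq.
- by move=> y; rewrite mem_pmap_sub.
move=> V F; rewrite -(big_map val xpredT F) pmap_filter; last first.
  exact: insubK.
rewrite (all_filterP _)//; apply/allP => x /xsP Px.
by rewrite /= (isSome_insub _ (P := fun x => x \in P)) mem_set.
Qed.

Lemma Xset_enum e : exists ys : seq (Xset sig e),
  [/\ uniq ys, forall y, y \in ys & \sum_(y <- ys) Rv (val y) = qproj s e].
Proof.
have [xs [uxs mxs sxs]] := Xset_sum el sig e.
have [ys [uys mys sys]] := sum_subtype uxs (fun x => (mxs x).1).
exists ys; split=> //; last by rewrite sys.
by move=> y; rewrite mys; apply/mxs; exact: set_valP.
Qed.

Lemma stab_edge_final a : stab_edge a ** (stab_edge a)^* =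
  munit (lev (src a)) (lev (src a)) (coef a ** (coef a)^*).
Proof. by rewrite /stab_edge munit_star munit_mul. Qed.

(** Projections at different diagonal positions are orthogonal for free, so only
    vertices with the same level have to be compared in the ultragraph algebra;
    there [Rvertex_orth] applies. *)
Lemma stab_family : cuntz_krieger_family stab_vertex stab_edge.
Proof.
have st x : (stab_vertex x)^* = stab_vertex x.
  by rewrite /stab_vertex munit_star (Rvertex_star el).
split.
- move=> x; split=> //; by rewrite /stab_vertex munit_mul (Rvertex_idem el).
- move=> a; rewrite /partial_isometry /stab_edge munit_star !munit_mul -cmulA.
  by rewrite coef_initial coef_mul_range.
- move=> x y xy; rewrite /stab_vertex; have [lxy|] := eqVneq (lev x) (lev y).
    by rewrite lxy munit_mul (Rvertex_orth el) ?munit0.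
  by move=> ne; rewrite munit_mul0.
- move=> a b ab; have [lab|ne] := eqVneq (lev (src a)) (lev (src b)); last first.
    by rewrite !stab_edge_final munit_mul0.
  have [sab|ne] := eqVneq (src a) (src b).
    rewrite !stab_edge_final lab munit_mul -cmulA [_ ** (coef b ** _)]cmulA.
    by rewrite coef_orth// cmul0l cmul0r munit0.
  rewrite !stab_edge_final lab munit_mul -(coef_final_source a).
  have -> : coef b ** (coef b)^* = Rv (src b) ** (coef b ** (coef b)^*).
    have := congr1 (@cstar _ _) (coef_final_source b).
    by rewrite !cstarM cstarK (Rvertex_star el) => ->.
  by rewrite cmulA -[_ ** Rv (src b)]cmulA (Rvertex_orth el ne lab) cmul0r cmul0l munit0.
- by move=> a; rewrite /stab_edge /stab_vertex munit_star munit_mul coef_initial.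
- by move=> a; rewrite /ple stab_edge_final /stab_vertex munit_mul coef_final_source.
case=> [v|w] fS nS.
  pose S := [set e | usource e = v].
  have [a0 va0] := nS.
  have [e0 _] : exists e0 : uedge G, True.
    by case: a0 va0 => [x /sE_bar_neq|[e x] _]; last exists e.
  pose edge (a : E1 sig) := if a is inr ex then tag ex else e0.
  have SE : S = edge @` [set a | src a = inl v].
    apply/seteqP; split=> [e ev|_ [[x|[e x]] /= h <-]].
    - have [x ex] := Xset_inhabited sig e.
      by exists (eedge (exist _ x (mem_set ex))) => //=; rewrite -ev.
    - by have := sE_bar_neq h.
    - by case: h.
  have fSS : finite_set S by rewrite SE; exact: finite_image.
  have nSS : S !=set0 by rewrite SE; exists (edge a0); exists a0.
  pose X e := projT1 (cid (Xset_enum e)).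
  have XP e : [/\ uniq (X e), forall y, y \in X e &
      \sum_(y <- X e) Rv (val y) = qproj s e] := projT2 (cid (Xset_enum e)).
  pose es := finmap.enum_fset (fset_set S).
  have ues : uniq es by exact: finmap.fset_uniq.
  pose L : seq (E1 sig) := [seq eedge y | e <- es, y <- X e].
  rewrite (@fsum_seq _ _ _ L); last 2 first.
  - apply: allpairs_uniq_dep => //; first by move=> e _; have [] := XP e.
    by move=> [e x] [f y] _ _ /= [].
  - move=> a; split=> [|/allpairsPdep[e [y [he _ ->]]]]; last first.
      by move: he; rewrite /= in_fset_set// => /set_mem ->.
    case: a => [x /sE_bar_neq|[e x]]//.
    move=> [ev]; apply/allpairsPdep; exists e, x; split=> //; last by have [] := XP e.
    by rewrite in_fset_set//; exact/mem_set.
  rewrite big_allpairs_dep /stab_vertex.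
  transitivity (\sum_(e <- es) munit (lev (inl v)) (lev (inl v)) (s e ** (s e)^*)).
    by rewrite -munit_sum -fsbig_finite//; congr munit; exact: (el_sum el fSS nSS).
  rewrite big_seq [RHS]big_seq; apply: eq_bigr => e.
  rewrite in_fset_set// => /set_mem ev.
  under eq_bigr => y _.
    rewrite stab_edge_final /= ev cstarM cmulA -[s e ** _ ** _]cmulA (Rvertex_star el).
    rewrite (Rvertex_idem el); over.
  rewrite -munit_sum -cmul_suml -cmul_sumr; have [_ _ ->] := XP e.
  by rewrite (s_q el).
have [xs [uxs mxs sxs]] := bar_sum el sig w.
have xsW x : x \in xs -> barred x by move=> /mxs; case: x => [v|d] [].
have [ys [uys mys sys]] := sum_subtype uxs xsW.
rewrite (@fsum_seq _ _ _ [seq inl y | y <- ys]); last 2 first.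
- by rewrite map_inj_uniq// => x y [].
- move=> a; split=> [|/mapP[y + ->]]; last first.
    rewrite mys => /mxs/bar_sourceP[x xy] <-.
    by rewrite /= (val_inj xy).
  case: a => [x|[e x]] //= h; rewrite map_f// mys; apply/mxs.
  by have [u [hu ux]] := sbar_source (set_valP x); move: hu ux; rewrite h => -[<-].
rewrite big_map /stab_vertex /= -[Rword _ _ _ _]sxs -sys munit_sum.
rewrite big_seq [RHS]big_seq; apply: eq_bigr => y yys.
have ay : src (inl y) = inr w.
  by move: yys; rewrite mys => /mxs/bar_sourceP[x /val_inj ->].
by rewrite stab_edge_final ay /= (Rvertex_star el) (Rvertex_idem el).
Qed.

Lemma bar_mul w x : bar_source sig w x -> Rw (val w) ** Rv x = Rv x.
Proof.
move=> wx; have := congr1 (@cstar _ _) (Rvertex_bar el wx).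
by rewrite cstarM (Rvertex_star el) (Rword_star el) ?(Delta_has (set_valP w)).
Qed.

Lemma stab_bar (x : barred) n : lev (val x) = n.+1 ->
  stab_edge (inl x) = munit n n.+1 (Rv (val x)).
Proof.
move=> lx; have [w [sx wx]] := sE_bar x; rewrite /stab_edge sx /= lx.
by have := bar_level wx; rewrite lx => -[<-].
Qed.

Lemma level_word (w : Delta num) :
  lev (inr w) = (size (val w) - (index true (val w)).+1)%N.
Proof. by []. Qed.

Lemma take_first_level (w : Delta num) i (d : Delta num) :
  let m := (index true (val w)).+1 in
  (m + i <= size (val w))%N -> val d = take (m + i) (val w) -> lev (inr d) = i.
Proof.
move=> m hi ed; rewrite level_word ed size_takel//.
have -> : index true (take (m + i) (val w)) = index true (val w).
  have tw : true \in take (m + i) (val w).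
    rewrite in_take ?addSn ?ltnS ?leq_addr//.
    by case/hasP: (Delta_has (set_valP w)) => -[].
  by rewrite -{2}(cat_take_drop (m + i) (val w)) index_cat tw.
by rewrite -/m addKn.
Qed.

(** The bars of [f_w] move one position at a time and the projections of the
    initial segments of [w] decrease. *)
Lemma stab_fword (w : Delta num) :
  tpath stab_vertex stab_edge (fword sig w) = munit 0 (lev (inr w)) (Rw (val w)).
Proof.
rewrite tpathE.
set m := (index true (val w)).+1; set k := lev (inr w).
have [/andP[_ hm] _] := bit_index (Delta_has (set_valP w)).
have mk : (m + k = size (val w))%N by rewrite /k level_word -/m subnKC.
pose pre i := take (m + i) (val w).
have dpre i : Delta num (pre i).
  apply: Delta_take; first exact: set_valP.
  apply/hasP; exists true => //; rewrite in_take ?addSn ?ltnS ?leq_addr//.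
  by case/hasP: (Delta_has (set_valP w)) => -[].
have lpre i (d : Delta num) : (i <= k)%N -> val d = pre i -> lev (inr d) = i.
  by move=> ik; apply: take_first_level; rewrite -mk leq_add2l.
have -> : [seq stab_edge b | b <- (fword sig w).2] =
    [seq munit i i.+1 (Rw (pre i.+1)) | i <- iota 0 k].
  rewrite /fword /= -val_enum_ord -!map_comp; apply/eq_map => i.
  rewrite /= /bar_word /bar.
  set y := exist _ _ _ : barred.
  rewrite (@stab_bar y i)//.
  by apply: lpre => //; exact: ltn_ord.
have step i : (i < k)%N -> Rw (pre i) ** Rw (pre i.+1) = Rw (pre i.+1).
  move=> ik; apply: (@bar_mul (DeltaV (dpre i)) (inr (DeltaV (dpre i.+1)))).
  have hk : (m + i.+1 <= size (val w))%N by rewrite -mk leq_add2l.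
  split; first by apply: Gammap_take; [exact: set_valP | rewrite hk -/m addnS ltnS leq_addr].
  by rewrite /= size_takel// /pre addnS /= take_takel.
have -> : stab_vertex (fword sig w).1 = munit 0 0 (Rw (pre 0)).
  rewrite /stab_vertex (lpre 0%N (DeltaV (Delta_first (set_valP w))))//=.
    by rewrite /pre addn0.
  by rewrite /pre addn0.
rewrite -foldl_start; last first.
  by case: k step {mk lpre} => //= k step; rewrite munit_mul step.
suff h n : (n <= k)%N -> foldl (@cmul _ _) (munit 0 0 (Rw (pre 0)))
    [seq munit i i.+1 (Rw (pre i.+1)) | i <- iota 0 n] = munit 0 n (Rw (pre n)).
  by rewrite h// /pre mk take_size.
elim: n => [//|n ih] nk; rewrite -addn1 iotaD map_cat foldl_cat ih ?(ltnW nk)//=.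
by rewrite add0n munit_mul step// addn1.
Qed.

Lemma stab_path x : tpath stab_vertex stab_edge (fvertex sig x) = munit 0 (lev x) (Rv x).
Proof.
case: x => [v|w]; last exact: stab_fword.
rewrite /fvertex; case: pselect => hv; last first.
  have l0 : lev (inl v) = 0%N by rewrite /=; case: pselect.
  by rewrite l0 tpathE [LHS]/= /stab_vertex l0.
set w := DeltaV (sigma_Delta sig hv); set b := bar _ _.
have wv : bar_source sig w (inl v) by [].
have lv := bar_level wv.
have eb : stab_edge b = munit (lev (inr w)) (lev (inr w)).+1 (p v).
  by rewrite (@stab_bar (exist _ (inl v) _) _ lv).
have := stab_fword w; have : size (fword sig w).2 = lev (inr w).
  by rewrite size_map size_enum_ord.
rewrite {}lv; move: (lev (inr w)) eb => n eb.
case: (fword sig w) => y [|a l] /=; first by move=> n0 _; rewrite /tpath /= eb -n0.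
move=> _; rewrite /tpath /= => hl; rewrite map_rcons -cats1 foldl_cat hl /= eb munit_mul.
by have := bar_mul wv => /= ->.
Qed.

Lemma Xset_finite e : finite_set [set: Xset sig e].
Proof.
have [ys [_ mys _]] := Xset_enum e; apply: (@sub_finite_set _ _ [set` ys]).
  by move=> y _; exact: mys.
exact: finite_seq.
Qed.

Lemma stab_Pvertex v : Pvertex stab_vertex stab_edge v = munit 0 0 (p v).
Proof. by rewrite /Pvertex /Upath stab_path munit_star munit_mul /= (p_star el) (p_idem el). Qed.

Lemma stab_Sedge e : Sedge stab_vertex stab_edge e = munit 0 0 (s e).
Proof.
have [ys [uys mys sys]] := Xset_enum e.
rewrite /Sedge (@fsum_seq _ _ _ ys)// /Upath.
under eq_bigr => y _.
  rewrite stab_path munit_star (Rvertex_star el) /stab_edge munit_mul /=.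
  rewrite -cmulA (Rvertex_idem el); over.
rewrite -munit_sum -cmul_sumr sys (s_q el) stab_path munit_mul.
have := congr1 (@cstar _ _) (s_star_source el e).
by rewrite cstarM cstarK (p_star el) => /= ->.
Qed.

End Stabilization.

Section Family.
Variables (G : ultragraph) (num : enumeration G) (sig : sigma_map num).
Variables (R : realType).

Lemma fvertex_bar x a : a \in (fvertex sig x).2 -> exists y, a = inl y.
Proof.
have fw w : a \in (fword sig w).2 -> exists y, a = inl y.
  by move=> /mapP[i _ ->]; rewrite /bar_word /bar; eexists.
case: x => [v|w]; last exact: fw.
rewrite /fvertex; case: pselect => // hv; rewrite mem_rcons inE => /orP[/eqP ->|/fw//].
by rewrite /bar; eexists.
Qed.

Variables (B D : cstarType R) (q : dvertex (ugraph_graph sig) -> B).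
Variables (t : dedge (ugraph_graph sig) -> B) (h : B -> D).
Hypothesis hh : star_hom h.

Lemma Upath_hom x : h (Upath q t x) = Upath (h \o q) (h \o t) x.
Proof. exact: tpath_hom. Qed.

Lemma Pvertex_hom v : h (Pvertex q t v) = Pvertex (h \o q) (h \o t) v.
Proof. by rewrite /Pvertex (homM hh) (homS hh) Upath_hom. Qed.

Lemma Sedge_hom e : finite_set [set: Xset sig e] ->
  h (Sedge q t e) = Sedge (h \o q) (h \o t) e.
Proof.
move=> fX; rewrite /Sedge (homM hh) Upath_hom !fsbig_finite// (hom_sum hh).
congr (_ ** _); apply: eq_bigr => x _.
by rewrite (homM hh) (homS hh) Upath_hom.
Qed.

End Family.

(** * The gauge actions *)

Lemma conj_mul_unit (R : realType) (c : complex R) : `|c| = 1 -> c * Num.conj c = 1.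
Proof. by move=> c1; rewrite -normCK c1 expr1n. Qed.

Lemma cuntz_krieger_scale (R : realType) (E : digraph) (B : cstarType R)
    (q : dvertex E -> B) (t : dedge E -> B) (c : dedge E -> complex R) :
  (forall a, `|c a| = 1) -> cuntz_krieger_family q t ->
  cuntz_krieger_family q (fun a => c a *: t a).
Proof.
move=> c1 ck; have cc a := conj_mul_unit (c1 a).
have fin a : (c a *: t a) ** (c a *: t a)^* = t a ** (t a)^*.
  by rewrite cstarZ cmulZl cmulZr scalerA cc scale1r.
split.
- exact: (ck_proj ck).
- by move=> a; rewrite /partial_isometry fin cmulZr (ck_pisom ck).
- exact: (ck_vertex_orth ck).
- by move=> a b ab; rewrite !fin (ck_final_orth ck).
- move=> a; rewrite cstarZ cmulZl cmulZr scalerA mulrC cc scale1r.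
  exact: (ck_initial ck).
- by move=> a; rewrite fin; exact: (ck_final_le ck).
- by move=> x fx nx; under eq_fsbigr do rewrite fin; exact: (ck_sum ck).
Qed.

Lemma weighted_action_exists (R : realType) (E : digraph) (B : cstarType R)
    (q : dvertex E -> B) (t : dedge E -> B) (k : dedge E -> nat) :
  graph_algebra q t -> exists g, weighted_action q t k g.
Proof.
move=> hB.
have hz (z : complex R) : exists g : B -> B, `|z| = 1 ->
    [/\ star_hom g, forall x, g (q x) = q x & forall a, g (t a) = z ^+ k a *: t a].
  have [z1|z1] := pselect (`|z| = 1); last by exists id.
  have [|g hg] := universal_hom hB (p' := q) (s' := fun a => z ^+ k a *: t a).
    apply: cuntz_krieger_scale (universal_family hB) => a.
    by rewrite normrX z1 expr1n.
  by exists g.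
exists (fun z => projT1 (cid (hz z))); split=> z.
- by move=> /(projT2 (cid (hz z)))[].
- by move=> x /(projT2 (cid (hz z)))[].
- by move=> a /(projT2 (cid (hz z)))[].
Qed.

Section GaugeWeights.
Variables (G : ultragraph) (num : enumeration G) (sig : sigma_map num).
Local Notation graph := (ugraph_graph sig).

(** The degrees for the circle action that fixes the bars. *)
Definition edge_weight (a : dedge graph) : nat := if a is inl _ then 0%N else 1%N.

Lemma finite_degree1 (E : digraph) : finite_degree (fun _ : dedge E => 1%N).
Proof. by move=> F; exists (fun m _ => m) => a m _ m1; lia. Qed.

Lemma bar_edge_level (x : @WGp G num) :
  level sig (val x) = (level sig (sE (inl x : E1 sig))).+1.
Proof. by have [w [-> wx]] := sE_bar sig x; exact: bar_level. Qed.

(** Along bars the level increases up to its maximum over the given edges; only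
    a step of weight 1 can lower it. *)
Lemma finite_degree_edge_weight : finite_degree edge_weight.
Proof.
move=> F; pose D := (\max_(a <- F) level sig (drange a))%N.
(* Between two steps of weight 1 there are at most [D] bars. *)
exists (fun m x => m * D.+1 + (D - level sig x))%N => a m aF.
have : (level sig (drange a) <= D)%N by exact: leq_bigmax_seq.
have : (level sig (drange a) = (level sig (dsource a)).+1)%N \/ edge_weight a = 1%N.
  by case: a {aF} => [x|]; [left; exact: bar_edge_level | right].
have : (edge_weight a <= 1)%N by case: (a).
move: (level _ _) (level _ _) (edge_weight a) => r s k; case: k => [|[|//]] _.
  by case=> // -> sD _; rewrite subn0 ltn_add2l; lia.
by move=> _ rD; case: m => // m _; rewrite subn1 mulSn; lia.
Qed.

End GaugeWeights.

(** * The corner *)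

Section Corner.
Variables (R : realType) (G : ultragraph) (num : enumeration G) (sig : sigma_map num).
Variables (A : cstarType R) (p : uvertex G -> A) (s : uedge G -> A).
Hypothesis hA : ultragraph_algebra p s.
Variables (B : cstarType R) (q : dvertex (ugraph_graph sig) -> B).
Variables (t : dedge (ugraph_graph sig) -> B).
Hypothesis hB : graph_algebra q t.
Variable phi : A -> B.
Hypothesis hphi : star_hom phi.
Hypothesis phip : forall v, phi (p v) = Pvertex q t v.
Hypothesis phis : forall e, phi (s e) = Sedge q t e.

Let el := universal_family hA.

(** The homomorphism into the stabilization takes [phi a] to [munit 0 0 a], and
    the preimage of [stab_ideal I] contains the ideal generated by [phi @` I]. *)
Lemma corner_ideal (I : set A) a : closed_ideal I ->
  ideal_generated (phi @` I) (phi a) -> I a.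
Proof.
move=> cI; have [psi [hpsi psiq psit]] := universal_hom hB (stab_family el sig).
have eq1 : psi \o q = stab_vertex p s (sig := sig) by apply/funext => x; exact: psiq.
have eq2 : psi \o t = stab_edge p s (sig := sig) by apply/funext => x; exact: psit.
have psiphi b : psi (phi b) = munit 0 0 b.
  move: b; apply: (hom_eq_generated (universal_generated hA) (hom_comp hpsi hphi)).
    exact: munit_diag_hom.
  move=> _ [[v _ <-]|[e _ <-]] /=.
    by rewrite phip (Pvertex_hom _ _ hpsi) eq1 eq2 stab_Pvertex.
  by rewrite phis (Sedge_hom _ _ hpsi (Xset_finite el sig e)) eq1 eq2 stab_Sedge.
have cJ := hom_preim_ideal hpsi (stab_ideal_ideal cI).
move=> /(_ _ (conj cJ _)) h; apply/(munit_ideal cI 0 0); rewrite -psiphi; apply: h.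
by move=> _ [b Ib <-]; rewrite /preimage /= psiphi; apply/munit_ideal.
Qed.

Variables (gA : complex R -> A -> A) (bet : complex R -> B -> B).
Hypothesis hgA : gauge_action p s gA.
Hypothesis hbet : weighted_action q t (edge_weight (sig := sig)) bet.

(** Both sides agree on generators: the paths [f_x] consist of bars. *)
Lemma corner_gauge z a : `|z| = 1 -> bet z (phi a) = phi (gA z a).
Proof.
move=> z1; have hz := weighted_hom hbet z1.
have hg := circle_action_hom (gauge_circle hgA) z1.
move: a; apply: (hom_eq_generated (universal_generated hA) (hom_comp hz hphi)).
  exact: hom_comp hphi hg.
have Uz x : Upath (bet z \o q) (bet z \o t) x = Upath q t x.
  apply: eq_tpath => [y|a /fvertex_bar[y ->]] /=; first exact: (weighted_vertex hbet).
  by rewrite (weighted_edge hbet)// expr0 scale1r.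
move=> _ [[v _ <-]|[e _ <-]] /=.
  by rewrite (gauge_vertex hgA)// phip (Pvertex_hom _ _ hz) /Pvertex Uz.
have fX := Xset_finite el sig e.
rewrite (gauge_edge hgA)// (homZ hphi) phis (Sedge_hom _ _ hz)// /Sedge Uz.
rewrite -cmulZr; congr (_ ** _); rewrite !fsbig_finite// scaler_sumr.
apply: eq_bigr => x _; rewrite Uz /= (weighted_edge hbet)// expr1 cmulZl.
by [].
Qed.

(** Preimages of ideals under the automorphisms [bet z] are ideals; conversely
    [I] is the preimage of the generated ideal. *)
Lemma corner_invariant (I : set A) : closed_ideal I ->
  action_invariant gA I <-> action_invariant bet (ideal_generated (phi @` I)).
Proof.
move=> cI; have cJ := ideal_generated_ideal (phi @` I).
have sub : phi @` I `<=` ideal_generated (phi @` I) by exact: sub_ideal_generated.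
split=> inv z z1 => [b Jb|a Ia].
  have hz := weighted_hom hbet z1.
  apply: (Jb (bet z @^-1` ideal_generated (phi @` I))); split.
    exact: hom_preim_ideal.
  move=> _ [a Ia <-]; rewrite /preimage /= corner_gauge//.
  by apply: sub; exists (gA z a) => //; exact: inv.
apply: corner_ideal => //; rewrite -corner_gauge//; apply: inv => //.
by apply: sub; exists a.
Qed.

End Corner.

Theorem proposition6p10 (R : realType) (G : ultragraph) (en : enumeration G)
  (sig : sigma_map en)
  (A : cstarType R) (p : uvertex G -> A) (s : uedge G -> A)
  (gA : complex R -> A -> A)
  (hA : ultragraph_algebra p s) (hgA : gauge_action p s gA)
  (B : cstarType R) (q : dvertex (ugraph_graph sig) -> B)
  (t : dedge (ugraph_graph sig) -> B)
  (gB : complex R -> B -> B)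
  (hB : graph_algebra q t) (hgB : gauge_action q t gB)
  (phi : A -> B) (hphi : star_hom phi)
  (phip : forall v, phi (p v) = Pvertex q t v)
  (phis : forall e, phi (s e) = Sedge q t e)
  (I : set A) (hI : closed_ideal I) :
  action_invariant gA I <-> action_invariant gB (ideal_generated (phi @` I)).
Proof.
have [bet hbet] := weighted_action_exists (edge_weight (sig := sig)) hB.
have ck := universal_family hB; have gen := universal_generated hB.
have hgB1 : weighted_action q t (fun=> 1%N) gB.
  split=> [z z1|z x z1|z a z1]; first exact: (circle_action_hom (gauge_circle hgB) z1).
    exact: (gauge_vertex hgB).
  by rewrite expr1 (gauge_edge hgB).
have cJ := ideal_generated_ideal (phi @` I).
rewrite (corner_invariant hA hB hphi phip phis hgA hbet hI).
split=> inv z z1 b Jb.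
  by apply: (weighted_action_ideal ck hbet hgB1 z1 cJ _ gen inv Jb);
    exact: finite_degree_edge_weight.
by apply: (weighted_action_ideal ck hgB1 hbet z1 cJ _ gen inv Jb);
  exact: finite_degree1.
Qed.
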